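(* Let $\phi:\mathbb{R}\to\mathbb{C}$ be a $C^\infty$ function such that: (i) $\operatorname{supp}\phi\subset[-1/4-\delta,1/4+\delta]$ for some $0<\delta\le 1/4$; (ii) $\sum_{k\in\mathbb{Z}}|\phi(\xi+k/2)|^2=1$ for all $\xi\in\mathbb{R}$; (iii) $\phi^{(m)}(0)=0$ for all $m\ge 1$. Define $f_j\in L^2(\mathbb{R})$, $j=0,1,2,\ldots$, by $$\widehat f_0(\xi)=\begin{cases}\phi(\xi-1/4) & \xi>1/4,\\ \phi(0) & |\xi|\le 1/4,\\ \phi(\xi+1/4) & \xi<-1/4,\end{cases}$$ $$\widehat f_j(\xi)=\overline{\phi(\xi-j/2-1/4)}^{(j)}+(-1)^j\,\overline{\phi(\xi+j/2+1/4)}^{(j)}\qquad\text{for } j\ge 1.$$ For $\mathbf j=(j_1,\ldots,j_n)\in\mathbb{N}_0^n$ define $w_{\mathbf j}(x_1,\ldots,x_n)=\prod_{i=1}^nf_{j_i}(x_i)$ on $\mathbb{R}^n$. Then the shift invariant system $\{T_{\mathbf k}w_{\mathbf j}:\mathbf k\in\mathbb{Z}^n,\ \mathbf j\in\mathbb{N}_0^n\}$ is an orthonormal basis of $L^2(\mathbb{R}^n)$.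
   Context: $\mathbb{N}_0=\{0,1,2,\ldots\}$. The Fourier transform on $\mathbb{R}$ is $\widehat f(\xi)=\int_{\mathbb{R}}f(x)e^{-2\pi ix\xi}dx$, and $T_{\mathbf k}f(x)=f(x-\mathbf k)$. For $z\in\mathbb{C}$ and an integer $j$, $\overline z^{(j)}$ denotes $\overline z$ (complex conjugate) if $j$ is odd, and $z$ if $j$ is even. In (iii), $\phi^{(m)}$ denotes the $m$-th derivative. *)

(* Defs.v *)
From HB Require Import structures.
From mathcomp Require Import all_boot all_order all_algebra.
From mathcomp Require Import all_classical all_reals all_analysis.
From mathcomp Require Import complex.

Set Implicit Arguments.
Unset Strict Implicit.
Unset Printing Implicit Defensive.

Import Order.TTheory GRing.Theory Num.Theory.
Import numFieldNormedType.Exports.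
Import ComplexField.Normc.

Local Open Scope classical_set_scope.
Local Open Scope complex_scope.
Local Open Scope ring_scope.

(* R^n, with the product of the Borel sigma-algebras of R *)
Notation euclid R n := (n.-tuple (measurableTypeR R)).

Section euclidean_lebesgue_measure.
Variable R : realType.

Definition econs n (z : euclid R n * measurableTypeR R) : euclid R n.+1 :=
  [tuple of z.2 :: z.1].

Lemma measurable_econs n : measurable_fun setT (@econs n).
Proof. exact: measurable_cons. Qed.

Definition cons_measure n (mu : {measure set (euclid R n) -> \bar R}) :
    set (euclid R n.+1) -> \bar R :=
  pushforward (mu \x (@lebesgue_measure R))%E (@econs n).

Section cons_measure_is_measure.
Variables (n : nat) (mu : {measure set (euclid R n) -> \bar R}).

Let cons_measure0 : cons_measure mu set0 = 0%E.
Proof. by rewrite /cons_measure /pushforward preimage_set0 measure0. Qed.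

Let cons_measure_ge0 A : (0 <= cons_measure mu A)%E.
Proof. by rewrite /cons_measure /pushforward measure_ge0. Qed.

Let cons_measure_sigma_additive : semi_sigma_additive (cons_measure mu).
Proof.
move=> F mF tF mUF.
have mE := @measurable_econs n.
rewrite /cons_measure /pushforward preimage_bigcup.
apply: (@measure_semi_sigma_additive _ _ _ (mu \x (@lebesgue_measure R))%E).
- by move=> i; rewrite -[X in measurable X]setTI; exact: mE.
- apply/trivIsetP => /= i j _ _ ij; rewrite -preimage_setI.
  by move/trivIsetP : tF => /(_ _ _ _ _ ij) ->//; rewrite preimage_set0.
- by rewrite -preimage_bigcup -[X in measurable X]setTI; exact: mE.
Qed.

HB.instance Definition _ := isMeasure.Build _ _ _ (cons_measure mu)
  cons_measure0 cons_measure_ge0 cons_measure_sigma_additive.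

End cons_measure_is_measure.

Fixpoint lebesgue_measure_n n : {measure set (euclid R n) -> \bar R} :=
  match n with
  | 0%N => \d_([tuple] : euclid R 0)
  | n'.+1 => cons_measure (lebesgue_measure_n n')
  end.

Lemma lebesgue_measure_n_box n (A : 'I_n -> set (measurableTypeR R)) :
  (forall i, measurable (A i)) ->
  lebesgue_measure_n n [set x | forall i, A i (tnth x i)] =
  (\prod_(i < n) lebesgue_measure (A i))%E.
Proof.
elim: n A => [|n ih] A mA /=.
  by rewrite big_ord0 diracE mem_set//= => -[].
rewrite /cons_measure /pushforward big_ord_recl muleC.
rewrite -ih// -product_measure1E//; last first.
  rewrite [X in measurable X](_ : _ =
    \bigcap_i ((@tnth _ _)^~ i @^-1` A (lift ord0 i))); last first.
    by apply/seteqP; split=> x /= Ax i; [move=> _; exact: Ax|exact: Ax i I].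
  apply: fin_bigcap_measurable => // i _.
  by rewrite -[X in measurable X]setTI; exact: measurable_tnth.
congr (_ _); apply/seteqP; split=> [[x y] /= Axy|[x y] /= [Ax Ay] i].
  by split=> [i|]; [have := Axy (lift ord0 i); rewrite tnthS|exact: Axy ord0].
by case: (unliftP ord0 i) => [j ->|->//]; rewrite tnthS.
Qed.

End euclidean_lebesgue_measure.

Section complex_L2.
Context d (T : measurableType d) (R : realType).
Variable mu : {measure set T -> \bar R}.
Implicit Types f g : T -> R[i].

(* Only meaningful for f integrable: \int f = \int Re f + i \int Im f *)
Definition cintegral f : R[i] :=
  (\int[mu]_x complex.Re (f x)) +i* (\int[mu]_x complex.Im (f x)).

Definition cmeasurable f : Prop :=
  measurable_fun setT (fun x => complex.Re (f x)) /\
  measurable_fun setT (fun x => complex.Im (f x)).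

Definition cLnorm (p : \bar R) f : \bar R :=
  Lnorm mu p (fun x => (normc (f x))%:E).

Definition in_Lp (p : \bar R) f : Prop :=
  cmeasurable f /\ (cLnorm p f < +oo)%E.

Definition L2_inner f g : R[i] := cintegral (fun x => f x * (g x)^*%C).

(* Functions stand for their classes modulo equality mu-almost everywhere. *)
Definition orthonormal_basis_L2 (I : eqType) (e : I -> T -> R[i]) : Prop :=
  [/\ forall i, in_Lp 2%:E (e i),
      forall i j, L2_inner (e i) (e j) = (i == j)%:R &
      forall h, in_Lp 2%:E h -> forall eps : R, 0 < eps ->
        exists (s : seq I) (c : I -> R[i]),
          (cLnorm 2%:E (fun x => h x - \sum_(i <- s) c i * e i x)%R
             < eps%:E)%E].

End complex_L2.

Section fourier.
Variable R : realType.
Implicit Types (f g phi : R -> R[i]) (xi : R).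

Definition cis (t : R) : R[i] := cos t +i* sin t.

Definition fourier f xi : R[i] :=
  cintegral (@lebesgue_measure R) (fun x => f x * cis (- (2 * pi * x * xi))).

(* g is the Fourier transform of f for the extension by continuity, from
   L^1 `&` L^2 to L^2, of the transform given by the integral *)
Definition is_fourier_L2 f g : Prop :=
  [/\ in_Lp (@lebesgue_measure R) 2%:E f,
      in_Lp (@lebesgue_measure R) 2%:E g &
      exists u : nat -> R -> R[i],
        [/\ forall m, in_Lp (@lebesgue_measure R) 1%:E (u m),
            forall m, in_Lp (@lebesgue_measure R) 2%:E (u m),
            cLnorm (@lebesgue_measure R) 2%:E (fun x => u m x - f x)
              @[m --> \oo] --> 0%E &
            cLnorm (@lebesgue_measure R) 2%:E
                (fun xi => fourier (u m) xi - g xi)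
              @[m --> \oo] --> 0%E]].

(* Derivatives in a real variable are taken componentwise, as R[i] has no
   structure of normed module over R. *)
Definition smooth phi : Prop := forall (m : nat) (x : R),
  derivable (derive1n m (fun t => complex.Re (phi t))) x 1 /\
  derivable (derive1n m (fun t => complex.Im (phi t))) x 1.

Definition cderiv1n (m : nat) phi (x : R) : R[i] :=
  derive1n m (fun t => complex.Re (phi t)) x +i*
  derive1n m (fun t => complex.Im (phi t)) x.

Definition conj_parity (j : nat) (z : R[i]) : R[i] := if odd j then z^*%C else z.

Definition wilson_hat phi (j : nat) xi : R[i] :=
  if j == 0%N then
    if xi > 1 / 4 then phi (xi - 1 / 4)
    else if xi < - (1 / 4) then phi (xi + 1 / 4)
    else phi 0
  else conj_parity j (phi (xi - j%:R / 2 - 1 / 4))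
       + (- 1) ^+ j * conj_parity j (phi (xi + j%:R / 2 + 1 / 4)).

End fourier.

Section tensor_system.
Variables (R : realType) (n : nat).

Definition tensor (f : nat -> R -> R[i]) (j : n.-tuple nat) (x : euclid R n) :
    R[i] :=
  \prod_(i < n) f (tnth j i) (tnth x i).

Definition translate (k : n.-tuple int) (f : euclid R n -> R[i])
    (x : euclid R n) : R[i] :=
  f [tuple (tnth x i : R) - (tnth k i)%:~R | i < n].

End tensor_system.

(* Main.v *)
(* On the Fourier side the translates of [f j] are the functions
   [cis (- 2 pi k xi) * wilson_hat phi j xi], and by Plancherel it suffices to
   treat these when [n = 1].

   Orthonormality.  The inner products are Fourier coefficients, at integer
   frequencies, of products [wilson_hat phi i * conj (wilson_hat phi j)].
   These products vanish if [|i - j| >= 2]; if [j = i + 1] the product is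
   [F xi - F (xi + j)], whose coefficients vanish as [j] is an integer; and if
   [i = j], condition (ii) writes it as the indicator function of a fundamental
   domain of [R/Z] plus differences of the form [F xi - F (xi + l)], [l]
   an integer.

   Completeness.  By (ii) again, [\sum_j |wilson_hat phi j|^2 = 1].  If [h] is
   supported in an interval of length 1, Parseval for Fourier series gives
   [\sum_(k, j) |<h, (k, j)>|^2 = \sum_j ||h * wilson_hat phi j||^2 = ||h||^2],
   and a function is the limit of finite sums of functions of this kind.

   In dimension [n], products of elements of an orthonormal basis of [L^2(R)]
   are orthonormal by Fubini, and total since indicators of boxes are in their
   closed span.

   The trigonometric system is total because the sign of [sin] is a pointwise
   bounded limit of polynomials in [sin], so that the indicators of intervals
   are in its closed span; Plancherel's identity for a compactly supported
   function then follows from Parseval's identity by integrating over the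
   frequencies in a period. *)
Require Import Defs.
From HB Require Import structures.
From mathcomp Require Import all_boot all_order all_algebra.
From mathcomp Require Import all_classical all_reals all_analysis.
From mathcomp Require Import measurable_realfun.
From mathcomp Require Import complex.
From mathcomp Require Import zify ring lra.

Set Implicit Arguments.
Unset Strict Implicit.
Unset Printing Implicit Defensive.

Import Order.TTheory GRing.Theory Num.Theory.
Import numFieldNormedType.Exports.
Import ComplexField.Normc.

Local Open Scope classical_set_scope.
Local Open Scope complex_scope.
Local Open Scope ring_scope.

(* In [ring_scope], MathComp reads [z^*] as [Num.conj z]. *)
Local Notation "z ^*" := (conjc z) : ring_scope.


(** * Square-integrable complex functions *)

(** The hypothesis on [f j] only says that [f j] and [wilson_hat phi j] are limits in L^2, along one
    sequence, of integrable functions and of their integral transforms, and no inverse transform is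
    constructed. The Fourier side is therefore handled through pairs of functions of equal norm
    ([fourier_pair]), and totality is pulled back by transforming only truncations, which lie in
    both L^1 and L^2.

    Density arguments share one form: the functions with the wanted property form a closed subspace
    ([csub]), so it is enough to look at generators.

    The alternating conjugation in [wilson_hat] comes from the overlap of the indices j and j + 1.
    Its part on the negative axis is an integer translate of its part on the positive axis, with the
    two values of [phi] exchanged. Conjugating one index out of two makes the overlap a product of
    two values of [phi], both conjugated or both not, hence symmetric under this exchange; the sign
    (-1)^j then turns the sum of the two parts into a difference. *)

Section complex_facts.
Variable R : realType.
Implicit Types z w : R[i].

(** Squared moduli are polynomial in the real and imaginary parts, so that most L^2 estimates below
    involve no square root. *)
Definition sqn z : R := complex.Re z ^+ 2 + complex.Im z ^+ 2.

Lemma sqn_ge0 z : 0 <= sqn z.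
Proof. by rewrite addr_ge0 ?sqr_ge0. Qed.

Lemma normc_sqr z : normc z ^+ 2 = sqn z.
Proof. by case: z => a b; rewrite /= sqr_sqrtr// addr_ge0 ?sqr_ge0. Qed.

Lemma sqn0 : sqn 0 = 0. Proof. by rewrite /sqn/= expr0n addr0. Qed.

Lemma sqn1 : sqn 1 = 1. Proof. by rewrite /sqn/= expr0n addr0 expr1n. Qed.

Lemma sqnN z : sqn (- z) = sqn z.
Proof. by case: z => a b; rewrite /sqn/= !sqrrN. Qed.

Lemma sqnM z w : sqn (z * w) = sqn z * sqn w.
Proof. by case: z w => [a b] [c d]; rewrite /sqn/=; ring. Qed.

Lemma sqn_conjc z : sqn z^* = sqn z.
Proof. by case: z => a b; rewrite /sqn/= sqrrN. Qed.

Lemma sqn_mulJ z : z * z^* = (sqn z)%:C.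
Proof.
by case: z => a b; apply/eqP; rewrite eq_complex /sqn/=;
  apply/andP; split; apply/eqP; ring.
Qed.

(** The parallelogram identity without the term of z - w. It replaces the triangle inequality, at
    the cost of a factor 2 on squared norms. *)
Lemma sqnD_le z w : sqn (z + w) <= 2 * sqn z + 2 * sqn w.
Proof.
case: z w => [a b] [c d]; rewrite /sqn/= -subr_ge0.
rewrite [leRHS](_ : _ = (a - c) ^+ 2 + (b - d) ^+ 2); last by ring.
by rewrite addr_ge0 ?sqr_ge0.
Qed.

Lemma sqn_real (a : R) : sqn a%:C = a ^+ 2.
Proof. by rewrite /sqn/= expr0n addr0. Qed.

Lemma ReD z w : complex.Re (z + w) = complex.Re z + complex.Re w.
Proof. by case: z w => [? ?] []. Qed.
Lemma ImD z w : complex.Im (z + w) = complex.Im z + complex.Im w.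
Proof. by case: z w => [? ?] []. Qed.
Lemma ReM z w : complex.Re (z * w) =
  complex.Re z * complex.Re w - complex.Im z * complex.Im w.
Proof. by case: z w => [? ?] []. Qed.
Lemma ImM z w : complex.Im (z * w) =
  complex.Re z * complex.Im w + complex.Im z * complex.Re w.
Proof. by case: z w => [? ?] []. Qed.
Lemma ReN z : complex.Re (- z) = - complex.Re z.
Proof. by case: z. Qed.
Lemma ImN z : complex.Im (- z) = - complex.Im z.
Proof. by case: z. Qed.
Lemma ReJ z : complex.Re z^* = complex.Re z.
Proof. by case: z. Qed.
Lemma ImJ z : complex.Im z^* = - complex.Im z.
Proof. by case: z. Qed.
Definition ReImE := (ReD, ImD, ReM, ImM, ReN, ImN, ReJ, ImJ).

Lemma complexP z w :
  complex.Re z = complex.Re w -> complex.Im z = complex.Im w -> z = w.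
Proof. by case: z w => [? ?] [? ?] /= -> ->. Qed.

Lemma conjcD z w : (z + w)^* = z^* + w^*.
Proof. by apply: complexP; rewrite !ReImE ?opprD. Qed.

Lemma conjcM z w : (z * w)^* = z^* * w^*.
Proof. by apply: complexP; rewrite !ReImE; ring. Qed.

Lemma conjcR (x : R) : (x%:C)^* = x%:C :> R[i].
Proof. by apply: complexP; rewrite !ReImE/= ?oppr0. Qed.

End complex_facts.

Section L2_theory.
Context d (T : measurableType d) (R : realType).
Variable mu : {measure set T -> \bar R}.
Implicit Types (f g h : T -> R[i]) (c : R[i]).

Lemma cmeasurable_cst c : cmeasurable (fun _ : T => c).
Proof. by split; exact: measurable_cst. Qed.

Lemma cmeasurableD f g : cmeasurable f -> cmeasurable g ->
  cmeasurable (fun x => f x + g x).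
Proof.
move=> [f1 f2] [g1 g2]; split.
  by under eq_fun do rewrite ReD; exact: measurable_funD.
by under eq_fun do rewrite ImD; exact: measurable_funD.
Qed.

Lemma cmeasurableM f g : cmeasurable f -> cmeasurable g ->
  cmeasurable (fun x => f x * g x).
Proof.
move=> [f1 f2] [g1 g2]; split.
  by under eq_fun do rewrite ReM; apply: measurable_funB; exact: measurable_funM.
by under eq_fun do rewrite ImM; apply: measurable_funD; exact: measurable_funM.
Qed.

Lemma cmeasurableZ c f : cmeasurable f -> cmeasurable (fun x => c * f x).
Proof. by apply: cmeasurableM; exact: cmeasurable_cst. Qed.

Lemma cmeasurableN f : cmeasurable f -> cmeasurable (fun x => - f x).
Proof.
by move=> /(cmeasurableZ (-1)); under eq_fun do rewrite mulN1r.
Qed.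

Lemma cmeasurableB f g : cmeasurable f -> cmeasurable g ->
  cmeasurable (fun x => f x - g x).
Proof. by move=> mf /cmeasurableN; exact: cmeasurableD. Qed.

Lemma cmeasurableJ f : cmeasurable f -> cmeasurable (fun x => (f x)^*).
Proof.
move=> [f1 f2]; split; first by under eq_fun do rewrite ReJ.
by under eq_fun do rewrite ImJ; exact: measurable_funN.
Qed.

Lemma cmeasurable_prod (I : Type) (s : seq I) (F : I -> T -> R[i]) :
  (forall i, cmeasurable (F i)) -> cmeasurable (fun x => \prod_(i <- s) F i x).
Proof.
move=> mF; elim: s => [|i s ih].
  by under eq_fun do rewrite big_nil; exact: cmeasurable_cst.
by under eq_fun do rewrite big_cons; exact: cmeasurableM.
Qed.

Lemma measurable_sqn f : cmeasurable f -> measurable_fun setT (fun x => sqn (f x)).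
Proof.
by move=> [f1 f2]; apply: measurable_funD; exact: measurable_funX.
Qed.

Lemma measurable_sqnE f : cmeasurable f ->
  measurable_fun setT (fun x => (sqn (f x))%:E).
Proof. by move=> mf; exact/measurable_EFinP/measurable_sqn. Qed.

Definition nsq f : \bar R := (\int[mu]_x (sqn (f x))%:E)%E.

(** [fine] sends an infinite value to 0, so this is the squared norm only for functions in [L2]. *)
Definition n2 f : R := fine (nsq f).

Definition L2 f : Prop := cmeasurable f /\ (nsq f < +oo)%E.

Lemma nsq_ge0 f : (0 <= nsq f)%E.
Proof. by apply: integral_ge0 => x _; rewrite lee_fin sqn_ge0. Qed.

Lemma n2_ge0 f : 0 <= n2 f. Proof. by rewrite fine_ge0// nsq_ge0. Qed.

Lemma nsqE f : L2 f -> nsq f = (n2 f)%:E.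
Proof. by move=> [_ ?]; rewrite /n2 fineK// ge0_fin_numE// nsq_ge0. Qed.

Lemma cLnorm2E f : cLnorm mu 2%:E f = (nsq f `^ 2^-1)%E.
Proof.
rewrite /cLnorm unlock; congr (_ `^ _)%E.
apply: eq_integral => x _; rewrite abse_EFin poweR_EFin.
rewrite ger0_norm; last by case: (f x) => a b; exact: sqrtr_ge0.
by rewrite -normc_sqr powR_mulrn//; case: (f x) => a b; exact: sqrtr_ge0.
Qed.

Lemma in_Lp2 f : in_Lp mu 2%:E f <-> L2 f.
Proof.
rewrite /in_Lp cLnorm2E; split=> -[mf nf]; split=> //.
  by apply: lty_poweRy nf; rewrite invr_neq0.
by move: nf; exact: poweR_lty.
Qed.

Lemma cLnorm2_lt f (eps : R) : 0 < eps -> (nsq f < (eps ^+ 2)%:E)%E ->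
  (cLnorm mu 2%:E f < eps%:E)%E.
Proof.
move=> e0 fe; rewrite cLnorm2E poweR12_sqrt ?nsq_ge0//.
move: fe (nsq_ge0 f); case: (nsq f) => [r| |]//=.
rewrite lte_fin lee_fin => re r0; rewrite lte_fin.
by rewrite -(ger0_norm (ltW e0)) -sqrtr_sqr ltr_sqrt// exprn_gt0.
Qed.

Lemma nsq_lt f (eps : R) : 0 < eps -> (cLnorm mu 2%:E f < eps%:E)%E ->
  (nsq f < (eps ^+ 2)%:E)%E.
Proof.
move=> e0; rewrite cLnorm2E poweR12_sqrt ?nsq_ge0//.
move: (nsq_ge0 f); case: (nsq f) => [r| |]//=.
rewrite !lte_fin lee_fin => r0 re.
rewrite -(@ltr_sqrt _ r) ?exprn_gt0//.
by rewrite sqrtr_sqr ger0_norm ?ltW.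
Qed.

End L2_theory.

Section complex_integral.
Context d (T : measurableType d) (R : realType).
Variable mu : {measure set T -> \bar R}.
Implicit Types (f g h : T -> R[i]) (c : R[i]).

Lemma normc_ge0 (z : R[i]) : 0 <= normc z.
Proof. by case: z => a b; exact: sqrtr_ge0. Qed.

Lemma normcE_sqrt (z : R[i]) : normc z = Num.sqrt (sqn z).
Proof. by case: z. Qed.

Lemma normr_Re_le (z : R[i]) : `|complex.Re z| <= normc z.
Proof. by case: z => a b /=; rewrite -sqrtr_sqr ler_wsqrtr// lerDl sqr_ge0. Qed.

Lemma normr_Im_le (z : R[i]) : `|complex.Im z| <= normc z.
Proof. by case: z => a b /=; rewrite -sqrtr_sqr ler_wsqrtr// lerDr sqr_ge0. Qed.

Lemma normc_le_ReIm (z : R[i]) : normc z <= `|complex.Re z| + `|complex.Im z|.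
Proof.
rewrite normcE_sqrt -[leRHS]ger0_norm ?addr_ge0// -sqrtr_sqr ler_wsqrtr//.
rewrite sqrrD !real_normK ?num_real// /sqn -addrA lerD2l lerDr.
by rewrite mulrn_wge0 ?mulr_ge0.
Qed.

Definition cintegrable f := mu.-integrable setT (fun x => (complex.Re (f x))%:E) /\
  mu.-integrable setT (fun x => (complex.Im (f x))%:E).

Lemma cintegrable_cmeasurable f : cintegrable f -> cmeasurable f.
Proof. by move=> [/measurable_int/measurable_EFinP ? /measurable_int/measurable_EFinP ?]. Qed.

Lemma cmeasurable_normc f : cmeasurable f -> measurable_fun setT (fun x => normc (f x)).
Proof.
move=> mf; under eq_fun do rewrite normcE_sqrt.
under eq_fun do rewrite -powR12_sqrt ?sqn_ge0//.
by apply: measurableT_comp (measurable_powR _) _; exact: measurable_sqn.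
Qed.

Lemma cintegrable_le f (G : T -> R) : cmeasurable f ->
  mu.-integrable setT (EFin \o G) -> (forall x, normc (f x) <= G x) ->
  cintegrable f.
Proof.
move=> [f1 f2] iG fG; split; apply: (le_integrable _ _ _ iG) => //;
  (try exact/measurable_EFinP) => x _ /=; rewrite lee_fin.
- by rewrite (le_trans (normr_Re_le _))// (le_trans (fG x))// ler_norm.
- by rewrite (le_trans (normr_Im_le _))// (le_trans (fG x))// ler_norm.
Qed.

Lemma cintegrable_normc f : cintegrable f ->
  mu.-integrable setT (fun x => (normc (f x))%:E).
Proof.
move=> intf; have [f1 f2] := intf.
apply: (le_integrable _ _ _ (integrableD _ (integrable_abse f1) (integrable_abse f2))) => //.
- exact/measurable_EFinP/cmeasurable_normc/cintegrable_cmeasurable.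
- move=> x _ /=; rewrite lee_fin ger0_norm ?normc_ge0//.
  by rewrite (le_trans (normc_le_ReIm _))// ler_norm.
Qed.

Lemma cintegrableD f g : cintegrable f -> cintegrable g ->
  cintegrable (fun x => f x + g x).
Proof.
move=> [f1 f2] [g1 g2]; split.
  by under eq_fun do rewrite ReD EFinD; exact: integrableD.
by under eq_fun do rewrite ImD EFinD; exact: integrableD.
Qed.

Lemma cintegrableZ c f : cintegrable f -> cintegrable (fun x => c * f x).
Proof.
move=> [f1 f2]; split.
  under eq_fun do rewrite ReM EFinB !EFinM.
  by apply: integrableB => //; exact: integrableZl.
under eq_fun do rewrite ImM EFinD !EFinM.
by apply: integrableD => //; exact: integrableZl.
Qed.

Lemma integrable_scale (k : R) (u : T -> R) :
  mu.-integrable setT (fun x => (u x)%:E) ->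
  mu.-integrable setT (fun x => (k * u x)%:E).
Proof. by move=> iu; under eq_fun do rewrite EFinM; exact: integrableZl. Qed.

Lemma cintegralD f g : cintegrable f -> cintegrable g ->
  cintegral mu (fun x => f x + g x) = cintegral mu f + cintegral mu g.
Proof.
move=> [f1 f2] [g1 g2]; apply: complexP; rewrite ?ReImE /=.
  by under eq_Rintegral do rewrite ReD; rewrite RintegralD.
by under eq_Rintegral do rewrite ImD; rewrite RintegralD.
Qed.

Lemma cintegralZ c f : cintegrable f ->
  cintegral mu (fun x => c * f x) = c * cintegral mu f.
Proof.
move=> [f1 f2]; apply: complexP; rewrite ?ReImE /=.
  under eq_Rintegral do rewrite ReM.
  by rewrite RintegralB// ?RintegralZl//; exact: integrable_scale.
under eq_Rintegral do rewrite ImM.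
by rewrite RintegralD// ?RintegralZl//; exact: integrable_scale.
Qed.

Lemma cintegralJ f : cintegrable f ->
  cintegral mu (fun x => (f x)^*) = (cintegral mu f)^*.
Proof.
move=> [f1 f2]; apply: complexP; rewrite ?ReImE /=.
  by under eq_Rintegral do rewrite ReJ.
under eq_Rintegral do rewrite ImJ -mulN1r.
by rewrite RintegralZl// mulN1r.
Qed.

Lemma eq_cintegral f g : f =1 g -> cintegral mu f = cintegral mu g.
Proof. by move=> /funext ->. Qed.

End complex_integral.

Section L2_space.
Context d (T : measurableType d) (R : realType).
Variable mu : {measure set T -> \bar R}.
Implicit Types (f g h : T -> R[i]) (c : R[i]).
Local Notation L2 := (L2 mu).
Local Notation nsq := (nsq mu).
Local Notation n2 := (n2 mu).
Local Notation ip := (L2_inner mu).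

Lemma eq_nsq f g : f =1 g -> nsq f = nsq g.
Proof. by move=> /funext ->. Qed.

Lemma le_nsq f g : cmeasurable f -> cmeasurable g ->
  (forall x, sqn (f x) <= sqn (g x)) -> (nsq f <= nsq g)%E.
Proof.
move=> mf mg fg; apply: ge0_le_integral => //; try exact: measurable_sqnE.
all: by move=> x _; rewrite lee_fin ?sqn_ge0.
Qed.

Lemma nsqZ c f : cmeasurable f -> nsq (fun x => c * f x)%R = ((sqn c)%:E * nsq f)%E.
Proof.
move=> mf; rewrite /nsq; under eq_integral do rewrite sqnM EFinM.
rewrite ge0_integralZl//; try exact: measurable_sqnE.
all: by move=> *; rewrite lee_fin sqn_ge0.
Qed.

Lemma nsqN f : nsq (fun x => - f x)%R = nsq f.
Proof. by apply: eq_integral => x _; rewrite sqnN. Qed.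

Lemma nsq0 : nsq (fun=> 0) = 0%E.
Proof. by apply: integral0_eq => x _; rewrite sqn0. Qed.

Lemma nsqD_le f g : cmeasurable f -> cmeasurable g ->
  (nsq (fun x => f x + g x)%R <= 2%:E * nsq f + 2%:E * nsq g)%E.
Proof.
move=> mf mg; rewrite /nsq -!ge0_integralZl//; try exact: measurable_sqnE;
  try by move=> *; rewrite lee_fin sqn_ge0.
rewrite -ge0_integralD//.
- apply: ge0_le_integral => //.
  + by move=> x _; rewrite lee_fin sqn_ge0.
  + by apply: measurable_sqnE; exact: cmeasurableD.
  + by apply: emeasurable_funD; apply: emeasurable_funM => //; exact: measurable_sqnE.
  + by move=> x _; rewrite -!EFinM -EFinD lee_fin sqnD_le.
- by move=> x _; rewrite -EFinM lee_fin mulr_ge0// sqn_ge0.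
- by apply: emeasurable_funM => //; exact: measurable_sqnE.
- by move=> x _; rewrite -EFinM lee_fin mulr_ge0// sqn_ge0.
- by apply: emeasurable_funM => //; exact: measurable_sqnE.
Qed.

Lemma nsqD_lt f g (a b : R) : cmeasurable f -> cmeasurable g ->
  (nsq f < a%:E)%E -> (nsq g < b%:E)%E ->
  (nsq (fun x => f x + g x)%R < (2 * a + 2 * b)%:E)%E.
Proof.
move=> mf mg fa gb; apply: (le_lt_trans (nsqD_le mf mg)).
by rewrite [ltRHS]EFinD [in ltRHS]EFinM [X in (_ < _ + X)%E]EFinM lteD// lte_pmul2l.
Qed.

Lemma L2_0 : L2 (fun=> 0).
Proof. by split; [exact: cmeasurable_cst|rewrite nsq0]. Qed.

Lemma L2D f g : L2 f -> L2 g -> L2 (fun x => f x + g x).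
Proof.
move=> [mf nf] [mg ng]; split; first exact: cmeasurableD.
apply: (le_lt_trans (nsqD_le mf mg)).
by rewrite lte_add_pinfty// lte_mul_pinfty// lee_fin.
Qed.

Lemma L2Z c f : L2 f -> L2 (fun x => c * f x).
Proof.
move=> [mf nf]; split; first exact: cmeasurableZ.
by rewrite nsqZ// lte_mul_pinfty// lee_fin sqn_ge0.
Qed.

Lemma L2N f : L2 f -> L2 (fun x => - f x).
Proof. by move=> [mf nf]; split; [exact: cmeasurableN|rewrite nsqN]. Qed.

Lemma L2B f g : L2 f -> L2 g -> L2 (fun x => f x - g x).
Proof. by move=> Lf /L2N; exact: L2D. Qed.

Lemma L2J f : L2 f -> L2 (fun x => (f x)^*).
Proof.
move=> [mf nf]; split; first exact: cmeasurableJ.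
by rewrite /nsq; under eq_integral do rewrite sqn_conjc.
Qed.

Lemma L2_le f g : cmeasurable f -> L2 g -> (forall x, sqn (f x) <= sqn (g x)) -> L2 f.
Proof.
by move=> mf [mg ng] fg; split=> //; exact: le_lt_trans (le_nsq mf mg fg) ng.
Qed.

Lemma L2M_bounded f g (C : R) : cmeasurable f -> (forall x, sqn (f x) <= C) ->
  L2 g -> L2 (fun x => f x * g x).
Proof.
move=> mf fC Lg; have [mg ng] := Lg.
apply: (L2_le _ (L2Z (Num.sqrt C)%:C Lg)); first exact: cmeasurableM.
move=> x; have C0 : 0 <= C := le_trans (sqn_ge0 _) (fC x).
by rewrite !sqnM sqn_real sqr_sqrtr// ler_wpM2r// sqn_ge0.
Qed.

Lemma nsqM_bounded_le f g (C : R) : 0 <= C -> cmeasurable f -> cmeasurable g ->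
  (forall x, sqn (f x) <= C) -> (nsq (fun x => f x * g x)%R <= C%:E * nsq g)%E.
Proof.
move=> C0 mf mg fC; rewrite -(sqr_sqrtr C0) -sqn_real -nsqZ//.
apply: le_nsq; [exact: cmeasurableM|exact: cmeasurableZ|].
by move=> x; rewrite !sqnM sqn_real sqr_sqrtr// ler_wpM2r// sqn_ge0.
Qed.

Lemma L2_integrable_sqn f : L2 f -> mu.-integrable setT (fun x => (sqn (f x))%:E).
Proof.
move=> [mf nf]; apply/integrableP; split; first exact: measurable_sqnE.
rewrite (le_lt_trans _ nf)// le_eqVlt; apply/orP; left; apply/eqP.
by apply: eq_integral => x _ /=; rewrite ger0_norm// sqn_ge0.
Qed.

Lemma L2_cintegrable f g : L2 f -> L2 g -> cintegrable mu (fun x => f x * (g x)^*).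
Proof.
move=> Lf Lg; have [mf _] := Lf; have [mg _] := Lg.
apply: (cintegrable_le (G := fun x => sqn (f x) + sqn (g x))).
- by apply: cmeasurableM => //; exact: cmeasurableJ.
- exact: (integrableD measurableT (L2_integrable_sqn Lf) (L2_integrable_sqn Lg)).
- move=> x; rewrite normcM -!normc_sqr.
  have -> : normc (g x)^* = normc (g x) by rewrite !normcE_sqrt sqn_conjc.
  rewrite -subr_ge0 (_ : _ - _ = ((normc (f x) - normc (g x)) ^+ 2
    + (normc (f x)) ^+ 2 + (normc (g x)) ^+ 2) / 2); last by field.
  by rewrite divr_ge0// !addr_ge0 ?sqr_ge0.
Qed.

Lemma ipDl f g h : L2 f -> L2 g -> L2 h ->
  ip (fun x => f x + g x) h = ip f h + ip g h.
Proof.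
move=> Lf Lg Lh; rewrite /L2_inner -cintegralD; try exact: L2_cintegrable.
by apply: eq_cintegral => x; rewrite mulrDl.
Qed.

Lemma ipZl c f h : L2 f -> L2 h -> ip (fun x => c * f x) h = c * ip f h.
Proof.
move=> Lf Lh; rewrite /L2_inner -cintegralZ; last exact: L2_cintegrable.
by apply: eq_cintegral => x; rewrite mulrA.
Qed.

Lemma ipC f h : L2 f -> L2 h -> ip h f = (ip f h)^*.
Proof.
move=> Lf Lh; rewrite /L2_inner -cintegralJ; last exact: L2_cintegrable.
by apply: eq_cintegral => x; rewrite conjcM conjcK mulrC.
Qed.

Lemma ipDr f g h : L2 f -> L2 g -> L2 h ->
  ip h (fun x => f x + g x) = ip h f + ip h g.
Proof.
by move=> Lf Lg Lh; rewrite ipC// ?ipDl//; [rewrite conjcD -!ipC|exact: L2D].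
Qed.

Lemma ipZr c f h : L2 f -> L2 h -> ip h (fun x => c * f x) = c^* * ip h f.
Proof.
by move=> Lf Lh; rewrite ipC// ?ipZl//; [rewrite conjcM -ipC|exact: L2Z].
Qed.

Lemma ipff f : ip f f = (n2 f)%:C.
Proof.
rewrite /L2_inner; under eq_cintegral do rewrite sqn_mulJ.
by apply: complexP => //=; rewrite /Rintegral integral0.
Qed.

Lemma n2E f : n2 f = complex.Re (ip f f). Proof. by rewrite ipff. Qed.

Lemma n2D f g : L2 f -> L2 g ->
  n2 (fun x => f x + g x) = n2 f + n2 g + 2 * complex.Re (ip f g).
Proof.
move=> Lf Lg; have Lfg := L2D Lf Lg.
rewrite !n2E ipDl// !ipDr// (ipC Lf Lg) !ReImE; ring.
Qed.

Lemma n2Z c f : L2 f -> n2 (fun x => c * f x) = sqn c * n2 f.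
Proof. by move=> Lf; rewrite /n2 nsqZ ?nsqE//; case: Lf. Qed.

(** Completing the square in c. With c the inner product it yields Bessel's inequality; for any
    other c it shows that the error is larger. *)
Lemma n2_sub f e c : L2 f -> L2 e -> ip e e = 1 ->
  n2 (fun x => f x - c * e x) = n2 f + (sqn (c - ip f e) - sqn (ip f e)).
Proof.
move=> Lf Le e1.
rewrite (_ : (fun x => _) = (fun x => f x + (- c) * e x)); last first.
  by apply/funext => x; rewrite mulNr.
rewrite n2D// ?n2Z//; last exact: L2Z.
rewrite ipZr// !n2E e1 /= /sqn !ReImE; ring.
Qed.

End L2_space.

(** * Closed subspaces and orthonormal bases *)

Section span.
Variables (T : Type) (R : realType) (I : Type) (e : I -> T -> R[i]).

(** Inductive rather than by finite sums: stability under sums and multiples is a plain induction,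
    and an index may occur several times. *)
Inductive span : (T -> R[i]) -> Prop :=
| span_0 : span (fun=> 0)
| span_cons i c g : span g -> span (fun x => c * e i x + g x).

Lemma spanD f g : span f -> span g -> span (fun x => f x + g x).
Proof.
elim=> [|i c h _ ih] sg; first by under eq_fun do rewrite add0r.
by under eq_fun do rewrite -addrA; apply: span_cons; exact: ih.
Qed.

Lemma spanZ c f : span f -> span (fun x => c * f x).
Proof.
elim=> [|i c' h _ ih]; first by under eq_fun do rewrite mulr0; exact: span_0.
by under eq_fun do rewrite mulrDr mulrA; exact: span_cons.
Qed.

Lemma span_gen i : span (e i).
Proof.
have := span_cons i 1 span_0.
by under eq_fun do rewrite mul1r addr0.
Qed.

End span.

(** Repeated indices are merged here because Bessel's inequality holds only for lists without
    repetition. *)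
Lemma span_sumP (T : Type) (R : realType) (I : eqType) (e : I -> T -> R[i]) f :
  span e f -> exists (s : seq I) (c : I -> R[i]),
    uniq s /\ f = (fun x => \sum_(i <- s) c i * e i x).
Proof.
elim=> [|i c g _ [s [c' [us ->]]]].
  by exists [::], (fun=> 0); split=> //; apply/funext => x; rewrite big_nil.
have [si|si] := boolP (i \in s).
  exists s, (fun k => (if k == i then c else 0) + c' k); split=> //.
  apply/funext => x; under [RHS]eq_bigr do rewrite mulrDl.
  rewrite big_split/=; congr (_ + _).
  rewrite (bigD1_seq i)//= eqxx big1_seq ?addr0//.
  by move=> k /andP[/negPf -> _]; rewrite mul0r.
exists (i :: s), (fun k => if k == i then c else c' k); split.
  by rewrite /= si.
apply/funext => x; rewrite big_cons eqxx; congr (_ + _).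
apply: eq_big_seq => k ks; case: eqP => // ki.
by move: si; rewrite -ki ks.
Qed.

Section closed_subspaces.
Context d (T : measurableType d) (R : realType).
Variable mu : {measure set T -> \bar R}.
Implicit Types (f g h : T -> R[i]) (c : R[i]) (P : (T -> R[i]) -> Prop).
Local Notation L2 := (L2 mu).
Local Notation nsq := (nsq mu).
Local Notation n2 := (n2 mu).
Local Notation ip := (L2_inner mu).

(* [P] is a closed linear subspace of [L^2]; [csub_lim] also makes it stable
   under almost everywhere equality. *)
Record csub P : Prop := CSub {
  csub_L2 : forall f, P f -> L2 f ;
  csub_0 : P (fun=> 0) ;
  csubD : forall f g, P f -> P g -> P (fun x => f x + g x) ;
  csubZ : forall c f, P f -> P (fun x => c * f x) ;
  csub_lim : forall f, L2 f ->
    (forall eps : R, 0 < eps ->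
       exists2 g, P g & (nsq (fun x => (f x - g x)%R) < eps%:E)%E) -> P f }.

Lemma csubN P f : csub P -> P f -> P (fun x => - f x).
Proof.
by move=> cP /(csubZ cP (-1)); under eq_fun do rewrite mulN1r.
Qed.

Lemma csubB P f g : csub P -> P f -> P g -> P (fun x => f x - g x).
Proof. by move=> cP Pf /(csubN cP); exact: csubD. Qed.

Lemma csub_sum P (I : eqType) (s : seq I) (F : I -> T -> R[i]) : csub P ->
  (forall i, i \in s -> P (F i)) -> P (fun x => \sum_(i <- s) F i x).
Proof.
move=> cP; elim: s => [|i s ih] PF.
  by under eq_fun do rewrite big_nil; exact: csub_0.
under eq_fun do rewrite big_cons; apply: csubD => //.
  by apply: PF; rewrite mem_head.
by apply: ih => k ks; apply: PF; rewrite in_cons ks orbT.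
Qed.

Lemma csub_span P (I : Type) (e : I -> T -> R[i]) f : csub P ->
  (forall i, P (e i)) -> span e f -> P f.
Proof.
move=> cP Pe; elim=> [|i c g _ ih]; first exact: csub_0.
by apply: csubD => //; exact: csubZ.
Qed.

Lemma csub_L2_self : csub L2.
Proof. by split=> *; [|exact: L2_0|exact: L2D|exact: L2Z|]. Qed.

Definition approx (I : Type) (e : I -> T -> R[i]) h : Prop := L2 h /\
  forall eps : R, 0 < eps ->
    exists2 g, span e g & (nsq (fun x => (h x - g x)%R) < eps%:E)%E.

(** The closed span of [e] is itself a [csub]. Totality of [e] can thus be proved by feeding
    [approx e] to the lemmas that enlarge an arbitrary [csub]. *)
Lemma approx_csub (I : Type) (e : I -> T -> R[i]) :
  (forall i, L2 (e i)) -> csub (approx e).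
Proof.
move=> Le; have Lspan g : span e g -> L2 g by apply: csub_span => //; exact: csub_L2_self.
split.
- by move=> f [].
- split=> [|eps e0]; first exact: L2_0.
  exists (fun=> 0); first exact: span_0.
  by under eq_fun do rewrite subr0; rewrite nsq0 lte_fin.
- move=> f g [Lf af] [Lg ag]; split=> [|eps e0]; first exact: L2D.
  (* A quarter for each part, because [nsqD_lt] doubles both bounds. *)
  have e4 : 0 < eps / 4 by rewrite divr_gt0.
  have [f' sf' ff'] := af _ e4; have [g' sg' gg'] := ag _ e4.
  exists (fun x => f' x + g' x); first exact: spanD.
  rewrite (_ : (fun x => _) = (fun x => (f x - f' x) + (g x - g' x))); last first.
    by apply/funext => x; rewrite opprD addrACA.
  have -> : eps = 2 * (eps / 4) + 2 * (eps / 4) by field.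
  have Lf' := Lspan _ sf'; have Lg' := Lspan _ sg'.
  by apply: nsqD_lt => //; [case: (L2B Lf Lf')|case: (L2B Lg Lg')].
- move=> c f [Lf af]; split=> [|eps e0]; first exact: L2Z.
  (* The [+ 1] keeps the divisor positive when c = 0. *)
  have e1 : 0 < eps / (sqn c + 1) by rewrite divr_gt0// ltr_wpDl ?sqn_ge0.
  have [f' sf' ff'] := af _ e1.
  exists (fun x => c * f' x); first exact: spanZ.
  under eq_fun do rewrite -mulrBr.
  have Lf' := Lspan _ sf'; have LB := L2B Lf Lf'; have [mB _] := LB.
  rewrite nsqZ// nsqE// -EFinM lte_fin; move: ff'.
  rewrite nsqE// lte_fin ltr_pdivlMr ?ltr_wpDl ?sqn_ge0//.
  by apply: le_lt_trans; rewrite mulrC ler_wpM2l ?n2_ge0// lerDl.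
- move=> f Lf lf; split=> // eps e0.
  have e4 : 0 < eps / 4 by rewrite divr_gt0.
  have [g [Lg ag] fg] := lf _ e4; have [g' sg' gg'] := ag _ e4.
  exists g' => //; have Lg' := Lspan _ sg'.
  rewrite (_ : (fun x => _) = (fun x => (f x - g x) + (g x - g' x))); last first.
    by apply/funext => x; rewrite addrA subrK.
  have -> : eps = 2 * (eps / 4) + 2 * (eps / 4) by field.
  by apply: nsqD_lt => //; [case: (L2B Lf Lg)|case: (L2B Lg Lg')].
Qed.

Lemma approx_gen (I : Type) (e : I -> T -> R[i]) i : L2 (e i) -> approx e (e i).
Proof.
move=> Le; split=> // eps e0; exists (e i); first exact: span_gen.
by under eq_fun do rewrite subrr; rewrite nsq0 lte_fin.
Qed.

Lemma csub_approx P (I : Type) (e : I -> T -> R[i]) h : csub P ->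
  (forall i, P (e i)) -> approx e h -> P h.
Proof.
move=> cP Pe [Lh ah]; apply: (csub_lim cP) => // eps /ah[g sg hg].
by exists g => //; exact: (csub_span cP Pe).
Qed.

Section orthonormal.
Variables (I : eqType) (e : I -> T -> R[i]).
Hypothesis Le : forall i, L2 (e i).
Hypothesis oe : forall i j, ip (e i) (e j) = (i == j)%:R.

(** The vectors are subtracted one at a time with [n2_sub]; by orthogonality this leaves the inner
    products with the remaining ones unchanged. *)
Lemma n2_sub_sum (s : seq I) (c : I -> R[i]) h : uniq s -> L2 h ->
  n2 (fun x => h x - \sum_(i <- s) c i * e i x) =
  n2 h + \sum_(i <- s) (sqn (c i - ip h (e i)) - sqn (ip h (e i))).
Proof.
elim: s h => [|i s ih] h /=.
  by move=> _ _; rewrite big_nil addr0; under eq_fun do rewrite big_nil subr0.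
move=> /andP[si us] Lh; rewrite big_cons addrA -n2_sub ?oe ?eqxx//.
have Lh' : L2 (fun x => h x - c i * e i x) by apply: L2B => //; exact: L2Z.
rewrite (_ : (fun x => _) =
    (fun x => (h x - c i * e i x) - \sum_(i <- s) c i * e i x)); last first.
  by apply/funext => x; rewrite big_cons opprD addrA.
rewrite ih//; congr (_ + _); apply: eq_big_seq => k ks.
have -> : ip (fun x => h x - c i * e i x) (e k) = ip h (e k).
  rewrite (_ : (fun x => _) = (fun x => h x + (- c i) * e i x)); last first.
    by apply/funext => x; rewrite mulNr.
  rewrite ipDl//; last exact: L2Z.
  rewrite ipZl// oe (_ : (i == k) = false) ?mulr0 ?addr0//.
  by apply/eqP => ik; move: si; rewrite ik ks.
by [].
Qed.

Lemma bessel (s : seq I) h : uniq s -> L2 h ->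
  \sum_(i <- s) sqn (ip h (e i)) <= n2 h.
Proof.
move=> us Lh; have := n2_ge0 mu (fun x => h x - \sum_(i <- s) ip h (e i) * e i x).
rewrite n2_sub_sum//; under eq_bigr do rewrite subrr sqn0 sub0r.
by rewrite sumrN subr_ge0.
Qed.

(** The coefficients of an approximant are arbitrary, but by [n2_sub_sum] replacing them by inner
    products can only lower the error. This direction extracts Parseval's identity from the totality
    of the exponentials. *)
Lemma approx_parseval h (eps : R) : approx e h -> 0 < eps ->
  exists2 s : seq I, uniq s & n2 h - eps < \sum_(i <- s) sqn (ip h (e i)).
Proof.
move=> [Lh ah] /ah[_ /span_sumP[s [c [us ->]]] he]; exists s => //.
move: he; rewrite nsqE; last first.
  apply: L2B => //; apply: (csub_sum csub_L2_self) => i _; exact: L2Z.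
rewrite lte_fin n2_sub_sum// => he; rewrite ltrBlDr addrC -ltrBlDr.
apply: le_lt_trans he; rewrite lerD2l sumrB lerDr.
by apply: sumr_ge0 => i _; exact: sqn_ge0.
Qed.

(** The converse, by which the totality of the Wilson modes is deduced from a computation of
    norms. *)
Lemma parseval_approx h : L2 h -> (forall eps : R, 0 < eps ->
  exists2 s : seq I, uniq s & n2 h - eps < \sum_(i <- s) sqn (ip h (e i))) ->
  approx e h.
Proof.
move=> Lh ph; split=> // eps /ph[s us hs].
exists (fun x => \sum_(i <- s) ip h (e i) * e i x).
  elim: s {us hs} => [|i s ih]; first by under eq_fun do rewrite big_nil; exact: span_0.
  by under eq_fun do rewrite big_cons; exact: span_cons.
rewrite nsqE; last first.
  apply: L2B => //; apply: (csub_sum csub_L2_self) => i _; exact: L2Z.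
rewrite lte_fin n2_sub_sum//; under eq_bigr do rewrite subrr sqn0 sub0r.
by rewrite sumrN ltrBlDr -ltrBlDl.
Qed.

End orthonormal.

Definition is_basis (I : eqType) (e : I -> T -> R[i]) :=
  [/\ forall i, L2 (e i), forall i j, ip (e i) (e j) = (i == j)%:R &
      forall h, L2 h -> approx e h].

Lemma is_basis_orthonormal_basis (I : eqType) (e : I -> T -> R[i]) :
  is_basis e -> orthonormal_basis_L2 mu e.
Proof.
move=> [Le oe ae]; split=> //; first by move=> i; exact/in_Lp2.
move=> h /in_Lp2 /ae[_ ah] eps e0.
have [_ /span_sumP[s [c [_ ->]]] hs] := ah _ (exprn_gt0 2 e0).
by exists s, c; exact: cLnorm2_lt.
Qed.

Lemma nsq_dct f (g : nat -> T -> R[i]) (G : T -> R) : cmeasurable f ->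
  (forall n, cmeasurable (g n)) -> mu.-integrable setT (fun x => (G x)%:E) ->
  (forall n x, sqn (f x - g n x) <= G x) ->
  (forall x, sqn (f x - g n x) @[n --> \oo] --> (0:R)) ->
  forall eps : R, 0 < eps -> exists N, forall n, (N <= n)%N ->
    (nsq (fun x => (f x - g n x)%R) < eps%:E)%E.
Proof.
move=> mf mg iG fG f0 eps e0.
have mB n : cmeasurable (fun x => f x - g n x) by exact: cmeasurableB.
have : (\int[mu]_x (sqn (f x - g n x))%:E)%E @[n --> \oo] --> (\int[mu]_x (cst 0 x))%E.
  apply: (@dominated_cvg _ _ _ mu setT _ _ (cst 0%E) (EFin \o G)) => //.
  - by move=> n; exact: measurable_sqnE.
  - move=> x _; apply/fine_cvgP; split; first exact: nearW.
    exact: f0.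
  - by move=> n x _; rewrite gee0_abs ?lee_fin ?sqn_ge0.
rewrite integral0 => /fine_cvgP[[M _ fn] /cvgrPdist_lt/(_ _ e0)[N _ gN]].
exists (maxn M N) => n; rewrite geq_max => /andP[Mn Nn].
have := gN n Nn; rewrite /= sub0r normrN ger0_norm ?n2_ge0// => he.
by rewrite /(nsq _) -(fineK (fn n Mn)) lte_fin.
Qed.

Lemma csub_dct P f (g : nat -> T -> R[i]) (G : T -> R) : csub P -> L2 f ->
  (forall n, P (g n)) -> mu.-integrable setT (fun x => (G x)%:E) ->
  (forall n x, sqn (f x - g n x) <= G x) ->
  (forall x, sqn (f x - g n x) @[n --> \oo] --> (0:R)) -> P f.
Proof.
move=> cP Lf Pg iG fG f0; apply: (csub_lim cP) => // eps e0.
have mg n : cmeasurable (g n) by case: (csub_L2 cP (Pg n)).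
have [N fN] := nsq_dct (proj1 Lf) mg iG fG f0 e0.
by exists (g N) => //; exact: fN.
Qed.

End closed_subspaces.

(** Serves to pass between [lebesgue_measure_n] and its copy with a sigma-finite structure: same
    values, different bundles. *)
Lemma is_basis_eq_measure d (T : measurableType d) (R : realType)
    (m m' : {measure set T -> \bar R}) (I : eqType) (e : I -> T -> R[i]) :
  (forall A, m A = m' A) -> is_basis m e -> is_basis m' e.
Proof.
move=> mm' [Le oe de].
have intE (u : T -> \bar R) : (\int[m]_x u x = \int[m']_x u x)%E.
  by apply: eq_measure_integral => A _ _; exact: mm'.
have LE f : L2 m f <-> L2 m' f by rewrite /L2 /nsq intE.
split.
- by move=> i; exact/LE.
- by move=> i j; rewrite -oe /L2_inner /cintegral /Rintegral !intE.
- move=> h /LE /de[Lh ah]; split; first exact/LE.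
  by move=> eps /ah[g sg hg]; exists g => //; rewrite /nsq -intE.
Qed.

(** * Density of indicators *)

Import HBSimple HBNNSimple.

Section indicators.
Context d (T : measurableType d) (R : realType).
Variable mu : {measure set T -> \bar R}.
Implicit Types (f g h : T -> R[i]) (A K : set T) (P : (T -> R[i]) -> Prop).
Local Notation L2 := (L2 mu).
Local Notation nsq := (nsq mu).

Definition cind A (x : T) : R[i] := (\1_A x : R)%:C.

Lemma cindT A x : A x -> cind A x = 1.
Proof. by move=> Ax; rewrite /cind indicE mem_set. Qed.

Lemma cindF A x : ~ A x -> cind A x = 0.
Proof. by move=> Ax; rewrite /cind indicE memNset. Qed.

Lemma sqn_cind A x : sqn (cind A x) = \1_A x.
Proof. by rewrite sqn_real indicE; case: (x \in A); rewrite ?expr1n ?expr0n. Qed.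

Lemma cindI A K x : cind (A `&` K) x = cind A x * cind K x.
Proof. by rewrite /cind indicI rmorphM. Qed.

Lemma cmeasurable_cind A : measurable A -> cmeasurable (cind A).
Proof. by move=> mA; split; [exact: measurable_indic|exact: measurable_cst]. Qed.

Lemma nsq_cind A : measurable A -> nsq (cind A) = mu A.
Proof.
move=> mA; rewrite /(nsq _); under eq_integral do rewrite sqn_cind.
by rewrite integral_indic// setIT.
Qed.

Lemma L2_cind A : measurable A -> (mu A < +oo)%E -> L2 (cind A).
Proof. by move=> mA ?; split; [exact: cmeasurable_cind|rewrite nsq_cind]. Qed.

Lemma L2M_cind A f : measurable A -> L2 f -> L2 (fun x => f x * cind A x).
Proof.
move=> mA Lf; under eq_fun do rewrite mulrC.
apply: (L2M_bounded (C := 1)) Lf; first exact: cmeasurable_cind.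
by move=> x; rewrite sqn_cind indicE; case: (x \in A); rewrite ?ler01.
Qed.

Section density.
Variable P : (T -> R[i]) -> Prop.
Hypothesis cP : csub mu P.

Hypothesis Pind : forall A, measurable A -> (mu A < +oo)%E -> P (cind A).

Let csub_nnsfun (F : {nnsfun T >-> R}) :
  L2 (fun x => (F x)%:C) -> P (fun x => (F x)%:C).
Proof.
move=> LF.
rewrite (_ : (fun x => _) = (fun x => \sum_(y <- finmap.enum_fset (fset_set (range F)))
    y%:C * cind (F @^-1` [set y]) x)); last first.
  apply/funext => x; rewrite fimfunE fsbig_finite//= rmorph_sum/=.
  by apply: eq_bigr => y _; rewrite rmorphM.
apply: (csub_sum cP) => y _.
(* The value 0 is set apart because its level set may have infinite measure. *)
have [->|y0] := eqVneq y 0.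
  by under eq_fun do rewrite mul0r; exact: (csub_0 cP).
apply: (csubZ cP); apply: Pind; first exact: measurable_sfunP.
have mA : measurable (F @^-1` [set y]) by exact: measurable_sfunP.
rewrite -nsq_cind//.
suff [] : L2 (cind (F @^-1` [set y])) by [].
(* Chebyshev's argument: y times the indicator of the level set is dominated by F, so a level set at
   a nonzero value has finite measure. *)
rewrite (_ : cind _ = (fun x => y^-1%:C * (y%:C * cind (F @^-1` [set y]) x))); last first.
  by apply/funext => x; rewrite mulrA -rmorphM mulVf// mul1r.
apply: L2Z; apply: (L2_le _ LF).
  by apply: cmeasurableZ; exact: cmeasurable_cind.
move=> x; rewrite sqnM sqn_cind !sqn_real indicE.
have [|] := boolP (x \in _); rewrite ?mulr0 ?sqr_ge0// mulr1.
by rewrite inE /= => ->.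
Qed.

Let csub_ge0 (u : T -> R) : (forall x, 0 <= u x) ->
  L2 (fun x => (u x)%:C) -> P (fun x => (u x)%:C).
Proof.
move=> u0 Lu; have [[mu1 _] _] := Lu.
have mu2 : measurable_fun setT (EFin \o u) by exact/measurable_EFinP.
pose F := nnsfun_approx measurableT mu2.
have Fu n x : F n x <= u x.
  by rewrite -lee_fin /F nnsfun_approxE; apply: le_approx => // y _; rewrite lee_fin.
apply: (@csub_dct _ _ _ mu P _ (fun n x => (F n x)%:C) (fun x => sqn (u x)%:C)) => //.
- move=> n; apply: csub_nnsfun; apply: (L2_le _ Lu) => [|x].
    by split; [exact: measurable_funP|exact: measurable_cst].
  by rewrite !sqn_real ler_pXn2r ?nnegrE.
- exact: L2_integrable_sqn.
- move=> n x; rewrite -rmorphB !sqn_real ler_pXn2r ?nnegrE ?subr_ge0//.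
  by rewrite gerBl.
- move=> x.
  have Fux : F n x @[n --> \oo] --> u x.
    have := @cvg_nnsfun_approx _ _ _ _ measurableT _ mu2.
    by move=> /(_ (fun x _ => u0 x) x I) /fine_cvgP[].
  under eq_fun do rewrite -rmorphB sqn_real expr2.
  rewrite -(mulr0 (u x - u x)) -[X in (_ * X)](subrr (u x)).
  by apply: cvgM; apply: cvgB => //; exact: cvg_cst.
Qed.

Lemma csub_indic_dense f : L2 f -> P f.
Proof.
move=> Lf; have [[m1 m2] _] := Lf.
have Ppos (u : T -> R) : measurable_fun setT u ->
    (forall x, u x ^+ 2 <= sqn (f x)) -> P (fun x => (u x)%:C).
  move=> mu_ uf.
  rewrite (_ : (fun x => _) = (fun x => (Num.max (u x) 0)%:C - (Num.max (- u x) 0)%:C));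
    last first.
    apply/funext => x; rewrite -rmorphB; congr _%:C.
    by have [|] := leP (u x) 0; have [|] := leP (- u x) 0; lra.
  have aux (v : T -> R) : measurable_fun setT v ->
      (forall x, v x ^+ 2 <= sqn (f x)) -> P (fun x => (Num.max (v x) 0)%:C).
    move=> mv vf; apply: csub_ge0 => [x|]; first by rewrite le_max lexx orbT.
    apply: (L2_le _ Lf) => [|x].
      split; last exact: measurable_cst.
      by apply: measurable_maxr => //; exact: measurable_cst.
    rewrite sqn_real (le_trans _ (vf x))//.
    by have [|] := leP (v x) 0; rewrite ?expr0n ?sqr_ge0.
  apply: (csubB cP (aux u mu_ uf)); apply: (aux (fun x => - u x)) => [|x].
    exact: measurable_funN.
  by rewrite sqrrN.
rewrite (_ : f = (fun x => (complex.Re (f x))%:C + 'i%C * (complex.Im (f x))%:C)).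
  apply: (csubD cP).
    by apply: Ppos => // x; rewrite lerDl sqr_ge0.
  by apply: (csubZ cP); apply: Ppos => // x; rewrite lerDr sqr_ge0.
by apply/funext => x; exact: complexE.
Qed.

End density.

(** The good sets form a Dynkin system: complements become differences from the indicator of K, and
    disjoint unions follow by dominated convergence. Intersecting with K, of finite measure, keeps
    all these indicators in L^2. *)
Lemma csub_dynkin P K (G : set (set T)) : csub mu P -> measurable K ->
  (mu K < +oo)%E -> @measurable _ T = <<s G >> -> setI_closed G ->
  P (cind K) -> (forall A, G A -> P (cind (A `&` K))) ->
  forall A, measurable A -> P (cind (A `&` K)).
Proof.
move=> cP mK Koo GE IG PK PG A; rewrite GE => sA.
apply: (dynkin_induction (P := fun A => P (cind (A `&` K))) GE IG) sA => //.
- by rewrite setTI.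
- move=> S _ PS; rewrite (_ : cind _ = (fun x => cind K x - cind (S `&` K) x)).
    exact: (csubB cP PK PS).
  apply/funext => x; rewrite !cindI.
  by have [Sx|Sx] := pselect (S x); [rewrite (cindT Sx) cindF ?mul1r ?subrr ?mul0r//; exact|
    rewrite (cindF Sx) cindT ?mul1r ?mul0r ?subr0].
- move=> F mF /trivIsetP tF PF.
  have mU : measurable (\bigcup_k F k `&` K).
    by apply: measurableI => //; exact: bigcupT_measurable.
  (* By disjointness at most one term is nonzero; at each point the partial sums are thus eventually
     constant. *)
  have FE n x : \sum_(i < n) cind (F i `&` K) x =
      cind K x * (asbool (exists2 k, (k < n)%N & F k x))%:R.
    have [[k kn Fk]|nF] := pselect (exists2 k, (k < n)%N & F k x).
      rewrite asboolT; last by exists k.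
      rewrite (bigD1 (Ordinal kn))//= big1 ?addr0 ?mulr1.
        by rewrite cindI cindT// mul1r.
      move=> i ik; rewrite cindI cindF ?mul0r// => Fi.
      have : (F i `&` F k) x by [].
      by rewrite tF.
    rewrite asboolF// mulr0 big1// => i _.
    by rewrite cindI cindF ?mul0r// => Fi; apply: nF; exists i.
  have UE x : cind (\bigcup_k F k `&` K) x = cind K x * (asbool (exists k, F k x))%:R.
    rewrite cindI mulrC; congr (_ * _).
    have [[k Fk]|nF] := pselect (exists k, F k x).
      by rewrite asboolT ?cindT//; [exists k|exists k].
    by rewrite asboolF// cindF// => -[k _ Fk]; apply: nF; exists k.
  apply: (@csub_dct _ _ _ mu P _ (fun n x => \sum_(i < n) cind (F i `&` K) x)
    (fun x => sqn (cind K x))) => //.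
  + apply: L2_cind => //; rewrite (le_lt_trans _ Koo)//.
    by apply: le_measure; rewrite ?inE//; exact: subIsetr.
  + by move=> n; apply: (csub_sum cP) => i _; exact: PF.
  + exact/L2_integrable_sqn/L2_cind.
  + move=> n x; rewrite FE UE -mulrBr sqnM ler_piMr ?sqn_ge0//.
    by case: asboolP => _; case: asboolP => _;
      rewrite ?subrr ?subr0 ?sub0r ?sqnN ?sqn1 ?sqn0.
  + move=> x; apply/cvgrPdist_lt => e e0.
    have [[k Fk]|nF] := pselect (exists k, F k x).
      exists k.+1 => // n /= kn; rewrite FE UE !asboolT//; last by exists k.
        by rewrite subrr sqn0 subrr normr0.
      by exists k.
    exists 0%N => // n _ /=; rewrite FE UE !asboolF//.
      by rewrite subrr sqn0 subrr normr0.
    by move=> [k _ Fk]; apply: nF; exists k.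
Qed.

End indicators.
Arguments cind {d T R}.
Arguments cmeasurable_cind {d T R A}.
Arguments cindT {d T R A x}.
Arguments cindF {d T R A x}.

(** * Tensor products in the L^2 space of a product measure *)

Section product_space.
Context d1 d2 (T1 : measurableType d1) (T2 : measurableType d2) (R : realType).
Variable m1 : {sigma_finite_measure set T1 -> \bar R}.
Variable m2 : {sigma_finite_measure set T2 -> \bar R}.
Implicit Types (a : T1 -> R[i]) (b : T2 -> R[i]).

Definition tens a b (z : T1 * T2) : R[i] := a z.1 * b z.2.

Lemma cmeasurable_tens a b : cmeasurable a -> cmeasurable b -> cmeasurable (tens a b).
Proof.
move=> [a1 a2] [b1 b2]; apply: cmeasurableM.
  by split; apply: (@measurableT_comp _ _ _ _ _ _ (fun x => _ (a x))) => //;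
    exact: measurable_fst.
by split; apply: (@measurableT_comp _ _ _ _ _ _ (fun x => _ (b x))) => //;
  exact: measurable_snd.
Qed.

Lemma nsq_tens a b : cmeasurable a -> cmeasurable b ->
  nsq (m1 \x m2)%E (tens a b) = (nsq m1 a * nsq m2 b)%E.
Proof.
move=> ma mb; rewrite /nsq fubini_tonelli1; last 2 first.
- exact/measurable_sqnE/cmeasurable_tens.
- by move=> x; rewrite lee_fin sqn_ge0.
transitivity (\int[m1]_x ((sqn (a x))%:E * nsq m2 b))%E.
  apply: eq_integral => x _; rewrite /fubini_F/=.
  under eq_integral do rewrite sqnM EFinM /=.
  rewrite ge0_integralZl//.
  + exact: measurable_sqnE.
  + by move=> *; rewrite lee_fin sqn_ge0.
  + by rewrite lee_fin sqn_ge0.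
rewrite ge0_integralZr//.
- exact: measurable_sqnE.
- by move=> *; rewrite lee_fin sqn_ge0.
- exact: nsq_ge0.
Qed.

Lemma L2_tens a b : L2 m1 a -> L2 m2 b -> L2 (m1 \x m2)%E (tens a b).
Proof.
move=> La Lb; have [ma _] := La; have [mb _] := Lb.
split; first exact: cmeasurable_tens.
by rewrite nsq_tens// !nsqE// -EFinM ltry.
Qed.

(** Tonelli on absolute values gives integrability, then Fubini gives the value. A complex product
    needs it for four pairs of real and imaginary parts. *)
Let integral_tens (u : T1 -> R) (v : T2 -> R) :
  m1.-integrable setT (EFin \o u) -> m2.-integrable setT (EFin \o v) ->
  (m1 \x m2)%E.-integrable setT (fun z => (u z.1 * v z.2)%:E) /\
  (\int[(m1 \x m2)%E]_z (u z.1 * v z.2) = (\int[m1]_x u x) * (\int[m2]_y v y))%R.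
Proof.
move=> iu iv.
have mu1 : measurable_fun setT u by exact/measurable_EFinP/(measurable_int _ iu).
have mv1 : measurable_fun setT v by exact/measurable_EFinP/(measurable_int _ iv).
have iuv : (m1 \x m2)%E.-integrable setT (fun z => (u z.1 * v z.2)%:E).
  apply/integrable12ltyP.
    apply/measurable_EFinP/measurable_funM.
      exact: (measurableT_comp mu1 measurable_fst).
    exact: (measurableT_comp mv1 measurable_snd).
  rewrite (_ : (\int[m1]_x _)%E =
      (\int[m1]_x (`|u x|%:E * \int[m2]_y `|v y|%:E))%E); last first.
    apply: eq_integral => x _.
    under eq_integral do rewrite /= normrM EFinM.
    rewrite ge0_integralZl//.
    by apply/measurable_EFinP; exact: measurableT_comp.
  rewrite ge0_integralZr//; last 2 first.
  - by apply/measurable_EFinP; exact: measurableT_comp.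
  - by apply: integral_ge0.
  have /integrableP[_ u1] := iu; have /integrableP[_ v1] := iv.
  rewrite -ge0_fin_numE ?mule_ge0 ?integral_ge0//.
  by apply: fin_numM; rewrite ge0_fin_numE// integral_ge0.
split=> //; rewrite /Rintegral -integral12_prod_meas1// /fubini_F.
rewrite (_ : (\int[m1]_x _)%E =
    (\int[m1]_x ((u x)%:E * (\int[m2]_y v y)%:E))%E); last first.
  apply: eq_integral => x _; under eq_integral do rewrite /= EFinM.
  by rewrite integralZl// /Rintegral fineK//; exact: integrable_fin_num.
rewrite integralZr// fineM//; exact: integrable_fin_num.
Qed.

Lemma cintegral_tens a b : cintegrable m1 a -> cintegrable m2 b ->
  cintegral (m1 \x m2)%E (tens a b) = cintegral m1 a * cintegral m2 b.
Proof.
move=> [a1 a2] [b1 b2].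
have [i11 e11] := integral_tens a1 b1; have [i22 e22] := integral_tens a2 b2.
have [i12 e12] := integral_tens a1 b2; have [i21 e21] := integral_tens a2 b1.
apply: complexP; rewrite ?ReImE /=.
  rewrite -e11 -e22 -RintegralB//; apply: eq_Rintegral => z _.
  by rewrite /tens ReM.
rewrite -e12 -e21 -RintegralD//; apply: eq_Rintegral => z _.
by rewrite /tens ImM.
Qed.

Lemma ip_tens a b a' b' : L2 m1 a -> L2 m2 b -> L2 m1 a' -> L2 m2 b' ->
  L2_inner (m1 \x m2)%E (tens a b) (tens a' b') = L2_inner m1 a a' * L2_inner m2 b b'.
Proof.
move=> *; rewrite /L2_inner -cintegral_tens; try exact: L2_cintegrable.
by apply: eq_cintegral => z; rewrite /tens conjcM; ring.
Qed.

Lemma cindX (A : set T1) (B : set T2) :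
  cind (A `*` B) = tens (cind A) (cind B) :> (_ -> R[i]).
Proof.
by apply/funext => -[x y]; rewrite /tens /cind !indicE in_setX -rmorphM -natrM mulnb.
Qed.

Section dense.
Variable P : (T1 * T2 -> R[i]) -> Prop.
Hypothesis cP : csub (m1 \x m2)%E P.

Let small (x y eps : R) : 0 <= x -> 0 <= y -> 0 < eps -> y < eps / (x + 1) ->
  x * y < eps.
Proof.
move=> x0 y0 e0; rewrite ltr_pdivlMr ?ltr_wpDl// => ye.
by rewrite (le_lt_trans _ ye)// mulrC ler_wpM2l// lerDl.
Qed.

(** The squared norm is multiplicative on tensors, so tensoring with a fixed function is continuous.
    With [csub_tensl] it lets each factor be approximated while the other one is frozen. *)
Let csub_tensr a : L2 m1 a -> csub m2 (fun b => L2 m2 b /\ P (tens a b)).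
Proof.
move=> La; split.
- by move=> b [].
- split; first exact: L2_0.
  rewrite (_ : tens _ _ = fun=> 0); first exact: (csub_0 cP).
  by apply/funext => z; rewrite /tens mulr0.
- move=> f g [Lf Pf] [Lg Pg]; split; first exact: L2D.
  rewrite (_ : tens _ _ = fun z => tens a f z + tens a g z); first exact: (csubD cP).
  by apply/funext => z; rewrite /tens mulrDr.
- move=> c f [Lf Pf]; split; first exact: L2Z.
  rewrite (_ : tens _ _ = fun z => c * tens a f z); first exact: (csubZ cP).
  by apply/funext => z; rewrite /tens mulrCA.
- move=> f Lf lf; split => //; apply: (csub_lim cP); first exact: L2_tens.
  move=> eps e0.
  have e1 : 0 < eps / (n2 m1 a + 1) by rewrite divr_gt0// ltr_wpDl ?n2_ge0.
  have [g [Lg Pg] fg] := lf _ e1; exists (tens a g) => //.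
  have Lfg := L2B Lf Lg.
  rewrite (_ : (fun z => _) = tens a (fun y => f y - g y)); last first.
    by apply/funext => z; rewrite /tens mulrBr.
  rewrite nsq_tens; [|by case: La|by case: Lfg].
  move: fg; rewrite !nsqE// -EFinM !lte_fin => fg.
  by apply: small fg => //; exact: n2_ge0.
Qed.

Let csub_tensl b : L2 m2 b -> csub m1 (fun a => L2 m1 a /\ P (tens a b)).
Proof.
move=> Lb; split.
- by move=> a [].
- split; first exact: L2_0.
  rewrite (_ : tens _ _ = fun=> 0); first exact: (csub_0 cP).
  by apply/funext => z; rewrite /tens mul0r.
- move=> f g [Lf Pf] [Lg Pg]; split; first exact: L2D.
  rewrite (_ : tens _ _ = fun z => tens f b z + tens g b z); first exact: (csubD cP).
  by apply/funext => z; rewrite /tens mulrDl.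
- move=> c f [Lf Pf]; split; first exact: L2Z.
  rewrite (_ : tens _ _ = fun z => c * tens f b z); first exact: (csubZ cP).
  by apply/funext => z; rewrite /tens mulrA.
- move=> f Lf lf; split => //; apply: (csub_lim cP); first exact: L2_tens.
  move=> eps e0.
  have e1 : 0 < eps / (n2 m2 b + 1) by rewrite divr_gt0// ltr_wpDl ?n2_ge0.
  have [g [Lg Pg] fg] := lf _ e1; exists (tens g b) => //.
  have Lfg := L2B Lf Lg.
  rewrite (_ : (fun z => _) = tens (fun y => f y - g y) b); last first.
    by apply/funext => z; rewrite /tens mulrBl.
  rewrite nsq_tens; [|by case: Lfg|by case: Lb].
  move: fg; rewrite !nsqE// -EFinM !lte_fin => fg.
  by rewrite mulrC; apply: small fg => //; exact: n2_ge0.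
Qed.

Lemma csub_tens (I1 I2 : Type) (e1 : I1 -> T1 -> R[i]) (e2 : I2 -> T2 -> R[i]) :
  (forall i, L2 m1 (e1 i)) -> (forall i, L2 m2 (e2 i)) ->
  (forall a, L2 m1 a -> approx m1 e1 a) -> (forall b, L2 m2 b -> approx m2 e2 b) ->
  (forall i j, P (tens (e1 i) (e2 j))) ->
  forall a b, L2 m1 a -> L2 m2 b -> P (tens a b).
Proof.
move=> Le1 Le2 D1 D2 Pe a b La Lb.
suff [] : (fun a => L2 m1 a /\ P (tens a b)) a by [].
apply: (csub_approx (csub_tensl Lb) _ (D1 _ La)) => i; split=> //.
suff [] : (fun b => L2 m2 b /\ P (tens (e1 i) b)) b by [].
by apply: (csub_approx (csub_tensr (Le1 i)) _ (D2 _ Lb)) => j; split.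
Qed.

(** Rectangles generate the product sigma-algebra and are stable under intersection, so
    [csub_dynkin] applies inside each rectangle of a sigma-finite exhaustion; sets of finite measure
    are then reached by dominated convergence. *)
Lemma csub_product_dense :
  (forall a b, L2 m1 a -> L2 m2 b -> P (tens a b)) ->
  forall h, L2 (m1 \x m2)%E h -> P h.
Proof.
move=> Pt; apply: (csub_indic_dense cP) => A mA Aoo.
have /sigma_finiteP[F [FT ndF Foo]] := sigma_finiteT m1.
have /sigma_finiteP[G [GT ndG Goo]] := sigma_finiteT m2.
have mF n : measurable (F n) by case: (Foo n).
have mG n : measurable (G n) by case: (Goo n).
have mFG n : measurable (F n `*` G n) by exact: measurableX.
have PA n : P (cind (A `&` (F n `*` G n))).
  apply: (csub_dynkin cP (mFG n) _ (measurable_prod_measurableType T1 T2)) => //.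
  - rewrite [ltLHS]product_measure1E// lte_mul_pinfty ?ge0_fin_numE//.
      by case: (Foo n).
    by case: (Goo n).
  - move=> _ _ [A1 mA1 [B1 mB1 <-]] [A2 mA2 [B2 mB2 <-]].
    exists (A1 `&` A2); first exact: measurableI.
    by exists (B1 `&` B2); [exact: measurableI|rewrite setXI].
  - by rewrite cindX; apply: Pt; apply: L2_cind => //; [case: (Foo n)|case: (Goo n)].
  - move=> _ [A1 mA1 [B1 mB1 <-]].
    rewrite -setXI cindX; apply: Pt; apply: L2_cind; try exact: measurableI.
      by rewrite (le_lt_trans _ (proj2 (Foo n)))// le_measure// inE//; exact: measurableI.
    by rewrite (le_lt_trans _ (proj2 (Goo n)))// le_measure// inE//; exact: measurableI.
apply: (csub_dct cP (g := fun n => cind (A `&` (F n `*` G n)))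
  (G := fun x => sqn (cind A x))) => //.
- exact: (L2_cind mA Aoo).
- exact/L2_integrable_sqn/L2_cind.
- move=> n x; rewrite cindI -[X in X - _]mulr1 -mulrBr sqnM ler_piMr ?sqn_ge0//.
  by rewrite /cind indicE; case: (_ \in _); rewrite ?subrr ?subr0 ?sqn0 ?sqn1.
- move=> [x y]; apply/cvgrPdist_lt => e e0.
  have [i _ Fi] : (\bigcup_i F i) x by rewrite -FT.
  have [j _ Gj] : (\bigcup_i G i) y by rewrite -GT.
  exists (maxn i j) => // n /=; rewrite geq_max => /andP[iN jN].
  rewrite cindI (_ : cind (F n `*` G n) (x, y) = 1) ?mulr1 ?subrr ?sqn0 ?subrr ?normr0//.
  apply: cindT; split => /=.
    by have /subsetPset := ndF _ _ iN; exact.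
  by have /subsetPset := ndG _ _ jN; exact.
Qed.

End dense.

End product_space.

(** * Lebesgue measure on R^n and products of bases *)

Section euclid_sigma_finite.
Variable R : realType.

Lemma lebesgue_measure_n_sigma_finite n :
  sigma_finite setT (@lebesgue_measure_n R n).
Proof.
exists (fun k => [set x | forall i : 'I_n,
  `[- k%:R, k%:R]%classic (tnth x i : measurableTypeR R)]).
  apply/esym/seteqP; split=> // x _.
  have [k kx] : exists k : nat, \sum_(i < n) `|tnth x i : R| < k%:R.
    exists (Num.bound (\sum_(i < n) `|tnth x i : R|)).
    by apply: archi_boundP; exact: sumr_ge0.
  exists k => // i; rewrite /= in_itv/= -ler_norml (le_trans _ (ltW kx))//.
  by rewrite (bigD1 i)//= lerDl sumr_ge0.
move=> k; split.
  rewrite [X in measurable X](_ : _ = \bigcap_i ((@tnth _ _)^~ i @^-1`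
     (`[- k%:R, k%:R]%classic : set (measurableTypeR R)))); last first.
    by apply/seteqP; split=> x /= Ax i; [move=> _; exact: Ax|exact: Ax i I].
  apply: fin_bigcap_measurable => // i _.
  by rewrite -[X in measurable X]setTI; exact: measurable_tnth.
have -> := @lebesgue_measure_n_box R n (fun=> `[- k%:R, k%:R]%classic) _.
  rewrite -ge0_fin_numE; last first.
    by apply: prode_ge0.
  apply: (big_ind (fun x => x \is a fin_num)) => // [x y|i _]; first exact: fin_numM.
  by rewrite lebesgue_measure_itv/=; case: ifP.
by move=> i; exact: measurable_itv.
Qed.

(** [lebesgue_measure_n] is already a bundled measure; this bare set function carries in addition
    the sigma-finite structure that Fubini's theorem requires. *)
Definition lebesgue_n n : set (euclid R n) -> \bar R := @lebesgue_measure_n R n.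

HB.instance Definition _ n := isMeasure.Build _ _ _ (@lebesgue_n n)
  (measure0 (@lebesgue_measure_n R n))
  (measure_ge0 (@lebesgue_measure_n R n))
  (@measure_semi_sigma_additive _ _ _ (@lebesgue_measure_n R n)).

HB.instance Definition _ n := @Measure_isSigmaFinite.Build _ _ _ (@lebesgue_n n)
  (lebesgue_measure_n_sigma_finite n).

End euclid_sigma_finite.

Section euclid_cons.
Variables (R : realType) (n : nat).
Variable M : {sigma_finite_measure set (euclid R n) -> \bar R}.
Local Notation mu1 := (@lebesgue_measure R).
Local Notation prodn := (M \x mu1)%E.
Implicit Types f g h : euclid R n.+1 -> R[i].
Local Notation pull f := (fun z => f (@econs R n z)).

Lemma cmeasurable_econs f : cmeasurable f -> cmeasurable (pull f).
Proof.
by move=> [f1 f2]; split;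
  apply: (@measurableT_comp _ _ _ _ _ _ (fun x => _ (f x))) => //;
  exact: measurable_econs.
Qed.

Lemma nsq_econs f : cmeasurable f -> nsq (cons_measure M) f = nsq prodn (pull f).
Proof.
move=> mf; rewrite /nsq.
have := @ge0_integral_pushforward _ _ _ _ R (@econs R n) (@measurable_econs R n)
  prodn setT (fun x => (sqn (f x))%:E) measurableT (measurable_sqnE mf).
rewrite preimage_setT => <-//.
by move=> x _; rewrite lee_fin sqn_ge0.
Qed.

Lemma L2_econs f : cmeasurable f -> L2 (cons_measure M) f <-> L2 prodn (pull f).
Proof.
move=> mf; split=> -[_ nf]; split=> //; [exact: cmeasurable_econs| |].
  by rewrite -nsq_econs.
by rewrite nsq_econs.
Qed.

Lemma cintegral_econs f : cmeasurable f -> cintegrable prodn (pull f) ->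
  cintegral (cons_measure M) f = cintegral prodn (pull f).
Proof.
move=> [f1 f2] [i1 i2]; apply: complexP; rewrite /= /Rintegral; congr fine.
  have := @integral_pushforward _ _ _ _ R (@econs R n) (@measurable_econs R n)
    prodn setT (fun x => (complex.Re (f x))%:E).
  by rewrite preimage_setT => -> //; exact/measurable_EFinP.
have := @integral_pushforward _ _ _ _ R (@econs R n) (@measurable_econs R n)
  prodn setT (fun x => (complex.Im (f x))%:E).
by rewrite preimage_setT => -> //; exact/measurable_EFinP.
Qed.

(** Pulled back by [econs], the system [F] becomes the tensor system of [E] and [e] on a product
    space. The coding of indices by [pair], [p1] and [p2] is abstract; it will be the splitting of a
    tuple into tail and head. *)
Lemma is_basis_econs (I J K : eqType) (e : I -> measurableTypeR R -> R[i])
    (E : J -> euclid R n -> R[i]) (F : K -> euclid R n.+1 -> R[i])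
    (pair : J -> I -> K) (p1 : K -> J) (p2 : K -> I) :
  (forall k, pair (p1 k) (p2 k) = k) -> (forall k, cmeasurable (F k)) ->
  (forall j i, pull (F (pair j i)) = tens (E j) (e i)) ->
  is_basis mu1 e -> is_basis M E -> is_basis (cons_measure M) F.
Proof.
move=> pK mF FE [Le oe de] [LE oE dE].
have FE' k : pull (F k) = tens (E (p1 k)) (e (p2 k)) by rewrite -{1}(pK k) FE.
have LT k : L2 prodn (tens (E (p1 k)) (e (p2 k))) by exact: L2_tens.
have LF k : L2 (cons_measure M) (F k).
  by apply: (proj2 (L2_econs (mF k))); rewrite FE'.
split=> // [k l|h Lh].
  rewrite /L2_inner cintegral_econs; last 2 first.
  - by apply: cmeasurableM => //; exact: cmeasurableJ.
  - rewrite (_ : (fun z => _) = (fun z => tens (E (p1 k)) (e (p2 k)) z *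
        (tens (E (p1 l)) (e (p2 l)) z)^*)).
      exact: L2_cintegrable.
    by rewrite -!FE'.
  rewrite (_ : cintegral _ _ = L2_inner prodn (tens (E (p1 k)) (e (p2 k)))
      (tens (E (p1 l)) (e (p2 l)))); last by rewrite -!FE'.
  rewrite ip_tens// oe oE -natrM mulnb; congr (nat_of_bool _)%:R.
  apply/andP/eqP => [[/eqP kl1 /eqP kl2]|->]; last by rewrite !eqxx.
  by rewrite -(pK k) -(pK l) kl1 kl2.
pose te (ji : J * I) := tens (E ji.1) (e ji.2).
have Lte ji : L2 prodn (te ji) by exact: L2_tens.
have mh : cmeasurable h by case: Lh.
have [_ ah] : approx prodn te (pull h).
  have ate := approx_csub Lte.
  apply: (csub_product_dense ate); last exact/L2_econs.
  apply: (csub_tens ate LE Le dE de) => j i.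
  exact: (@approx_gen _ _ _ _ _ te (j, i)).
split=> // eps /ah[g sg hg].
have [g' sg' gE] : exists2 g', span F g' & g = pull g'.
  elim: sg => [|[j i] c g1 _ [g2 sg2 ->]]; first by exists (fun=> 0); [exact: span_0|].
  exists (fun x => c * F (pair j i) x + g2 x); first exact: span_cons.
  by apply/funext => z; rewrite /te/= -FE.
exists g' => //; rewrite nsq_econs; first by rewrite gE in hg.
apply: cmeasurableB => //.
by case: (csub_span (csub_L2_self (cons_measure M)) LF sg').
Qed.

End euclid_cons.

Section euclid_basis.
Variables (R : realType) (I : eqType) (e : I -> measurableTypeR R -> R[i]).
Local Notation mu := (@lebesgue_measure R).
Hypothesis be : is_basis mu e.

Definition tensor_family n (J : n.-tuple I) (x : euclid R n) : R[i] :=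
  \prod_(l < n) e (tnth J l) (tnth x l).

Lemma tensor_family_cons n i (J : n.-tuple I) z :
  tensor_family [tuple of i :: J] (econs z) = tens (tensor_family J) (e i) z.
Proof.
rewrite /tensor_family big_ord_recl mulrC /tens; congr (_ * _).
by apply: eq_bigr => l _; rewrite !tnthS.
Qed.

Lemma cmeasurable_tensor_family n (J : n.-tuple I) : cmeasurable (tensor_family J).
Proof.
have [Le _ _] := be.
apply: cmeasurable_prod => l; have [[e1 e2] _] := Le (tnth J l).
by split; apply: (@measurableT_comp _ _ _ _ _ _ (fun x => _ (e _ x))) => //;
  exact: measurable_tnth.
Qed.

(** R^0 is a single point of mass 1, and the empty product is the constant 1. *)
Let tensor_family_basis0 : is_basis (@lebesgue_measure_n R 0) (@tensor_family 0).
Proof.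
have one (J : 0.-tuple I) : tensor_family J = fun=> 1.
  by apply/funext => x; rewrite /tensor_family big_ord0.
have L1 (h : euclid R 0 -> R[i]) : cmeasurable h ->
    nsq (@lebesgue_measure_n R 0) h = (sqn (h [tuple]))%:E.
  move=> mh; rewrite /nsq/= integral_dirac//; last exact: measurable_sqnE.
  by rewrite diracT mul1e.
have L2J J : L2 (@lebesgue_measure_n R 0) (tensor_family J).
  split; first exact: cmeasurable_tensor_family.
  by rewrite L1 ?ltry//; exact: cmeasurable_tensor_family.
split=> // [J K|h Lh].
  rewrite (tuple0 J) (tuple0 K) eqxx ipff.
  by rewrite /n2 L1 ?one/= ?sqn1//; exact: cmeasurable_cst.
have cs := approx_csub L2J.
rewrite (_ : h = fun x => h [tuple] * tensor_family [tuple] x).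
  by apply: (csubZ cs); exact: approx_gen.
by apply/funext => x; rewrite (tuple0 x) one mulr1.
Qed.

Lemma tensor_family_basis n : is_basis (@lebesgue_measure_n R n) (@tensor_family n).
Proof.
elim: n => [|n ih]; first exact: tensor_family_basis0.
have ih' : is_basis (@lebesgue_n R n) (@tensor_family n).
  exact: is_basis_eq_measure ih.
apply: (@is_basis_eq_measure _ _ _ (cons_measure (@lebesgue_n R n))) => //.
have H := (@is_basis_econs R n (@lebesgue_n R n) I (n.-tuple I) (n.+1.-tuple I) e
  (@tensor_family n) _ (fun J i => [tuple of i :: J])
  (fun K => [tuple of behead K]) (@thead _ I)). apply: H => //.
- by move=> K; rewrite -tuple_eta.
- exact: cmeasurable_tensor_family.
- by move=> J i; apply/funext => z; exact: tensor_family_cons.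
Qed.

End euclid_basis.

(** * The trigonometric system *)

Section translation.
Variable R : realType.
Local Notation mu := (@lebesgue_measure R).
Local Notation T := (measurableTypeR R).

Lemma measurable_shift (c : R) : measurable_fun setT (fun x : T => x + c : T).
Proof. by apply: measurable_funD => //; exact: measurable_cst. Qed.

Lemma lebesgue_measure_shift (c : R) (A : set T) : measurable A ->
  pushforward mu (fun x : T => x + c : T) A = mu A.
Proof.
move=> mA; apply/esym/lebesgue_measure_unique => //= [|_ _ [[a b] _ <-]].
  exact: measurable_shift.
rewrite /pushforward (_ : _ @^-1` _ = `]a - c, b - c]%classic).
  rewrite !lebesgue_measure_itv/= !lte_fin ltrD2r.
  by rewrite -!EFinB (_ : b - c - (a - c) = b - a)//; ring.
by apply/seteqP; split=> x /=; rewrite !in_itv/= ltrBlDr lerBrDr.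
Qed.

Lemma ge0_integral_shift (c : R) (u : T -> \bar R) : measurable_fun setT u ->
  (forall x, (0 <= u x)%E) -> (\int[mu]_x u (x + c)%R = \int[mu]_x u x)%E.
Proof.
move=> mu_ u0.
have := @ge0_integral_pushforward _ _ _ _ R _ (measurable_shift c) mu setT u
  measurableT mu_ (fun x _ => u0 x).
rewrite preimage_setT => <-; apply: eq_measure_integral => [|? A mA _].
  exact: measurable_shift.
exact: (lebesgue_measure_shift c mA).
Qed.

Lemma cmeasurable_shift (c : R) (f : T -> R[i]) :
  cmeasurable f -> cmeasurable (fun x : T => f (x + c) : R[i]).
Proof.
by move=> [f1 f2]; split;
  apply: (@measurableT_comp _ _ _ _ _ _ (fun x => _ (f x))) => //;
  exact: measurable_shift.
Qed.

Lemma nsq_shift (c : R) (f : T -> R[i]) : cmeasurable f ->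
  nsq mu (fun x => f (x + c)) = nsq mu f.
Proof.
move=> mf; apply: (ge0_integral_shift c (measurable_sqnE mf)) => x.
by rewrite lee_fin sqn_ge0.
Qed.

Lemma L2_shift (c : R) (f : T -> R[i]) : L2 mu f -> L2 mu (fun x => f (x + c)).
Proof. by move=> [mf nf]; split; [exact: cmeasurable_shift|rewrite nsq_shift]. Qed.

Let Rintegral_shift (c : R) (u : T -> R) : measurable_fun setT u ->
  \int[mu]_x u (x + c)%R = \int[mu]_x u x.
Proof.
move=> mu_; rewrite /Rintegral; congr fine; rewrite integralE [RHS]integralE.
have mE : measurable_fun setT (EFin \o u) by exact/measurable_EFinP.
congr (_ - _)%E.
  rewrite -(ge0_integral_shift c (measurable_funepos mE)) => [|x]; last exact: funepos_ge0.
  by apply: eq_integral => x _; rewrite !funeposE.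
rewrite -(ge0_integral_shift c (measurable_funeneg mE)) => [|x]; last exact: funeneg_ge0.
by apply: eq_integral => x _; rewrite !funenegE.
Qed.

Lemma cintegral_shift (c : R) (f : T -> R[i]) : cmeasurable f ->
  cintegral mu (fun x => f (x + c)) = cintegral mu f.
Proof.
move=> [f1 f2]; apply: complexP => /=.
  exact: (@Rintegral_shift c (fun x => complex.Re (f x))).
exact: (@Rintegral_shift c (fun x => complex.Im (f x))).
Qed.

End translation.

Section cis.
Variable R : realType.
Local Notation mu := (@lebesgue_measure R).
Local Notation T := (measurableTypeR R).

Lemma cisD (s t : R) : cis (s + t) = cis s * cis t.
Proof. by apply: complexP; rewrite ReImE/= ?cosD ?sinD//; ring. Qed.

Lemma cis0 : cis (0 : R) = 1.
Proof. by apply: complexP; rewrite /= ?cos0 ?sin0. Qed.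

Lemma cisN (t : R) : cis (- t) = (cis t)^*.
Proof. by apply: complexP; rewrite /= ?cosN ?sinN. Qed.

Lemma sqn_cis (t : R) : sqn (cis t) = 1.
Proof. exact: cos2Dsin2. Qed.

Lemma cis_mulrn (t : R) (n : nat) : cis (t *+ n) = cis t ^+ n.
Proof.
elim: n => [|n ih]; first by rewrite mulr0n cis0.
by rewrite mulrS cisD ih exprS.
Qed.

Lemma cis_2pi_int (k : int) : cis (2 * pi * k%:~R : R) = 1.
Proof.
have c1 : cis (2 * pi : R) = 1.
  by rewrite mulr_natl; apply: complexP; rewrite /= ?cos2pi ?sin2pi.
case: k => n; first by rewrite -pmulrn mulr_natr cis_mulrn c1 expr1n.
by rewrite NegzE mulrNz mulrN cisN -pmulrn mulr_natr cis_mulrn c1 expr1n conjc1.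
Qed.

Lemma cmeasurable_cis d (T0 : measurableType d) (u : T0 -> R) :
  measurable_fun setT u ->
  cmeasurable (fun x => cis (u x)).
Proof.
move=> mu_; split.
  exact: (measurableT_comp (continuous_measurable_fun (@continuous_cos R)) mu_).
exact: (measurableT_comp (continuous_measurable_fun (@continuous_sin R)) mu_).
Qed.

Lemma cmeasurable_cis_lin (c : R) : cmeasurable (fun x : T => cis (c * x)).
Proof. by apply: cmeasurable_cis; exact: measurable_funM. Qed.

Lemma Rintegral_deriv (a b : R) (u F : R -> R) : a < b -> continuous u ->
  (forall x : R, is_derive x (1 : R) F (u x)) -> \int[mu]_(x in `[a, b[) u x = F b - F a.
Proof.
move=> ab cu dF.
have cu' : {within `[a, b], continuous u} by exact: continuous_subspaceT.
have iu : mu.-integrable `[a, b] (EFin \o u).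
  by apply: continuous_compact_integrable => //; exact: segment_compact.
rewrite Rintegral_itv_bndo_bndc; last first.
  apply: integrableS iu; [exact: measurable_itv|exact: measurable_itv|].
  by apply: subset_itvl; rewrite bnd_simp.
rewrite /Rintegral (@continuous_FTC2 _ u F)//.
have cF : continuous F.
  by move=> x; apply/differentiable_continuous/derivable1_diffP; exact: ex_derive.
  split=> [x _||].
  - exact: ex_derive.
  - exact/cvg_at_right_filter/cF.
  - exact/cvg_at_left_filter/cF.
by move=> x _; rewrite derive1E; exact: derive_val.
Qed.

Lemma lebesgue_measure_itv_co (a L : R) : 0 < L -> mu `[a, a + L[%classic = L%:E.
Proof.
move=> L0; rewrite lebesgue_measure_itv/= lte_fin ltrDl L0 -EFinB.
by rewrite addrAC subrr add0r.
Qed.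

Lemma cintegral_cis (a L : R) (m : int) : 0 < L ->
  cintegral mu (fun x : T => cis (2 * pi * m%:~R / L * x) *
    cind (`[a, a + L[%classic : set T) x) =
  if m == 0 then L%:C else 0.
Proof.
move=> L0; have aL : a < a + L by rewrite ltrDl.
have E (u : T -> R) : \int[mu]_x (u x * \1_(`[a, a + L[%classic) x) =
    \int[mu]_(x in `[a, a + L[) u x.
  by rewrite [RHS]Rintegral_mkcond; apply: eq_Rintegral => x _;
    rewrite patchE indicE; case: (_ \in _); rewrite ?mulr1 ?mulr0.
rewrite /cintegral.
under eq_Rintegral do rewrite ReM/= mulr0 subr0.
under [X in _ +i* X]eq_Rintegral do rewrite ImM/= mulr0 add0r.
rewrite !E; set c := _ / L.
have [m0|m0] := eqVneq m 0.
  rewrite /c m0 mulr0 mul0r.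
  under eq_Rintegral do rewrite mul0r cos0.
  under [X in _ +i* X]eq_Rintegral do rewrite mul0r sin0.
  rewrite !Rintegral_cst; [|exact: measurable_itv..].
  have -> : fine (mu `[a, a + L[%classic) = L; last by rewrite mul1r mul0r.
  by rewrite lebesgue_measure_itv_co.
have c0 : c != 0.
  apply: mulf_neq0; last by rewrite invr_eq0 gt_eqF.
  apply: mulf_neq0; last by rewrite intr_eq0.
  by rewrite mulf_neq0// gt_eqF// pi_gt0.
have cc : continuous (fun x : R => cos (c * x)).
  by move=> x; apply: continuous_comp; [exact: mulrl_continuous|exact: continuous_cos].
have cs : continuous (fun x : R => sin (c * x)).
  by move=> x; apply: continuous_comp; [exact: mulrl_continuous|exact: continuous_sin].
have dc (x : R) : is_derive x (1 : R) ( *%R c) c.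
  have := is_deriveZ c (is_derive_id x (1 : R)); rewrite /GRing.scale/= mulr1.
  by [].
have d1 (x : R) : is_derive x (1 : R) (fun x => c^-1 * sin (c * x)) (cos (c * x)).
  have := @is_derive1_comp _ sin ( *%R c) x _ _ (is_derive_sin (c * x)) (dc x).
  by move=> /(is_deriveZ c^-1)/=; rewrite /GRing.scale/= mulrCA mulVf// mulr1.
have d2 (x : R) : is_derive x (1 : R) (fun x => - c^-1 * cos (c * x)) (sin (c * x)).
  have := @is_derive1_comp _ cos ( *%R c) x _ _ (is_derive_cos (c * x)) (dc x).
  move=> /(is_deriveZ (- c^-1))/=; rewrite /GRing.scale/=.
  by rewrite (_ : - c^-1 * (- sin (c * x) * c) = sin (c * x))//; field.
rewrite (Rintegral_deriv aL cc d1) (Rintegral_deriv aL cs d2).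
(* The antiderivatives have period L / m, hence equal values at both ends. *)
have cL : c * (a + L) = c * a + 2 * pi * m%:~R.
  by rewrite mulrDr /c; congr (_ + _); rewrite mulfVK// gt_eqF.
have := cisD (c * a) (2 * pi * m%:~R); rewrite cis_2pi_int mulr1 -cL.
by move=> [-> ->]; rewrite !subrr.
Qed.

End cis.

Section bounded_multiplier.
Context d (T : measurableType d) (R : realType).
Variable mu : {measure set T -> \bar R}.
Variable P : (T -> R[i]) -> Prop.
Hypothesis cP : csub mu P.

(** Multiplication by a bounded function is continuous. Hence, to show that it maps a closed span
    into P, it suffices to treat the generators. *)
Lemma csub_mulr (m : T -> R[i]) (C : R) : cmeasurable m ->
  (forall x, sqn (m x) <= C) ->
  csub mu (fun h => L2 mu h /\ P (fun x => m x * h x)).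
Proof.
move=> mm mC; have LM h : L2 mu h -> L2 mu (fun x => m x * h x).
  by move=> Lh; exact: (L2M_bounded mm mC Lh).
split.
- by move=> f [].
- split; first exact: L2_0.
  by under eq_fun do rewrite mulr0; exact: (csub_0 cP).
- move=> f g [Lf Pf] [Lg Pg]; split; first exact: L2D.
  by under eq_fun do rewrite mulrDr; exact: (csubD cP).
- move=> c f [Lf Pf]; split; first exact: L2Z.
  by under eq_fun do rewrite mulrCA; exact: (csubZ cP).
- move=> f Lf lf; split=> //; apply: (csub_lim cP); first exact: LM.
  move=> eps e0.
  (* C comes without a sign; this majorant is a valid divisor. *)
  have CC : 0 < `|C| + 1 by rewrite ltr_wpDl.
  have e1 : 0 < eps / (`|C| + 1) by rewrite divr_gt0.
  have [g [Lg Pg] fg] := lf _ e1; exists (fun x => m x * g x) => //.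
  under eq_fun do rewrite -mulrBr.
  have Lfg := L2B Lf Lg; have [mfg _] := Lfg.
  have mC' x : sqn (m x) <= `|C| + 1.
    by rewrite (le_trans (mC x))// (le_trans (ler_norm _))// lerDl.
  apply: le_lt_trans (nsqM_bounded_le mu (ltW CC) mm mfg mC') _.
  move: fg; rewrite nsqE// -EFinM !lte_fin ltr_pdivlMr//.
  by rewrite mulrC.
Qed.

End bounded_multiplier.

(** * Polynomials converging to the sign function on [-1, 1] *)

Section sign_iteration.
Variable R : realType.
Implicit Types y : R.

(** The odd cubic that fixes -1, 0 and 1 and has zero slope at -1 and 1 (the Newton-Schulz iteration
    for the sign). Its iterates are polynomials, so applied to a sine they remain trigonometric
    polynomials. *)
Definition sgn_step y : R := (3 * y - y ^+ 3) / 2.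

Lemma sgn_step_le1 y : `|y| <= 1 -> `|sgn_step y| <= 1.
Proof.
rewrite /sgn_step !ler_norml => /andP[y1 y2]; apply/andP; split.
- rewrite -subr_ge0 (_ : _ - _ = (1 + y) ^+ 2 * (2 - y) / 2); last by field.
  by rewrite divr_ge0// mulr_ge0 ?sqr_ge0// subr_ge0 (le_trans y2)// ler1n.
- rewrite -subr_ge0 (_ : _ - _ = (1 - y) ^+ 2 * (2 + y) / 2); last by field.
  by rewrite divr_ge0// mulr_ge0 ?sqr_ge0//; lra.
Qed.

Lemma iter_sgn_step_le1 n y : `|y| <= 1 -> `|iter n sgn_step y| <= 1.
Proof. by move=> y1; elim: n => //= n; exact: sgn_step_le1. Qed.

Lemma sgn_stepN y : sgn_step (- y) = - sgn_step y.
Proof. by rewrite /sgn_step; field. Qed.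

Lemma iter_sgn_stepN n y : iter n sgn_step (- y) = - iter n sgn_step y.
Proof. by elim: n => //= n ->; rewrite sgn_stepN. Qed.

(* [1 - sgn_step y = (1 - y) ((1 - y) (2 + y) / 2)], and the last factor is at
   most [1 - y / 2] on [0, 1]. *)
Lemma iter_sgn_step_gt0 n y : 0 < y <= 1 ->
  y <= iter n sgn_step y <= 1 /\ 1 - iter n sgn_step y <= (1 - y / 2) ^+ n.
Proof.
move=> /andP[y0 y1]; elim: n => [|n [/= /andP[ih1 ih2] ih3]].
  by rewrite /= lexx y1 expr0; split=> //; lra.
set z := iter n sgn_step y in ih1 ih2 ih3 *.
have z0 : 0 < z by exact: lt_le_trans ih1.
have zE : 1 - sgn_step z = (1 - z) * ((1 - z) * (2 + z) / 2).
  by rewrite /sgn_step; field.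
have q1 : (1 - z) * (2 + z) / 2 <= 1 - y / 2.
  have : 0 <= z ^+ 2 by exact: sqr_ge0.
  by rewrite expr2 => z2; nra.
split; last first.
  rewrite zE exprS mulrC ler_pM// ?subr_ge0//.
  by rewrite divr_ge0// mulr_ge0 ?subr_ge0//; lra.
have := sgn_step_le1 (y := z); rewrite ger0_norm ?(ltW z0)// => /(_ ih2).
rewrite ler_norml => /andP[_ ->]; rewrite andbT (le_trans ih1)//.
rewrite -subr_ge0 (_ : _ - _ = z * ((1 - z) * (1 + z)) / 2); last first.
  by rewrite /sgn_step; field.
rewrite divr_ge0// mulr_ge0 ?(ltW z0)// mulr_ge0 ?subr_ge0//; lra.
Qed.

Lemma cvg_iter_sgn_step y : `|y| <= 1 ->
  iter n sgn_step y @[n --> \oo] --> Num.sg y.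
Proof.
wlog y0 : y / 0 <= y => [H y1|y1].
  have [y0|y0] := leP 0 y; first exact: H.
  have := H (- y); rewrite oppr_ge0 (ltW y0) normrN sgrN => /(_ isT y1) h.
  rewrite -[Num.sg y]opprK.
  rewrite (_ : (fun n => _) = (fun n => - iter n sgn_step (- y))); first exact: cvgN.
  by apply/funext => n; rewrite iter_sgn_stepN opprK.
move: y0; rewrite le_eqVlt => /predU1P[<-|y0].
  rewrite sgr0 (_ : (fun n => _) = cst 0); first exact: cvg_cst.
  by apply/funext; elim=> //= n ->; rewrite /sgn_step; field.
have y01 : 0 < y <= 1 by rewrite y0/= (le_trans (ler_norm _)).
rewrite gtr0_sg//.
have y2 : `|1 - y / 2| < 1 by rewrite ltr_norml; lra.
have h : 1 - (1 - y / 2) ^+ n @[n --> \oo] --> (1 - 0 : R).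
  exact: (cvgB (cvg_cst _) (cvg_expr y2)).
rewrite subr0 in h.
apply: (@squeeze_cvgr _ _ _ _ (fun n => 1 - (1 - y / 2) ^+ n) (fun=> 1)) => //;
  last exact: cvg_cst.
apply: nearW => n.
have [/andP[_ h2] h3] := iter_sgn_step_gt0 n y01.
by rewrite h2 andbT lerBlDr -lerBlDl.
Qed.

End sign_iteration.

(** * Orthonormality and totality of the exponentials on [a, a + L) *)

Section trigonometric_system.
Variables (R : realType) (a L : R).
Hypothesis L0 : 0 < L.
Local Notation mu := (@lebesgue_measure R).
Local Notation T := (measurableTypeR R).
Local Notation I := (`[a, a + L[%classic : set T).

Definition expi (k : int) (x : R) : R[i] := cis (2 * pi * k%:~R / L * x).

Definition rsqrtL : R := (Num.sqrt L)^-1.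

Lemma rsqrtL_neq0 : rsqrtL != 0.
Proof. by rewrite invr_eq0 gt_eqF// sqrtr_gt0. Qed.

Lemma sqr_rsqrtL : rsqrtL ^+ 2 = L^-1.
Proof. by rewrite exprVn sqr_sqrtr// ltW. Qed.

Definition trig (k : int) (x : T) : R[i] :=
  rsqrtL%:C * (expi k x * cind I x).

Let mI : measurable I. Proof. exact: measurable_itv. Qed.

Let muI : mu I = L%:E. Proof. exact: lebesgue_measure_itv_co. Qed.

Lemma cmeasurable_expi k : cmeasurable (expi k : T -> R[i]).
Proof. exact: cmeasurable_cis_lin. Qed.

Lemma sqn_expi k x : sqn (expi k x) = 1.
Proof. exact: sqn_cis. Qed.

Lemma expiD k l x : expi (k + l) x = expi k x * expi l x.
Proof. by rewrite /expi -cisD intrD; congr cis; ring. Qed.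

Lemma expiN k x : expi (- k) x = (expi k x)^*.
Proof. by rewrite /expi -cisN mulrNz; congr cis; ring. Qed.

Lemma expi0 x : expi 0 x = 1.
Proof. by rewrite /expi mulr0 mul0r mul0r cis0. Qed.

Lemma L2_indI : L2 mu (cind I).
Proof. by apply: L2_cind => //; rewrite [ltLHS](_ : _ = L%:E) ?ltry//; exact: muI. Qed.

Let cindII x : cind I x * cind I x = cind I x :> R[i].
Proof. by rewrite -cindI setIid. Qed.

Let L2_expi k : L2 mu (fun x => expi k x * cind I x).
Proof.
apply: (L2M_bounded (C := 1)) L2_indI; first exact: cmeasurable_expi.
by move=> x; rewrite sqn_expi.
Qed.

Lemma L2_trig k : L2 mu (trig k).
Proof. by apply: L2Z; exact: L2_expi. Qed.

Lemma trig_orthonormal k l : L2_inner mu (trig k) (trig l) = (k == l)%:R.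
Proof.
rewrite ipZl; [|exact: L2_expi|exact: L2_trig].
rewrite ipZr; [|exact: L2_expi..].
rewrite /L2_inner (_ : cintegral _ _ = if k - l == 0 then L%:C else 0).
  rewrite subr_eq0 conjcR mulrA -rmorphM -expr2 sqr_rsqrtL.
  by case: eqP => // _; rewrite ?mulr0// -rmorphM mulVf ?gt_eqF.
rewrite -(cintegral_cis a (k - l) L0); apply: eq_cintegral => x.
rewrite -/(expi (k - l) x) expiD expiN !conjcM.
have -> : (cind I x)^* = cind I x :> R[i] by apply: complexP; rewrite !ReImE/= ?oppr0.
set u := cind _ x; have uu : u * u = u by exact: cindII.
rewrite -[in RHS]uu; ring.
Qed.

Let V := approx mu trig.
Let cV : csub mu V. Proof. exact: approx_csub L2_trig. Qed.

(** The functions whose restriction to the interval lies in the closed span. The bound makes [Q]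
    stable under products, so that the sets with indicator in [Q] form an algebra. *)
Let Q (f : T -> R[i]) := [/\ cmeasurable f, exists C : R, forall x, sqn (f x) <= C &
  V (fun x => f x * cind I x)].

Let Q_eq f g : Q f -> cmeasurable g -> (exists C : R, forall x, sqn (g x) <= C) ->
  (forall x, I x -> f x = g x) -> Q g.
Proof.
move=> [mf _ Vf] mg gC fg; split=> //.
rewrite (_ : (fun x => _) = (fun x => f x * cind I x))//.
apply/funext => x; have [Ix|Ix] := pselect (I x); first by rewrite fg.
by rewrite cindF// !mulr0.
Qed.

Let Q_expi k : Q (expi k).
Proof.
split; [exact: cmeasurable_expi|by exists 1 => x; rewrite sqn_expi|].
rewrite (_ : (fun x => _) = (fun x => rsqrtL^-1%:C * trig k x)).
  by apply: (csubZ cV); apply: approx_gen; exact: L2_trig.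
apply/funext => x; by rewrite /trig mulrA -rmorphM mulVf ?rsqrtL_neq0// mul1r.
Qed.

Let Q_add f g : Q f -> Q g -> Q (fun x => f x + g x).
Proof.
move=> [mf [C fC] Vf] [mg [D gD] Vg]; split; first exact: cmeasurableD.
  exists (2 * C + 2 * D) => x; rewrite (le_trans (sqnD_le _ _))// lerD// ler_wpM2l//.
by under eq_fun do rewrite mulrDl; exact: (csubD cV).
Qed.

Let Q_scale c f : Q f -> Q (fun x => c * f x).
Proof.
move=> [mf [C fC] Vf]; split; first exact: cmeasurableZ.
  by exists (sqn c * C) => x; rewrite sqnM ler_wpM2l// sqn_ge0.
by under eq_fun do rewrite -mulrA; exact: (csubZ cV).
Qed.

Let V_expi k g : V g -> V (fun x => expi k x * g x).
Proof.
move=> Vg; have Lg := csub_L2 cV Vg.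
suff [] : L2 mu g /\ V (fun x => expi k x * g x) by [].
apply: (csub_approx (csub_mulr cV (cmeasurable_expi k) (C := 1) _) _ Vg) => [x|l].
  by rewrite sqn_expi.
split; first exact: L2_trig.
rewrite (_ : (fun x => _) = trig (k + l)); first exact/approx_gen/L2_trig.
by apply/funext => x; rewrite /trig expiD; ring.
Qed.

(** With g fixed, multiplication by g restricted to the interval is continuous, so f may be replaced
    by an exponential; the product is then an exponential times an element of [V], and [V_expi]
    concludes. *)
Let Q_mul f g : Q f -> Q g -> Q (fun x => f x * g x).
Proof.
move=> [mf [C fC] Vf] [mg [D gD] Vg]; split; first exact: cmeasurableM.
  exists (C * D) => x; rewrite sqnM ler_pM// sqn_ge0//.
have [_] : L2 mu (fun x => f x * cind I x) /\
    V (fun x => (g x * cind I x) * (f x * cind I x)).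
  have mgI : cmeasurable (fun x => g x * cind I x).
    by apply: cmeasurableM => //; exact: cmeasurable_cind.
  apply: (csub_approx (csub_mulr cV mgI (C := D) _) _ Vf) => [x|k].
    rewrite sqnM sqn_cind indicE (le_trans _ (gD x))//.
    by case: (_ \in _); rewrite ?mulr1// mulr0 sqn_ge0.
  split; first exact: L2_trig.
  rewrite (_ : (fun x => _) =
      (fun x => rsqrtL%:C * (expi k x * (g x * cind I x)))).
    by apply: (csubZ cV); exact: V_expi.
  apply/funext => x; rewrite /trig.
  rewrite -[in RHS]cindII; ring.
rewrite (_ : (fun x => _ * (f x * _)) = (fun x => f x * g x * cind I x))//.
apply/funext => x.
rewrite -[in RHS]cindII; ring.
Qed.

Let Q_cst c : Q (fun=> c).
Proof.
have := Q_scale c (Q_expi 0).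
by under eq_fun do rewrite expi0 mulr1.
Qed.

Let Q_lim f (g : nat -> T -> R[i]) (C : R) : cmeasurable f ->
  (forall x, sqn (f x) <= C) -> (forall n, Q (g n)) ->
  (forall n x, sqn (g n x) <= C) ->
  (forall x, sqn (f x - g n x) @[n --> \oo] --> (0:R)) -> Q f.
Proof.
move=> mf fC Qg gC fg; split=> //; first by exists C.
have C0 : 0 <= C by exact: le_trans (sqn_ge0 _) (fC 0).
(* The dominating constant [4 * C] is 2C + 2C, from [sqnD_le]. *)
apply: (csub_dct cV (g := fun n x => g n x * cind I x)
  (G := fun x => 4 * C * sqn (cind I x))).
- by apply: (L2M_bounded mf fC); exact: L2_indI.
- by move=> n; case: (Qg n).
- exact/integrable_scale/L2_integrable_sqn/L2_indI.
- move=> n x; rewrite -mulrBl sqnM ler_wpM2r ?sqn_ge0//.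
  rewrite (le_trans (sqnD_le _ _))// sqnN.
  by have := fC x; have := gC n x; lra.
- move=> x; under eq_fun do rewrite -mulrBl sqnM.
  by rewrite -(mul0r (sqn (cind I x))); apply: cvgM => //; exact: cvg_cst.
Qed.

Let sinL t x := sin (2 * pi / L * (x - t)).

Let measurable_sinL t : measurable_fun setT (sinL t : T -> R).
Proof.
have m1 : measurable_fun setT (fun x : T => 2 * pi / L * (x - t) : R).
  apply: measurable_funM; first exact: measurable_cst.
  by apply: measurable_funB => //; exact: measurable_cst.
exact: (measurableT_comp (continuous_measurable_fun (@continuous_sin R)) m1).
Qed.

Let Q_sinL t : Q (fun x => (sinL t x)%:C).
Proof.
pose th := 2 * pi / L * t.
(* Euler's formula for the sine, with 1 / (2i) = - i / 2. *)
have -> : (fun x => (sinL t x)%:C) = (fun x =>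
    (0 -i* (2^-1)) * cis (- th) * expi 1 x + (0 +i* (2^-1)) * cis th * expi (-1) x).
  apply/funext => x; rewrite /sinL mulrBr -/th /expi.
  have -> : 2 * pi * 1%:~R / L * x = 2 * pi / L * x by ring.
  have -> : 2 * pi * (-1)%:~R / L * x = - (2 * pi / L * x) by ring.
  by apply: complexP; rewrite !ReImE /= ?sinB !cosN !sinN; field.
by apply: Q_add; apply: Q_scale; exact: Q_expi.
Qed.

(** Modulo L, the open arc of length L / 2 starting at t. *)
Let S t : set T := [set x | 0 < sinL t x].

Let measurable_S t : measurable (S t).
Proof.
rewrite (_ : S t = setT `&` sinL t @^-1` `]0, +oo[%classic).
  by apply: measurable_sinL => //; exact: measurable_itv.
by rewrite setTI; apply/seteqP; split=> x; rewrite /S/= in_itv/= andbT.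
Qed.

Let cind_bounded A : exists C : R, forall x : T, sqn (cind A x : R[i]) <= C.
Proof. by exists 1 => x; rewrite sqn_cind indicE; case: (_ \in _); rewrite ?ler01. Qed.

Let Q_S t : Q (cind (S t)).
Proof.
pose y n x := iter n (@sgn_step R) (sinL t x).
have y1 n x : `|y n x| <= 1 by apply: iter_sgn_step_le1; exact: sin_max.
have Qy n : Q (fun x => (y n x)%:C).
  elim: n => [|n ih]; first exact: Q_sinL.
  rewrite (_ : (fun x => _) = (fun x => (3 / 2 : R)%:C * (y n x)%:C +
      (- 2^-1 : R)%:C * ((y n x)%:C * ((y n x)%:C * (y n x)%:C)))).
    by apply: Q_add; apply: Q_scale => //; do 2 apply: Q_mul => //.
  apply/funext => x; rewrite -!rmorphM -rmorphD; congr _%:C.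
  by rewrite /y/= {1}/sgn_step; field.
(* The polynomial (y + y^2) / 2 sends -1, 0, 1 to 0, 0, 1, so it turns the sign into the indicator
   of positivity and still stays in [-1, 1] there. *)
pose g n x : R := (y n x + y n x * y n x) / 2.
have g1 n x : `|g n x| <= 1.
  have := y1 n x; rewrite /g !ler_norml => /andP[a1 a2].
  by apply/andP; split; nra.
apply: (@Q_lim _ (fun n x => (g n x)%:C) 1).
- exact: cmeasurable_cind.
- by move=> x; rewrite sqn_cind indicE; case: (_ \in _); rewrite ?ler01.
- move=> n; rewrite (_ : (fun x => _) = (fun x => (2^-1 : R)%:C * ((y n x)%:C +
      (y n x)%:C * (y n x)%:C))).
    by apply: Q_scale; apply: Q_add => //; exact: Q_mul.
  by apply/funext => x; rewrite -rmorphM -rmorphD -rmorphM /g mulrC.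
- by move=> n x; rewrite sqn_real -real_normK ?num_real// expr_le1// normr_ge0.
- move=> x.
  have yx : y n x @[n --> \oo] --> Num.sg (sinL t x).
    by apply: cvg_iter_sgn_step; exact: sin_max.
  have gx : g n x @[n --> \oo] --> (\1_(S t) x : R).
    rewrite (_ : \1_(S t) x = (Num.sg (sinL t x) +
      Num.sg (sinL t x) * Num.sg (sinL t x)) / 2).
      by apply: cvgM; [apply: cvgD => //; exact: cvgM|exact: cvg_cst].
    rewrite indicE.
    have [s0|s0|s0] := ltrgtP 0 (sinL t x).
    + by rewrite gtr0_sg// mem_set//= mulr1n; field.
    + rewrite ltr0_sg// memNset; last by rewrite /S/= lt_gtF.
      by rewrite /= mulr0n; field.
    + by rewrite -s0 sgr0 memNset ?mulr0 ?addr0 ?mul0r// /S/= -s0 ltxx.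
  under eq_fun do rewrite /cind -rmorphB sqn_real expr2.
  rewrite -(mulr0 (\1_(S t) x - \1_(S t) x)) -[X in (_ * X)](subrr (\1_(S t) x)).
  by apply: cvgM; apply: cvgB => //; exact: cvg_cst.
Qed.

Let Q_setI A B : Q (cind A) -> Q (cind B) -> Q (cind (A `&` B)).
Proof.
move=> QA QB; rewrite (_ : cind _ = fun x => cind A x * cind B x); first exact: Q_mul.
by apply/funext => x; rewrite cindI.
Qed.

Let Q_setC A : Q (cind A) -> Q (cind (~` A)).
Proof.
move=> QA; rewrite (_ : cind _ = fun x => 1 + (-1) * cind A x).
  by apply: Q_add; [exact: Q_cst|exact: Q_scale].
apply/funext => x; have [Ax|Ax] := pselect (A x).
  by rewrite (cindT Ax) cindF ?mulr1 ?subrr//; exact.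
by rewrite (cindF Ax) cindT ?mulr0 ?addr0.
Qed.

Let Q_setU A B : Q (cind A) -> Q (cind B) -> Q (cind (A `|` B)).
Proof.
by move=> QA QB; rewrite -[A `|` B]setCK setCU; apply/Q_setC/Q_setI; exact: Q_setC.
Qed.

Let S_gt0 t x : 0 < x - t < L / 2 -> S t x.
Proof.
move=> /andP[x0 xL]; apply: sin_gt0_pi; apply/andP; split.
  by rewrite !mulr_gt0 ?invr_gt0 ?pi_gt0.
rewrite (_ : 2 * pi / L * (x - t) = pi * ((x - t) / (L / 2))); last first.
  by field; rewrite gt_eqF.
by rewrite gtr_pMr ?pi_gt0// ltr_pdivrMr ?mul1r// divr_gt0.
Qed.

Let S_le0 t x : - (L / 2) <= x - t <= 0 -> ~ S t x.
Proof.
move=> /andP[xL x0]; rewrite /S/= /sinL => s0.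
suff : 0 <= sin (2 * pi / L * (t - x)).
  by rewrite -opprB mulrN sinN oppr_ge0 leNgt s0.
have xt : 0 <= t - x by rewrite -oppr_le0 opprB.
apply: sin_ge0_pi; apply/andP; split.
  by rewrite !mulr_ge0 ?invr_ge0 ?pi_ge0// ltW.
rewrite (_ : 2 * pi / L * (t - x) = pi * ((t - x) / (L / 2))); last first.
  by field; rewrite gt_eqF.
rewrite ger_pMr ?pi_gt0// ler_pdivrMr ?mul1r ?divr_gt0//.
by rewrite -lerN2 opprB.
Qed.

(** Inside the interval, a ray is a Boolean combination of half-period arcs; which one depends on
    the position of s with respect to the midpoint m. *)
Let Q_ray s : Q (cind (`]s, +oo[%classic : set T)).
Proof.
have mr : cmeasurable (cind (`]s, +oo[%classic : set T) : T -> R[i]).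
  by apply: cmeasurable_cind; exact: measurable_itv.
have eqQ A : Q (cind A) -> (forall x, I x -> A x <-> s < x) ->
    Q (cind (`]s, +oo[%classic : set T)).
  move=> QA Ax; apply: (Q_eq QA) => // x Ix.
  have [sx|sx] := pselect (A x).
    by rewrite !cindT//= in_itv/= andbT; apply/Ax.
  by rewrite !cindF//= in_itv/= andbT => /(Ax x Ix).
have Itv x : I x -> a <= x < a + L by rewrite /= in_itv.
set m := a + L / 2.
have [sa|sa] := ltP s a.
  apply: (@eqQ setT).
    rewrite (_ : cind _ = fun=> 1); first exact: Q_cst.
    by apply/funext => x; rewrite cindT.
  by move=> x /Itv/andP[ax _]; split=> // _; exact: lt_le_trans ax.
have [sL|sL] := leP (a + L) s.
  apply: (@eqQ set0).
    rewrite (_ : cind _ = fun=> 0); first exact: Q_cst.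
    by apply/funext => x; rewrite cindF.
  move=> x /Itv/andP[_ xL]; split=> // sx.
  by have := lt_le_trans xL sL; rewrite ltNge (ltW sx).
have mE : m = a + L / 2 by [].
have [ms|sm] := leP m s.
  (* The arc from s wraps around to the beginning of the interval; intersecting with the arc from m,
     which is the open right half, removes that piece. *)
  apply: (@eqQ (S s `&` S m)); first by apply: Q_setI; exact: Q_S.
  move=> x /Itv/andP[ax xL]; split=> [[Ssx Smx]|sx].
    rewrite ltNge; apply/negP => xs.
    have [xm|xm] := leP x m.
      by apply: S_le0 Smx; lra.
    by apply: S_le0 Ssx; lra.
  by split; apply: S_gt0; lra.
(* The arcs from s and from m are open; when s = a both miss the point m, which the third arc
   covers. *)
apply: (@eqQ ((S s `|` S m) `|` S ((s + m) / 2))).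
  by apply: Q_setU; [apply: Q_setU|]; exact: Q_S.
move=> x /Itv/andP[ax xL]; split=> [Sx|sx].
  rewrite ltNge; apply/negP => xs; move: Sx => -[[]|].
  - by apply: S_le0; lra.
  - by apply: S_le0; lra.
  - by apply: S_le0; lra.
have [x1|x1] := ltP x (s + L / 2); first by left; left; apply: S_gt0; lra.
have [x2|x2] := ltP m x.
  by left; right; apply: S_gt0; lra.
by right; apply: S_gt0; lra.
Qed.

Lemma trig_approx h : L2 mu h -> approx mu trig (fun x => cind I x * h x).
Proof.
move=> Lh.
suff [] : L2 mu h /\ V (fun x => cind I x * h x) by [].
have bI x : sqn (cind I x : R[i]) <= 1.
  by rewrite sqn_cind indicE; case: (_ \in _); rewrite ?ler01.
refine (csub_indic_dense (P := fun h => L2 mu h /\ V (fun x => cind I x * h x))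
  (csub_mulr cV (cmeasurable_cind mI) bI) _ Lh) => A mA Aoo.
split; first exact: L2_cind.
rewrite (_ : (fun x => _) = cind (A `&` I)); last first.
  by apply/funext => x; rewrite cindI mulrC.
apply: (csub_dynkin cV mI _ (RGenOInfty.measurableE R)) mA.
- by rewrite [ltLHS](_ : _ = L%:E) ?ltry//; exact: muI.
- move=> _ _ [s ->] [t ->]; exists (Num.max s t).
  apply/seteqP; split=> x /=; rewrite !in_itv/= !andbT gt_max.
    by move=> [-> ->].
  by move=> /andP[].
- have [_ _] := Q_cst 1.
  by under eq_fun do rewrite mul1r.
- move=> _ [s ->]; have [_ _] := Q_ray s.
  rewrite (_ : (fun x => _) = cind (`]s, +oo[%classic `&` I))//.
  by apply/funext => x; rewrite cindI.
Qed.

End trigonometric_system.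

(** * Plancherel *)

Section norm_limits.
Context d (T : measurableType d) (R : realType).
Variable mu : {measure set T -> \bar R}.
Implicit Types f g : T -> R[i].
Local Notation L2 := (L2 mu).
Local Notation n2 := (n2 mu).
Local Notation nsq := (nsq mu).

(** Expand the squared norm of t f - g. For small t the constant in front of the first norm is close
    to 1, which the factor 2 of [nsqD_le] does not allow and which limits of norms require. *)
Lemma n2D_le f g (t : R) : 0 < t -> L2 f -> L2 g ->
  n2 (fun x => f x + g x) <= (1 + t) * n2 f + (1 + t^-1) * n2 g.
Proof.
move=> t0 Lf Lg; rewrite n2D//; set z := L2_inner mu f g.
have h : 0 <= t ^+ 2 * n2 f + n2 g - 2 * t * complex.Re z.
  have := n2_ge0 mu (fun x => t%:C * f x + (-1) * g x).
  have Ltf := L2Z t%:C Lf; have Lg' := L2Z (-1) Lg.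
  rewrite n2D// ipZl// ipZr// !n2Z// sqn_real sqnN sqn1 -/z !ReImE/=.
  by congr (_ <= _); ring.
rewrite -subr_ge0 (_ : _ - _ =
  (t ^+ 2 * n2 f + n2 g - 2 * t * complex.Re z) / t); first by rewrite divr_ge0// ltW.
by field; rewrite gt_eqF.
Qed.

End norm_limits.

(** Norms pass to the limit: f is compared with g, then g' with f', each time by [n2D_le]. The two
    spaces may differ; below, f' is the transform of f or conversely. *)
Lemma n2_le_lim d (T : measurableType d) d' (T' : measurableType d') (R : realType)
    (mu : {measure set T -> \bar R}) (mu' : {measure set T' -> \bar R})
    (f : T -> R[i]) (f' : T' -> R[i]) :
  L2 mu f -> L2 mu' f' ->
  (forall eps : R, 0 < eps -> exists g g', [/\ L2 mu g, L2 mu' g', n2 mu g = n2 mu' g',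
     (nsq mu (fun x => (f x - g x)%R) < eps%:E)%E &
     (nsq mu' (fun x => (f' x - g' x)%R) < eps%:E)%E]) ->
  n2 mu f <= n2 mu' f'.
Proof.
move=> Lf Lf' H; apply/ler_addgt0Pr => e e0.
set B := n2 mu' f'; have B0 : 0 <= B by exact: n2_ge0.
(* For t <= 1 one has (1 + t)^2 B <= B + 3 t B, and 6 B t <= e makes the excess at most e / 2. *)
pose t := Num.min 1 (e / (6 * B + 1)).
have B1 : 0 < 6 * B + 1 by rewrite ltr_wpDl// mulr_ge0.
have t0 : 0 < t by rewrite lt_min ltr01 divr_gt0.
have t1 : t <= 1 by rewrite ge_min lexx.
have tB : t * (6 * B + 1) <= e by rewrite -ler_pdivlMr// ge_min lexx orbT.
have ti0 : 0 < t^-1 by rewrite invr_gt0.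
(* The sum of the coefficients of the two errors, (1 + t)(1 + 1/t) and 1 + 1/t; errors below e /
   (2K) thus contribute at most e / 2. *)
pose K := (1 + t^-1) * (2 + t).
have K0 : 0 < K by rewrite mulr_gt0 ?addr_gt0.
have K2 : 0 < 2 * K by rewrite mulr_gt0.
have eK : 0 < e / (2 * K) by rewrite divr_gt0.
have [g [g' [Lg Lg' gg' fg fg']]] := H _ eK.
have Lfg := L2B Lf Lg; have Lfg' := L2N (L2B Lf' Lg').
have h1 := n2D_le t0 Lg Lfg; have h2 := n2D_le t0 Lf' Lfg'.
have E1 : (fun x => g x + (f x - g x)) = f by apply/funext => x; rewrite addrC subrK.
have E2 : (fun x => f' x + - (f' x - g' x)) = g'.
  by apply/funext => x; rewrite opprB addrC subrK.
rewrite E1 gg' in h1; rewrite E2 in h2.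
move: fg fg'; rewrite -(nsqN mu' (fun x => f' x - g' x)) !nsqE// !lte_fin.
rewrite !ltr_pdivlMr//.
set D := n2 mu _; set D' := n2 mu' _ => DK D'K.
have D0 : 0 <= D by exact: n2_ge0.
rewrite -/D in h1; rewrite -/D' -/B in h2.
have h3 : (1 + t) * n2 mu' g' <= (1 + t) * ((1 + t) * B + (1 + t^-1) * D').
  by rewrite ler_wpM2l// addr_ge0// ltW.
apply: (le_trans h1); apply: (@le_trans _ _
  ((1 + t) * (1 + t) * B + (1 + t) * ((1 + t^-1) * D') + (1 + t^-1) * D)).
  by rewrite lerD2r (le_trans h3)// mulrDr mulrA.
have h4 : (1 + t) * ((1 + t^-1) * D') + (1 + t^-1) * D <= e / 2.
  have -> : e / 2 = (1 + t) * ((1 + t^-1) * (e / (2 * K))) + (1 + t^-1) * (e / (2 * K)).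
    by rewrite /K; field; rewrite ?gt_eqF ?addr_gt0.
  have t1' : 0 <= 1 + t by rewrite addr_ge0// ltW.
  have ti1 : 0 <= 1 + t^-1 by rewrite addr_ge0// ltW.
  by apply: lerD; [apply: ler_wpM2l => //|]; apply: ler_wpM2l => //;
    rewrite ltW// ltr_pdivlMr.
have h5 : (1 + t) * (1 + t) * B <= B + e / 2 by nra.
by rewrite -addrA; lra.
Qed.

Lemma n2_eq_lim d (T : measurableType d) d' (T' : measurableType d') (R : realType)
    (mu : {measure set T -> \bar R}) (mu' : {measure set T' -> \bar R})
    (f : T -> R[i]) (f' : T' -> R[i]) :
  L2 mu f -> L2 mu' f' ->
  (forall eps : R, 0 < eps -> exists g g', [/\ L2 mu g, L2 mu' g', n2 mu g = n2 mu' g',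
     (nsq mu (fun x => (f x - g x)%R) < eps%:E)%E &
     (nsq mu' (fun x => (f' x - g' x)%R) < eps%:E)%E]) ->
  n2 mu f = n2 mu' f'.
Proof.
move=> Lf Lf' H; apply/eqP; rewrite eq_le; apply/andP; split.
  exact: n2_le_lim.
apply: n2_le_lim => // eps /H[g [g' [Lg Lg' gg' h h']]]; by exists g', g.
Qed.

(** * Parseval's identity, periodization and Plancherel for compact support *)

Section windows.
Variable R : realType.

Definition window (N : nat) : seq int := [seq (i%:Z - N%:Z)%R | i <- iota 0 N.*2].

Lemma window_uniq N : uniq (window N).
Proof. by rewrite map_inj_uniq ?iota_uniq// => i j ij; lia. Qed.

Lemma mem_window N (k : int) : (k \in window N) = (- N%:Z <= k < N%:Z).
Proof.
apply/mapP/idP => [ [j]|/andP[k1 k2]].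
  by rewrite mem_iota => /andP[_ jN] ->; lia.
exists (absz (k + N%:Z)); last by lia.
by rewrite mem_iota; lia.
Qed.

Lemma ler_sum_uniq_sub (I : eqType) (s t : seq I) (F : I -> R) :
  uniq s -> uniq t -> {subset s <= t} -> (forall i, 0 <= F i) ->
  \sum_(i <- s) F i <= \sum_(i <- t) F i.
Proof.
move=> us ut st F0; rewrite [leRHS](bigID (mem s))/= -[leLHS]addr0 lerD//.
  have ps : perm_eq s [seq i <- t | i \in s].
    apply: uniq_perm => //; first exact: filter_uniq.
    by move=> i; rewrite mem_filter; apply/idP/andP => [si|[]//]; split=> //; exact: st.
  by rewrite (perm_big _ ps)/= big_filter.
by apply: sumr_ge0 => i _.
Qed.

End windows.

Section plancherel.
Variable R : realType.
Local Notation mu := (@lebesgue_measure R).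
Local Notation T := (measurableTypeR R).
Implicit Types u v : T -> R[i].

(** A good approximant involves finitely many frequencies, all contained in some window. From that
    window on, the partial sums are close to the norm, and Bessel's inequality bounds them above. *)
Lemma trig_parseval (a L : R) h : 0 < L -> L2 mu h ->
  (forall x, ~ `[a, a + L[%classic x -> h x = 0) ->
  \sum_(k <- window N) sqn (L2_inner mu h (trig a L k)) @[N --> \oo] --> n2 mu h.
Proof.
move=> L0 Lh h0.
have ah : approx mu (@trig R a L) h.
  have := trig_approx a L0 Lh; congr approx; apply/funext => x.
  have [Ix|Ix] := pselect (`[a, a + L[%classic x); first by rewrite cindT ?mul1r.
  by rewrite cindF// mul0r h0.
apply/cvgrPdist_le => eps e0.
have [s us hs] := approx_parseval (@L2_trig R a L L0) (@trig_orthonormal R a L L0) ah e0.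
have [N0 sN0] : exists N0, {subset s <= window N0}.
  have [N0 H] : exists N0 : nat, forall k, k \in s -> (absz k < N0)%N.
    elim: s {us hs} => [|k s [N0 ih]]; first by exists 0%N.
    exists (maxn N0 (absz k).+1) => l; rewrite in_cons => /predU1P[->|/ih].
      by rewrite leq_max ltnSn orbT.
    by rewrite leq_max => ->.
  by exists N0 => k /H; rewrite mem_window; lia.
exists N0 => // N /= N0N.
have h1 : \sum_(k <- window N) sqn (L2_inner mu h (trig a L k)) <= n2 mu h.
  by apply: bessel => //; [exact: L2_trig|exact: trig_orthonormal|exact: window_uniq].
have h2 : \sum_(k <- s) sqn (L2_inner mu h (trig a L k)) <=
    \sum_(k <- window N) sqn (L2_inner mu h (trig a L k)).
  apply: ler_sum_uniq_sub => //; first exact: window_uniq.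
    by move=> k /sN0; rewrite !mem_window; lia.
  by move=> k; exact: sqn_ge0.
by rewrite ger0_norm ?subr_ge0// lerBlDr -lerBlDl (le_trans (ltW hs)).
Qed.

(** The positive and negative parts of the integrand are treated separately: Tonelli makes the
    integral of each measurable in the frequency. *)
Lemma cmeasurable_fourier u : cmeasurable u -> cmeasurable (fourier u : T -> R[i]).
Proof.
move=> [u1 u2].
have m1 (v : T -> R) : measurable_fun setT v ->
    measurable_fun setT (fun z : T * T => v z.2).
  by move=> mv; exact: (measurableT_comp mv measurable_snd).
have mF : cmeasurable (fun z : T * T => u z.2 * cis (- (2 * pi * z.2 * z.1))).
  apply: cmeasurableM; first by split; [exact: (m1 _ u1)|exact: (m1 _ u2)].
  apply: cmeasurable_cis; apply: measurable_funN; apply: measurable_funM.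
    by apply: measurable_funM; [exact: measurable_cst|exact: measurable_snd].
  exact: measurable_fst.
have mI (g : T * T -> R) : measurable_fun setT g ->
    measurable_fun setT (fun x : T => (\int[mu]_y g (x, y))%R : R).
  move=> /measurable_EFinP mg.
  rewrite /Rintegral; apply: (measurableT_comp (fine_measurable _)) => //.
  rewrite (_ : (fun x => _) = (fun x => (\int[mu]_y ((EFin \o g)^\+ (x, y)) -
      \int[mu]_y ((EFin \o g)^\- (x, y)))%E)); last first.
    by apply/funext => x; rewrite integralE; congr (_ - _)%E;
      apply: eq_integral => y _; rewrite ?funeposE ?funenegE.
  have mp : measurable_fun setT (fubini_F mu ((EFin \o g)^\+)%E).
    by apply: measurable_fun_fubini_tonelli_F => //; exact: measurable_funepos.
  have mn : measurable_fun setT (fubini_F mu ((EFin \o g)^\-)%E).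
    by apply: measurable_fun_fubini_tonelli_F => //; exact: measurable_funeneg.
  exact: (emeasurable_funB mp mn).
by case: mF => mF1 mF2; split; [exact: (mI _ mF1)|exact: (mI _ mF2)].
Qed.

Lemma window_tile (w : R) (N : nat) x : 0 < w ->
  \sum_(k <- window N) (\1_(`[0, w[%classic : set R) (x - k%:~R * w) : R) =
  (Num.floor (x / w) \in window N)%:R.
Proof.
move=> w0; have E k : (\1_(`[0, w[%classic : set R) (x - k%:~R * w) : R) =
    (k == Num.floor (x / w))%:R.
  rewrite indicE; congr (nat_of_bool _)%:R.
  rewrite mem_setE in_itv/= subr_ge0 eq_sym floor_eq.
  by rewrite ler_pdivlMr// ltr_pdivrMr// ltrBlDl intrD mulrDl mul1r.
under eq_bigr do rewrite E.
have [kN|kN] := boolP (_ \in _).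
  rewrite (bigD1_seq _ kN) ?window_uniq//= eqxx big1_seq ?addr0//.
  by move=> k /andP[/negPf -> _].
rewrite big1_seq// => k /andP[_ kw]; case: eqP => // kE.
by move: kN; rewrite -kE kw.
Qed.

(** Periodization: the cells [k w, (k + 1) w) tile the line, so translating each of them back to [0,
    w) recovers the whole integral. [D N] is the indicator of the cells in the window, and increases
    to 1. *)
Lemma nsq_windows (w : R) (F : T -> R[i]) : 0 < w -> cmeasurable F ->
  (\int[mu]_x ((\1_(`[0%R, w[%classic : set R) x : R) *
     \sum_(k <- window N) sqn (F (x + k%:~R * w)))%:E)%E @[N --> \oo] -->
  nsq mu F.
Proof.
move=> w0 mF; set J := (`[0%R, w[%classic : set R).
have mJ : measurable_fun setT (fun x : T => \1_J x : R).
  by apply: measurable_indic; exact: measurable_itv.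
pose D N x : R := \sum_(k <- window N) (\1_J (x - k%:~R * w) : R).
have DE N x : D N x = (Num.floor (x / w) \in window N)%:R by exact: window_tile.
have mJs c : measurable_fun setT (fun x : T => \1_J (x - c) : R).
  exact: (measurableT_comp mJ (@measurable_shift R (- c))).
have mD N : measurable_fun setT (D N : T -> R).
  by apply: measurable_sum => k; exact: mJs.
have mS := measurable_sqn mF.
have E N : (\int[mu]_x (\1_J x * \sum_(k <- window N) sqn (F (x + k%:~R * w)))%:E)%E =
    (\int[mu]_x (sqn (F x) * D N x)%:E)%E.
  have mFk k : measurable_fun setT (fun x : T => sqn (F (x + k%:~R * w))).
    by apply: measurable_sqn; exact: cmeasurable_shift.
  transitivity (\sum_(k <- window N)
      \int[mu]_x (\1_J x * sqn (F (x + k%:~R * w)))%:E)%E.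
    rewrite -ge0_integral_sum//.
    - by apply: eq_integral => x _; rewrite sumEFin mulr_sumr.
    - by move=> k; apply/measurable_EFinP; apply: measurable_funM.
    - by move=> k x _; rewrite lee_fin mulr_ge0 ?sqn_ge0.
  transitivity (\sum_(k <- window N)
      \int[mu]_x (sqn (F x) * \1_J (x - k%:~R * w))%:E)%E.
    apply: eq_bigr => k _.
    rewrite -(@ge0_integral_shift R (k%:~R * w)
      (fun x => (sqn (F x) * \1_J (x - k%:~R * w))%:E)).
    - by apply: eq_integral => x _; rewrite addrK mulrC.
    - by apply/measurable_EFinP; apply: measurable_funM.
    - by move=> x; rewrite lee_fin mulr_ge0 ?sqn_ge0.
  rewrite -ge0_integral_sum//.
  - by apply: eq_integral => x _; rewrite sumEFin -mulr_sumr.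
  - by move=> k; apply/measurable_EFinP; apply: measurable_funM.
  - by move=> k x _; rewrite lee_fin mulr_ge0 ?sqn_ge0.
rewrite (_ : (fun N => _) = (fun N => \int[mu]_x (sqn (F x) * D N x)%:E)%E); last first.
  by apply/funext => N; exact: E.
have nd x : {homo (fun N => (sqn (F x) * D N x)%:E) : m n / (m <= n)%N >-> (m <= n)%E}.
  move=> m n mn; rewrite lee_fin ler_wpM2l ?sqn_ge0// !DE ler_nat.
  case E1 : (_ \in window m) => //=.
  by move: E1; rewrite !mem_window => E1; rewrite (_ : _ && _ = true)//; lia.
have := @cvg_monotone_convergence _ _ _ mu setT measurableT
  (fun N x => (sqn (F x) * D N x)%:E).
move=> /(_ _ _ _)/=.
rewrite (_ : nsq mu F =
  (\int[mu]_x (limn (fun N => (sqn (F x) * D N x)%:E)))%E).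
  apply.
  - by move=> N; apply/measurable_EFinP; apply: measurable_funM.
  - by move=> N x _; rewrite lee_fin mulr_ge0 ?sqn_ge0// DE.
  - by move=> x _; exact: nd.
apply: eq_integral => x _; apply/esym/cvg_lim => //.
apply: cvg_near_cst; exists (absz (Num.floor (x / w))).+1 => // N /= fN.
rewrite DE (_ : _ \in _ = true) ?mulr1//.
by move: fN; move: (Num.floor _) => k; rewrite mem_window; lia.
Qed.

(** Up to the factor L^(-1/2), the values of the transform at xi + k / L are the Fourier
    coefficients on [a, a + L) of [h xi], which has the norm of u. By Parseval their squares sum to
    L times the squared norm of u, whatever xi, and the frequencies modulo 1 / L fill an interval of
    length 1 / L. *)
Lemma plancherel_compact (a L : R) u : 0 < L -> L2 mu u ->
  (forall x, ~ `[a, a + L[%classic x -> u x = 0) ->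
  nsq mu (fourier u : T -> R[i]) = nsq mu u.
Proof.
move=> L0 Lu u0; have [mu_ _] := Lu.
pose h xi (x : T) : R[i] := cis (- (2 * pi * x * xi)) * u x.
have mc xi : cmeasurable (fun x : T => cis (- (2 * pi * x * xi))).
  apply: cmeasurable_cis; apply: measurable_funN.
  apply: measurable_funM; last exact: measurable_cst.
  by apply: measurable_funM; [exact: measurable_cst|exact: measurable_id].
have Lh xi : L2 mu (h xi).
  by apply: (L2M_bounded (C := 1) (mc xi)) Lu => x; rewrite sqn_cis.
have h0 xi x : ~ `[a, a + L[%classic x -> h xi x = 0.
  by move=> /u0; rewrite /h => ->; rewrite mulr0.
have nh xi : n2 mu (h xi) = n2 mu u.
  congr fine; apply: eq_integral => x _.
  by rewrite sqnM sqn_cis mul1r.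
have ipE xi k : sqn (L2_inner mu (h xi) (trig a L k)) =
    L^-1 * sqn (fourier u (xi + k%:~R * L^-1)).
  rewrite -{1}(sqr_rsqrtL L0) -sqn_real -sqnM; congr sqn.
  rewrite /fourier -cintegralZ.
    apply: eq_cintegral => x; rewrite /h /trig !conjcM conjcR.
    have [Ix|Ix] := pselect (`[a, a + L[%classic x); last by rewrite u0// !(mulr0, mul0r).
    rewrite cindT// conjc1 /expi -cisN.
    rewrite (_ : - (2 * pi * x * (xi + k%:~R / L)) =
      - (2 * pi * x * xi) + - (2 * pi * k%:~R / L * x)); last by ring.
    by rewrite cisD; ring.
  rewrite (_ : (fun x => _) = (fun x => h (xi + k%:~R * L^-1) x * (cind `[a, a + L[ x)^*)).
    by apply: L2_cintegrable => //; exact: L2_indI.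
  apply/funext => x; rewrite /h.
  have [Ix|Ix] := pselect (`[a, a + L[%classic x).
    by rewrite cindT// conjc1 mulr1 mulrC.
  by rewrite u0// !(mul0r, mulr0).
have Li0 : 0 < L^-1 by rewrite invr_gt0.
have cw := nsq_windows Li0 (cmeasurable_fourier mu_).
set J := (`[0%R, L^-1[%classic : set R) in cw.
have mJ : measurable_fun setT (fun x : T => \1_J x : R).
  by apply: measurable_indic; exact: measurable_itv.
have sumE N x : \sum_(k <- window N) sqn (fourier u (x + k%:~R * L^-1)) =
    L * \sum_(k <- window N) sqn (L2_inner mu (h x) (trig a L k)).
  rewrite mulr_sumr; apply: eq_bigr => k _.
  by rewrite ipE mulrA mulfV ?mul1r// gt_eqF.
have mf := measurable_sqn (cmeasurable_fourier mu_).
(* The same integrals as in [cw], computed in a second way: Parseval gives the pointwise limit and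
   Bessel the domination. *)
have cd : (\int[mu]_x (\1_J x * \sum_(k <- window N)
      sqn (fourier u (x + k%:~R * L^-1)))%:E)%E @[N --> \oo] -->
    (\int[mu]_x ((\1_J x : R) * (L * n2 mu u))%:E)%E.
  apply: (@dominated_cvg _ _ _ mu setT measurableT _ _
    (fun x => ((\1_J x : R) * (L * n2 mu u))%:E)) => //.
  - move=> N; apply/measurable_EFinP/measurable_funM => //.
    apply: measurable_sum => k; apply: measurable_sqn.
    exact/cmeasurable_shift/cmeasurable_fourier.
  - move=> x _; apply: cvg_EFin; first exact: nearW.
    apply: cvgM; first exact: cvg_cst.
    rewrite (_ : (fun N => _) = (fun N => L * \sum_(k <- window N)
      sqn (L2_inner mu (h x) (trig a L k)))); last by apply/funext => N; exact: sumE.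
    apply: cvgM; first exact: cvg_cst.
    by rewrite -(nh x); exact: (trig_parseval L0 (Lh x) (h0 x)).
  - under eq_fun do rewrite mulrC.
    by apply: integrable_scale; exact: integrable_indic_itv.
  - move=> N x _; rewrite gee0_abs; last first.
      by rewrite lee_fin mulr_ge0// sumr_ge0// => k _; exact: sqn_ge0.
    rewrite lee_fin ler_wpM2l// sumE ler_wpM2l ?(ltW L0)// -(nh x).
    exact: (bessel (@L2_trig R a L L0) (trig_orthonormal a L0) (window_uniq N) (Lh x)).
have := cvg_unique (@ereal_hausdorff R) cw cd.
move=> ->; rewrite (nsqE Lu); under eq_integral do rewrite mulrC EFinM.
rewrite integralZl//; last exact: integrable_indic_itv.
rewrite integral_indic//; last exact: measurable_itv.
rewrite setIT [X in (_ * X)%E](_ : _ = (L^-1)%:E).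
  by rewrite -EFinM mulrAC mulfV ?mul1r// gt_eqF.
by have := lebesgue_measure_itv_co 0 Li0; rewrite add0r.
Qed.

End plancherel.

Lemma limn_einf_le (R : realType) (v : (\bar R)^nat) (C : \bar R) :
  (forall n, (v n <= C)%E) -> (limn_einf v <= C)%E.
Proof.
move=> vC; rewrite limn_einf_lim; apply: lime_le; first exact: is_cvg_einfs.
apply: nearW => n; apply: le_trans (vC n); apply: ereal_inf_lbound.
by exists n => /=.
Qed.

Section cintegral_limit.
Context d (T : measurableType d) (R : realType).
Variable mu : {measure set T -> \bar R}.

Lemma cintegral_dct (f : T -> R[i]) (g : nat -> T -> R[i]) (G : T -> R) :
  cintegrable mu f -> (forall n, cmeasurable (g n)) ->
  mu.-integrable setT (fun x => (G x)%:E) ->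
  (forall n x, normc (g n x) <= G x) ->
  (forall x, \forall n \near \oo, g n x = f x) ->
  sqn (cintegral mu (g n)) @[n --> \oo] --> sqn (cintegral mu f).
Proof.
move=> [f1 f2] mg iG gG gf.
have cv (p : R[i] -> R) : (forall z, `|p z| <= normc z) ->
    (forall n, measurable_fun setT (fun x => p (g n x))) ->
    mu.-integrable setT (fun x => (p (f x))%:E) ->
    \int[mu]_x p (g n x) @[n --> \oo] --> \int[mu]_x p (f x).
  move=> pn mp ipf; rewrite /Rintegral.
  have : (\int[mu]_x (p (g n x))%:E)%E @[n --> \oo] --> (\int[mu]_x (p (f x))%:E)%E.
    apply: (@dominated_cvg _ _ _ mu setT measurableT _ _ (EFin \o G)) => //.
    - by move=> n; exact/measurable_EFinP.
    - move=> x _; apply: cvg_near_cst; have [N _ H] := gf x.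
      by exists N => // n /H /= ->.
    - by move=> n x _ /=; rewrite lee_fin (le_trans (pn _)).
  rewrite -(fineK (integrable_fin_num measurableT ipf)).
  by move=> /fine_cvgP[].
rewrite /sqn /=; apply: cvgD; rewrite expr2; under eq_fun do rewrite expr2.
  by apply: cvgM; apply: cv => // [z|n]; rewrite ?normr_Re_le//; case: (mg n).
by apply: cvgM; apply: cv => // [z|n]; rewrite ?normr_Im_le//; case: (mg n).
Qed.

End cintegral_limit.

(** * Plancherel's identity on the intersection of L^1 and L^2, and Fourier pairs *)

Section plancherel_L1_L2.
Variable R : realType.
Local Notation mu := (@lebesgue_measure R).
Local Notation T := (measurableTypeR R).
Implicit Types u v f g : T -> R[i].

Lemma normc_cis (t : R) : normc (cis t) = 1.
Proof. by rewrite normcE_sqrt sqn_cis sqrtr1. Qed.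

Lemma cmeasurable_fourier_kernel (xi : R) :
  cmeasurable (fun x : T => cis (- (2 * pi * x * xi))).
Proof.
apply: cmeasurable_cis; apply: measurable_funN.
apply: measurable_funM; last exact: measurable_cst.
by apply: measurable_funM; [exact: measurable_cst|exact: measurable_id].
Qed.

Lemma cintegrable_fourier_kernel u (xi : R) : cintegrable mu u ->
  cintegrable mu (fun x => u x * cis (- (2 * pi * x * xi))).
Proof.
move=> iu; apply: (cintegrable_le (G := fun x => normc (u x))).
- apply: cmeasurableM; first exact: (cintegrable_cmeasurable iu).
  exact: cmeasurable_fourier_kernel.
- exact: cintegrable_normc.
- by move=> x; rewrite normcM normc_cis mulr1.
Qed.

Lemma fourierD u v xi : cintegrable mu u -> cintegrable mu v ->
  fourier (fun x => u x + v x) xi = fourier u xi + fourier v xi.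
Proof.
move=> iu iv; rewrite /fourier -cintegralD; try exact: cintegrable_fourier_kernel.
by apply: eq_cintegral => x; rewrite mulrDl.
Qed.

Lemma fourierZ c u xi : cintegrable mu u ->
  fourier (fun x => c * u x) xi = c * fourier u xi.
Proof.
move=> iu; rewrite /fourier -cintegralZ; last exact: cintegrable_fourier_kernel.
by apply: eq_cintegral => x; rewrite mulrA.
Qed.

Lemma fourierB u v xi : cintegrable mu u -> cintegrable mu v ->
  fourier (fun x => u x - v x) xi = fourier u xi - fourier v xi.
Proof.
move=> iu iv; rewrite -mulN1r -fourierZ// -fourierD//; last exact: cintegrableZ.
by congr fourier; apply/funext => x; rewrite mulN1r.
Qed.

Lemma fourier_shift u (c xi : R) : cintegrable mu u ->
  fourier (fun x => u (x + c)) xi = cis (2 * pi * c * xi) * fourier u xi.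
Proof.
move=> iu; have mu_ := cintegrable_cmeasurable iu.
rewrite /fourier -cintegralZ; last exact: cintegrable_fourier_kernel.
rewrite -[RHS](@cintegral_shift R c); last first.
  apply: cmeasurableZ; apply: cmeasurableM => //; exact: cmeasurable_fourier_kernel.
apply: eq_cintegral => x; rewrite mulrCA -cisD; congr (_ * cis _); ring.
Qed.

(** The interval is [-N, N), written in the form [a, a + L) of [plancherel_compact]. *)
Definition trunc (N : nat) u (x : T) : R[i] :=
  u x * cind (`[- N%:R, - N%:R + N.*2%:R[%classic : set T) x.

Let trunc_eq u x : \forall N \near \oo, trunc N u x = u x.
Proof.
exists (Num.bound `|x|) => // N /= xN; rewrite /trunc cindT ?mulr1//= in_itv/=.
have xN' : `|x| < N%:R.
  by rewrite (lt_le_trans (archi_boundP (normr_ge0 x)))// ler_nat.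
by move: xN'; rewrite ltr_norml -addnn natrD => /andP[x1 x2]; lra.
Qed.

Let mtrunc N u : cmeasurable u -> cmeasurable (trunc N u).
Proof.
by move=> mu_; apply: cmeasurableM => //; apply: cmeasurable_cind; exact: measurable_itv.
Qed.

Let L2_trunc N u : L2 mu u -> L2 mu (trunc N u).
Proof. by move=> Lu; apply: L2M_cind => //; exact: measurable_itv. Qed.

Let normc_trunc N u x : normc (trunc N u x) <= normc (u x).
Proof.
rewrite /trunc normcM ler_piMr ?normc_ge0// normcE_sqrt sqn_cind indicE.
by case: (_ \in _); rewrite ?sqrtr1 ?sqrtr0 ?ler01.
Qed.

Let trunc_cintegrable N u : cintegrable mu u -> cintegrable mu (trunc N u).
Proof.
move=> iu; apply: cintegrable_le (cintegrable_normc iu) (normc_trunc N u).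
exact/mtrunc/(cintegrable_cmeasurable iu).
Qed.

Let sqn_trunc_le N u x : sqn (trunc N u x) <= sqn (u x).
Proof.
by rewrite sqnM ler_piMr ?sqn_ge0// sqn_cind indicE; case: (_ \in _); rewrite ?ler01.
Qed.

Lemma trunc_cvg u (eps : R) : L2 mu u -> 0 < eps -> exists N,
  (nsq mu (fun x => (u x - trunc N u x)%R) < eps%:E)%E.
Proof.
move=> Lu e0; have [mu_ _] := Lu.
have [n x|x|N H] := @nsq_dct _ _ _ mu u (fun N => trunc N u) (fun x => 4 * sqn (u x))
  mu_ (fun N => mtrunc N mu_) (integrable_scale 4 (L2_integrable_sqn Lu)) _ _ eps e0.
- rewrite (le_trans (sqnD_le _ _))// sqnN.
  by have := sqn_trunc_le n u x; have := sqn_ge0 (u x); lra.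
- apply: cvg_near_cst; have [N _ H] := trunc_eq u x.
  by exists N => // n /H /= ->; rewrite subrr sqn0.
- by exists N; exact: H.
Qed.

Let nsq_fourier_trunc N u : L2 mu u ->
  nsq mu (fourier (trunc N u) : T -> R[i]) = nsq mu (trunc N u).
Proof.
(* For N = 0 the interval is empty, whereas [plancherel_compact] asks for a positive length. *)
move=> Lu; case: N => [|N].
  have t0 : trunc 0 u = fun=> 0.
    apply/funext => x; rewrite /trunc cindF ?mulr0//= in_itv/= oppr0 addr0.
    by move=> /andP[/le_lt_trans /[apply]]; rewrite ltxx.
  rewrite t0 nsq0; apply: integral0_eq => x _.
  rewrite /fourier (_ : (fun x => _) = fun=> 0).
    by rewrite /cintegral /= /Rintegral !integral0 sqn0.
  by apply/funext => y; rewrite mul0r.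
apply: (@plancherel_compact R (- N.+1%:R) N.+1.*2%:R); rewrite ?ltr0n//.
  exact: L2_trunc.
by move=> x Ix; rewrite /trunc cindF// mulr0.
Qed.

(** Fatou's lemma along truncations, whose transforms converge pointwise as u is integrable. Only an
    inequality, but it puts the transform in L^2. *)
Let plancherel_le u : cintegrable mu u -> L2 mu u ->
  (nsq mu (fourier u : T -> R[i]) <= nsq mu u)%E.
Proof.
move=> iu Lu; have [mu_ _] := Lu.
have := @fatou _ _ _ mu setT measurableT
  (fun N xi => (sqn (fourier (trunc N u) xi))%:E).
move=> /(_ _ _)/le_trans; rewrite /nsq.
rewrite (_ : (fun x => limn_einf _) = (fun xi => (sqn (fourier u xi))%:E)); last first.
  apply/funext => xi.
  have cv : (sqn (fourier (trunc N u) xi))%:E @[N --> \oo] --> (sqn (fourier u xi))%:E.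
    apply: cvg_EFin; first exact: nearW.
    apply: (@cintegral_dct _ _ _ mu _ _ (fun x => normc (u x))).
    - exact: cintegrable_fourier_kernel.
    - move=> n; apply: cmeasurableM; first exact: mtrunc.
      exact: cmeasurable_fourier_kernel.
    - exact: cintegrable_normc.
    - by move=> n x; rewrite normcM normc_cis mulr1.
    - move=> x; have [N _ H] := trunc_eq u x.
      by exists N => // n /H /= ->.
  by have [] := cvg_limn_einf_sup cv.
apply.
- by move=> N; apply: measurable_sqnE; exact/cmeasurable_fourier/mtrunc.
- by move=> N x _; rewrite lee_fin sqn_ge0.
apply: limn_einf_le => N; rewrite -/(nsq mu _) nsq_fourier_trunc//.
by apply: le_nsq => //; exact: mtrunc.
Qed.

Lemma L2_fourier u : cintegrable mu u -> L2 mu u -> L2 mu (fourier u).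
Proof.
move=> iu Lu; split; first by apply: cmeasurable_fourier; case: Lu.
by apply: (le_lt_trans (plancherel_le iu Lu)); case: Lu.
Qed.

(** [plancherel_le] applied to u minus its truncation shows that the transforms of the truncations
    converge in L^2, and for these the identity is known. *)
Theorem plancherel u : cintegrable mu u -> L2 mu u ->
  n2 mu (fourier u) = n2 mu u.
Proof.
move=> iu Lu; apply/esym/n2_eq_lim => //; first exact: L2_fourier.
move=> eps e0; have [N HN] := trunc_cvg Lu e0.
have it := trunc_cintegrable N iu; have Lt := L2_trunc N Lu.
exists (trunc N u), (fourier (trunc N u)); split=> //.
- exact: L2_fourier.
- by rewrite /n2 nsq_fourier_trunc.
- apply: le_lt_trans HN.
  rewrite (_ : (fun x => _) = fourier (fun x => u x - trunc N u x)).
    apply: plancherel_le; last exact: L2B.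
    have := cintegrableD iu (cintegrableZ (-1) it).
    by congr cintegrable; apply/funext => x; rewrite mulN1r.
  by apply/funext => x; rewrite fourierB.
Qed.

(* As in [is_fourier_L2], with squared norms and without sequences. *)
Definition fourier_pair f g := [/\ L2 mu f, L2 mu g &
  forall eps : R, 0 < eps -> exists u, [/\ cintegrable mu u, L2 mu u,
    (nsq mu (fun x => (f x - u x)%R) < eps%:E)%E &
    (nsq mu (fun xi => (g xi - fourier u xi)%R) < eps%:E)%E]].

Lemma fourier_pair_n2 f g : fourier_pair f g -> n2 mu f = n2 mu g.
Proof.
move=> [Lf Lg H]; apply: n2_eq_lim => // eps /H[u [iu Lu fu gu]].
exists u, (fourier u); split=> //; first exact: L2_fourier.
by rewrite plancherel.
Qed.

Lemma fourier_pair_self u : cintegrable mu u -> L2 mu u -> fourier_pair u (fourier u).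
Proof.
move=> iu Lu; split=> //; first exact: L2_fourier.
move=> eps e0; exists u; split=> //;
  by under eq_fun do rewrite subrr; rewrite nsq0 lte_fin.
Qed.

Lemma fourier_pairD f g f' g' : fourier_pair f g -> fourier_pair f' g' ->
  fourier_pair (fun x => f x + f' x) (fun x => g x + g' x).
Proof.
move=> [Lf Lg H] [Lf' Lg' H']; split; [exact: L2D|exact: L2D|move=> eps e0].
have e4 : 0 < eps / 4 by rewrite divr_gt0.
have [u [iu Lu fu gu]] := H _ e4; have [u' [iu' Lu' fu' gu']] := H' _ e4.
exists (fun x => u x + u' x); split; [exact: cintegrableD|exact: L2D| |].
  rewrite (_ : (fun x => _) = (fun x => (f x - u x) + (f' x - u' x))); last first.
    by apply/funext => x; rewrite opprD addrACA.
  have -> : eps = 2 * (eps / 4) + 2 * (eps / 4) by field.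
  by apply: nsqD_lt => //; [case: (L2B Lf Lu)|case: (L2B Lf' Lu')].
rewrite (@eq_nsq _ _ _ mu _ (fun x => (g x - fourier u x) + (g' x - fourier u' x)));
  last first.
  by move=> x; rewrite (fourierD _ iu iu') opprD addrACA.
have -> : eps = 2 * (eps / 4) + 2 * (eps / 4) by field.
by apply: nsqD_lt => //;
  [case: (L2B Lg (L2_fourier iu Lu))|case: (L2B Lg' (L2_fourier iu' Lu'))].
Qed.

(* Both the scaling and the translation of a pair are multiplications by a
   bounded factor on the Fourier side. *)
Let fourier_pair_map f g (F : (T -> R[i]) -> T -> R[i]) (m : T -> R[i]) (C : R) :
  0 < C -> cmeasurable m -> (forall x, sqn (m x) <= C) ->
  (forall u, L2 mu u -> L2 mu (F u)) ->
  (forall u v, (fun x => F u x - F v x) = F (fun x => u x - v x)) ->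
  (forall u, L2 mu u -> (nsq mu (F u) <= C%:E * nsq mu u)%E) ->
  (forall u, cintegrable mu u -> cintegrable mu (F u)) ->
  (forall u, cintegrable mu u -> fourier (F u) = (fun xi => m xi * fourier u xi)) ->
  fourier_pair f g -> fourier_pair (F f) (fun xi => m xi * g xi).
Proof.
move=> C0 mm mC LF FB FC iF FE [Lf Lg H].
split; [exact: LF|exact: (L2M_bounded mm mC Lg)|move=> eps e0].
have eC : 0 < eps / C by rewrite divr_gt0.
have [u [iu Lu fu gu]] := H _ eC.
have small v : L2 mu v -> (nsq mu v < (eps / C)%:E)%E ->
    (C%:E * nsq mu v < eps%:E)%E.
  by move=> Lv; rewrite nsqE// -EFinM !lte_fin ltr_pdivlMr// mulrC.
exists (F u); split; [exact: iF|exact: LF| |].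
  rewrite FB; apply: (le_lt_trans (FC _ (L2B Lf Lu))).
  by apply: small => //; exact: L2B.
have Lgu := L2B Lg (L2_fourier iu Lu).
rewrite (@eq_nsq _ _ _ mu _ (fun xi => m xi * (g xi - fourier u xi))); last first.
  by move=> xi; rewrite FE// mulrBr.
apply: (le_lt_trans (nsqM_bounded_le _ (ltW C0) mm (proj1 Lgu) mC)).
exact: small.
Qed.

Lemma fourier_pairZ c f g : fourier_pair f g ->
  fourier_pair (fun x => c * f x) (fun x => c * g x).
Proof.
have c1 : 0 < sqn c + 1 by rewrite ltr_wpDl ?sqn_ge0.
apply: (@fourier_pair_map f g (fun u x => c * u x) (fun=> c) (sqn c + 1)) => //.
- by move=> _; rewrite lerDl.
- by move=> u; exact: L2Z.
- by move=> u v; apply/funext => x; rewrite mulrBr.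
- move=> u Lu; rewrite nsqZ; last by case: Lu.
  by rewrite lee_wpmul2r ?nsq_ge0// lee_fin lerDl.
- by move=> u; exact: cintegrableZ.
- by move=> u iu; apply/funext => xi; exact: fourierZ.
Qed.

Lemma cintegrable_shift u c : cintegrable mu u -> cintegrable mu (fun x => u (x + c)).
Proof.
move=> iu; have mu_ := cintegrable_cmeasurable iu.
apply: (@cintegrable_le _ _ _ mu _ (fun x => normc (u (x + c)))) => //.
  exact: cmeasurable_shift.
have /integrableP[m1 f1] := cintegrable_normc iu.
have m2 := cmeasurable_normc (cmeasurable_shift c mu_).
apply/integrableP; split; first exact/measurable_EFinP.
apply: le_lt_trans f1; rewrite -(@ge0_integral_shift R c (fun x => `|(normc (u x))%:E|%E))//.
by apply: measurableT_comp.
Qed.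

Lemma fourier_pair_shift c f g : fourier_pair f g ->
  fourier_pair (fun x => f (x + c)) (fun xi => cis (2 * pi * c * xi) * g xi).
Proof.
apply: (@fourier_pair_map f g (fun u x => u (x + c))
  (fun xi => cis (2 * pi * c * xi)) 1) => //.
- exact: cmeasurable_cis_lin.
- by move=> x; rewrite sqn_cis.
- by move=> u; exact: L2_shift.
- by move=> u [mu_ _]; rewrite nsq_shift// mul1e.
- by move=> u; exact: cintegrable_shift.
- by move=> u iu; apply/funext => xi; exact: fourier_shift.
Qed.

Lemma is_fourier_L2_pair f g : is_fourier_L2 f g -> fourier_pair f g.
Proof.
move=> [/in_Lp2 Lf /in_Lp2 Lg [u [u1 u2 uf ug]]]; split=> // eps e0.
have s0 : 0 < Num.sqrt eps by rewrite sqrtr_gt0.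
have ev (F : nat -> T -> R[i]) : cLnorm mu 2%:E (F m) @[m --> \oo] --> 0%E ->
    \forall m \near \oo, (nsq mu (F m) < eps%:E)%E.
  move=> /fine_cvgP[[M _ fM] /cvgrPdist_lt/(_ _ s0)[N _ HN]].
  exists (maxn M N) => // m /=; rewrite geq_max => /andP[Mm Nm].
  rewrite -[eps]sqr_sqrtr ?ltW//; apply: nsq_lt => //.
  have := HN m Nm; rewrite /= sub0r normrN ger0_norm ?fine_ge0 ?Lnorm_ge0// => h.
  by rewrite -(fineK (fM m Mm)) lte_fin.
have [M _ HM] := ev _ uf; have [N _ HN] := ev _ ug.
have m1 := HM (maxn M N) (leq_maxl _ _); have m2 := HN (maxn M N) (leq_maxr _ _).
exists (u (maxn M N)); split.
- have [mu_ nu] := u1 (maxn M N).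
  apply: (@cintegrable_le _ _ _ mu _ (fun x => normc (u (maxn M N) x))) => //.
  apply/integrableP; split; first exact/measurable_EFinP/cmeasurable_normc.
  by move: nu; rewrite /cLnorm Lnorm1.
- exact/in_Lp2.
- by rewrite -nsqN; under eq_fun do rewrite opprB.
- by rewrite -nsqN; under eq_fun do rewrite opprB.
Qed.

(* Polarization: compare the norms of [f + f'] and of [f + i f']. *)
Lemma fourier_pair_ip f g f' g' : fourier_pair f g -> fourier_pair f' g' ->
  L2_inner mu f f' = L2_inner mu g g'.
Proof.
move=> p p'; have [Lf Lg _] := p; have [Lf' Lg' _] := p'.
have re (h k h' k' : T -> R[i]) : fourier_pair h k -> fourier_pair h' k' ->
    complex.Re (L2_inner mu h h') = complex.Re (L2_inner mu k k').
  move=> q q'; have [Lh Lk _] := q; have [Lh' Lk' _] := q'.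
  have := fourier_pair_n2 (fourier_pairD q q').
  rewrite !n2D// (fourier_pair_n2 q) (fourier_pair_n2 q') => /addrI.
  by apply: mulfI.
apply: complexP; first exact: re.
have := re _ _ _ _ p (fourier_pairZ 'i%C p').
by rewrite !ipZr// !ReImE/= !mul0r !sub0r !mulN1r !opprK.
Qed.

End plancherel_L1_L2.

(** * The Wilson system *)

Section bounded_compact_support.
Variable R : realType.
Local Notation mu := (@lebesgue_measure R).
Local Notation T := (measurableTypeR R).
Implicit Types F G : T -> R[i].

(** Bounded functions with bounded support: a class contained in L^1 and L^2, where sums, products
    and translations raise no integrability question. One constant bounds both the values and the
    support. *)
Definition bcs F := cmeasurable F /\
  exists2 M : R, forall x, sqn (F x) <= M & forall x, M <= `|x| -> F x = 0.

Lemma bcs_L2_cintegrable F : bcs F -> L2 mu F /\ cintegrable mu F.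
Proof.
move=> [mF [M FM F0]]; have M1 : 0 < `|M| + 1 by rewrite ltr_wpDl.
pose I : set T := `[- (`|M| + 1), - (`|M| + 1) + 2 * (`|M| + 1)[%classic.
have FE x : F x = F x * cind I x.
  have [xM|xM] := leP M `|x|; first by rewrite F0// mul0r.
  rewrite cindT ?mulr1//= /I/= in_itv/=.
  have := lt_le_trans xM (ler_norm M); rewrite ltr_norml => /andP[x1 x2].
  by apply/andP; split; lra.
have LI : L2 mu (cind I) by apply: L2_indI; rewrite mulr_gt0.
have LF : L2 mu F.
  by have := L2M_bounded mF FM LI; congr (L2 mu _); apply/funext => x; rewrite -FE.
split=> //; have := L2_cintegrable LF LI; congr cintegrable.
apply/funext => x; rewrite [RHS]FE; congr (_ * _).
by apply: complexP; rewrite !ReImE/= ?oppr0.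
Qed.

Lemma bcs_L2 F : bcs F -> L2 mu F. Proof. by move=> /bcs_L2_cintegrable[]. Qed.

Lemma bcs_cintegrable F : bcs F -> cintegrable mu F.
Proof. by move=> /bcs_L2_cintegrable[]. Qed.

Lemma bcsD F G : bcs F -> bcs G -> bcs (fun x => F x + G x).
Proof.
move=> [mF [M FM F0]] [mG [N GN G0]]; split; first exact: cmeasurableD.
have M0 := le_trans (sqn_ge0 _) (FM 0); have N0 := le_trans (sqn_ge0 _) (GN 0).
exists (2 * M + 2 * N) => [x|x xMN].
  rewrite (le_trans (sqnD_le _ _))//.
  by have := FM x; have := GN x; lra.
by rewrite F0 ?G0 ?addr0//; lra.
Qed.

Lemma bcsM F G (C : R) : cmeasurable G -> (forall x, sqn (G x) <= C) -> bcs F ->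
  bcs (fun x => G x * F x).
Proof.
move=> mG GC [mF [M FM F0]]; split; first exact: cmeasurableM.
have M0 := le_trans (sqn_ge0 _) (FM 0); have C0 := le_trans (sqn_ge0 _) (GC 0).
(* At least C M, to bound the values, and at least M, to contain the support. *)
exists ((C + 1) * M) => [x|x xMN].
  rewrite sqnM ler_pM ?sqn_ge0//.
  by have := GC x; lra.
rewrite F0 ?mulr0// (le_trans _ xMN)// mulrDl mul1r lerDr mulr_ge0//.
Qed.

Lemma bcsN F : bcs F -> bcs (fun x => - F x).
Proof.
move=> bF; have := bcsM (cmeasurable_cst _ (-1)) (C := 1) _ bF.
under eq_fun do rewrite mulN1r; apply => x.
by rewrite sqnN sqn1.
Qed.

Lemma bcs_shift F c : bcs F -> bcs (fun x => F (x + c)).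
Proof.
move=> [mF [M FM F0]]; split; first exact: cmeasurable_shift.
have M0 := le_trans (sqn_ge0 _) (FM 0).
exists (M + `|c|) => [x|x xM]; first by rewrite (le_trans (FM _))// lerDl.
apply: F0; have := ler_normB (x + c) c; rewrite addrK => h.
by lra.
Qed.

Lemma bcs_cind a b : bcs (cind (`[a, b[%classic : set T)).
Proof.
split; first by apply: cmeasurable_cind; exact: measurable_itv.
exists (1 + `|a| + `|b|) => [x|x xab].
  have : 0 <= `|a| + `|b| by rewrite addr_ge0.
  rewrite -addrA sqn_cind indicE => ab0; case: (_ \in _); last by rewrite addr_ge0.
  by rewrite lerDl.
rewrite cindF//= in_itv/= => /andP[ax xb]; move: xab; rewrite leNgt => /negP; apply.
rewrite ltr_norml; have := ler_norm b; have := ler_norm (- a); rewrite normrN.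
by have := normr_ge0 a; have := normr_ge0 b; move=> *; apply/andP; split; lra.
Qed.

(** A Fourier coefficient of the 1-periodization of F, which is why integer translations do not
    change it. *)
Definition fcoef (m : int) F : R[i] := cintegral mu (fun x => cis (2 * pi * m%:~R * x) * F x).

Lemma bcs_cis_mul m F : bcs F -> bcs (fun x => cis (2 * pi * m%:~R * x) * F x).
Proof.
by apply: (@bcsM F _ 1) => [|x]; [exact: cmeasurable_cis_lin|rewrite sqn_cis].
Qed.

Lemma fcoefD m F G : bcs F -> bcs G ->
  fcoef m (fun x => F x + G x) = fcoef m F + fcoef m G.
Proof.
move=> bF bG; rewrite /fcoef -cintegralD.
- by apply: eq_cintegral => x; rewrite mulrDr.
- exact/bcs_cintegrable/bcs_cis_mul.
- exact/bcs_cintegrable/bcs_cis_mul.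
Qed.

Lemma fcoefN m F : bcs F -> fcoef m (fun x => - F x) = - fcoef m F.
Proof.
move=> bF; rewrite /fcoef -mulN1r -cintegralZ; last exact/bcs_cintegrable/bcs_cis_mul.
by apply: eq_cintegral => x; rewrite mulN1r mulrN.
Qed.

Lemma fcoefB m F G : bcs F -> bcs G ->
  fcoef m (fun x => F x - G x) = fcoef m F - fcoef m G.
Proof. by move=> bF bG; rewrite fcoefD ?fcoefN//; exact: bcsN. Qed.

Lemma fcoef_shift m (l : int) F : bcs F -> fcoef m (fun x => F (x + l%:~R)) = fcoef m F.
Proof.
move=> bF; rewrite /fcoef -[RHS](@cintegral_shift R l%:~R); last first.
  by case: (bcs_cis_mul m bF).
apply: eq_cintegral => x; congr (_ * _).
rewrite (_ : 2 * pi * m%:~R * (x + l%:~R) = 2 * pi * m%:~R * x + 2 * pi * (m * l)%:~R).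
  by rewrite cisD cis_2pi_int mulr1.
by rewrite intrM; ring.
Qed.

Lemma fcoef_cind m (a : R) :
  fcoef m (cind (`[a, a + 1[%classic : set T)) = (m == 0)%:R.
Proof.
have := cintegral_cis a m (@ltr01 R); rewrite divr1 /fcoef => ->.
by case: eqP.
Qed.

End bounded_compact_support.

(** * Orthonormality of the Wilson modes and their partition of unity *)

Section wilson.
Variables (R : realType) (phi : R -> R[i]).
Local Notation mu := (@lebesgue_measure R).
Local Notation T := (measurableTypeR R).
Local Notation g := (wilson_hat phi).

Lemma sqn_conj_parity j (z : R[i]) : sqn (conj_parity j z) = sqn z.
Proof. by rewrite /conj_parity; case: ifP => // _; rewrite sqn_conjc. Qed.

Lemma conj_parity0 j : conj_parity j (0 : R[i]) = 0.
Proof. by rewrite /conj_parity conjc0 if_same. Qed.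

Lemma conj_parityM j (z w : R[i]) :
  conj_parity j (z * w) = conj_parity j z * conj_parity j w.
Proof. by rewrite /conj_parity; case: ifP => // _; rewrite conjcM. Qed.

Lemma conj_parityS j (z : R[i]) : (conj_parity j.+1 z)^* = conj_parity j z.
Proof. by rewrite /conj_parity /=; case: (odd j) => //=; rewrite conjcK. Qed.

Lemma cmeasurable_conj_parity d (T0 : measurableType d) j (f : T0 -> R[i]) :
  cmeasurable f -> cmeasurable (fun x => conj_parity j (f x)).
Proof. by move=> mf; rewrite /conj_parity; case: (odd j) => //; exact: cmeasurableJ. Qed.

Lemma sqn_sign (j : nat) (z : R[i]) : sqn ((- 1) ^+ j * z) = sqn z.
Proof. by rewrite -signr_odd mulr_sign; case: ifP => // _; rewrite sqnN. Qed.

Hypothesis mphi : cmeasurable (phi : T -> R[i]).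
Hypothesis phi0 : forall x : R, 1 / 2 <= `|x| -> phi x = 0.
Hypothesis phi1 : forall x : R, - (1 / 2) <= x <= 0 ->
  sqn (phi x) + sqn (phi (x + 1 / 2)) = 1.

Let phiL x : x <= - (1 / 2) -> phi x = 0.
Proof. by move=> x1; apply: phi0; rewrite ler0_norm; lra. Qed.

Let phiR x : 1 / 2 <= x -> phi x = 0.
Proof. by move=> x1; apply: phi0; rewrite ger0_norm; lra. Qed.

Let sqn_phi_le1 x : sqn (phi x) <= 1.
Proof.
have [x1|x1] := leP x (- (1 / 2)); first by rewrite phiL// sqn0.
have [x2|x2] := leP x 0.
  have x12 : - (1 / 2) <= x <= 0 by rewrite ltW.
  by rewrite -(phi1 x12) lerDl sqn_ge0.
have [x3|x3] := leP (1 / 2) x; first by rewrite phiR// sqn0.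
have x12 : - (1 / 2) <= x - 1 / 2 <= 0 by lra.
by rewrite -(phi1 x12) subrK lerDr sqn_ge0.
Qed.

Let sqn_phi_0 : sqn (phi 0) = 1.
Proof.
have h : - (1 / 2) <= (0 : R) <= 0 by lra.
by rewrite -(phi1 h) add0r (phiR (lexx _)) sqn0 addr0.
Qed.

(** For j > 0 the two bumps of [g j] are centred at [c j] and [- c j]; for j = 0 these are the
    points where the constant part of [g 0] ends. *)
Let c (j : nat) : R := j%:R / 2 + 1 / 4.

Let gE j xi : (0 < j)%N -> g j xi =
  conj_parity j (phi (xi - c j)) + (- 1) ^+ j * conj_parity j (phi (xi + c j)).
Proof. by case: j => // j _; rewrite /wilson_hat/= /c opprD !addrA. Qed.

Let g0E xi : g 0 xi = if xi > 1 / 4 then phi (xi - 1 / 4) else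
  if xi < - (1 / 4) then phi (xi + 1 / 4) else phi 0.
Proof. by []. Qed.

Let c_gt j : (0 < j)%N -> 3 / 4 <= c j.
Proof.
move=> j0; have : 1 <= j%:R :> R by rewrite ler1n.
by move=> h; rewrite /c; lra.
Qed.

(** The centres are at distance at least 3/4 from 0 and the bumps have radius 1/2: the two bumps lie
    on opposite half-lines, so squared moduli have no cross term. *)
Let phi_shift0 j xi : (0 < j)%N -> phi (xi - c j) = 0 \/ phi (xi + c j) = 0.
Proof.
move=> /c_gt cj; have [x0|x0] := leP xi 0.
  by left; apply: phiL; lra.
by right; apply: phiR; lra.
Qed.

Let sqn_g j xi : (0 < j)%N ->
  sqn (g j xi) = sqn (phi (xi - c j)) + sqn (phi (xi + c j)).
Proof.
move=> j0; rewrite gE//; have [->|->] := phi_shift0 xi j0.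
  by rewrite conj_parity0 add0r sqn0 add0r sqn_sign sqn_conj_parity.
by rewrite conj_parity0 mulr0 addr0 sqn0 addr0 sqn_conj_parity.
Qed.

Let g_large j xi : c j + 1 / 2 <= `|xi| -> g j xi = 0.
Proof.
case: j => [|j]; rewrite ler_normr => /orP[] h.
- rewrite g0E /c in h *; rewrite ifT; last by lra.
  by apply: phiR; lra.
- rewrite g0E /c in h *; rewrite ifF; last by apply/negbTE; rewrite -leNgt; lra.
  by rewrite ifT; [apply: phiL; lra|lra].
- have := c_gt (ltn0Sn j); rewrite gE// => cj.
  by rewrite !phiR ?conj_parity0 ?mulr0 ?addr0//; lra.
- have := c_gt (ltn0Sn j); rewrite gE// => cj.
  by rewrite !phiL ?conj_parity0 ?mulr0 ?addr0//; lra.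
Qed.

Let g_small j xi : (0 < j)%N -> `|xi| <= c j - 1 / 2 -> g j xi = 0.
Proof.
move=> j0; rewrite ler_norml gE// => /andP[h1 h2].
by rewrite phiL ?phiR ?conj_parity0 ?mulr0 ?addr0//; lra.
Qed.

Let sqn_g_le1 j xi : sqn (g j xi) <= 1.
Proof.
case: j => [|j]; first by rewrite g0E; do 2 case: ifP => // _.
rewrite sqn_g//; have [->|->] := phi_shift0 xi (ltn0Sn j).
  by rewrite sqn0 add0r.
by rewrite sqn0 addr0.
Qed.

Let mphi_shift (s : R) : cmeasurable (fun x : T => phi (x + s)).
Proof. exact: (cmeasurable_shift s mphi). Qed.

Lemma cmeasurable_wilson_hat j : cmeasurable (g j : T -> R[i]).
Proof.
case: j => [|j].
  pose A : set T := `]1 / 4, +oo[%classic; pose B : set T := `]-oo, - (1 / 4)[%classic.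
  rewrite (_ : g 0 = fun xi : T => cind A xi * phi (xi + - (1 / 4)) +
    (cind B xi * phi (xi + 1 / 4) + cind (~` (A `|` B)) xi * phi 0)).
    have mA : measurable A by exact: measurable_itv.
    have mB : measurable B by exact: measurable_itv.
    have mC : measurable (~` (A `|` B)) by apply: measurableC; exact: measurableU.
    apply: cmeasurableD; first by apply: cmeasurableM => //; exact: cmeasurable_cind.
    apply: cmeasurableD; first by apply: cmeasurableM => //; exact: cmeasurable_cind.
    by apply: cmeasurableM; [exact: cmeasurable_cind|exact: cmeasurable_cst].
  apply/funext => xi; rewrite g0E.
  have AE : A xi = (1 / 4 < xi) by rewrite /A/= in_itv/= andbT.
  have BE : B xi = (xi < - (1 / 4)) by rewrite /B/= in_itv/=.
  case: ifPn => h1.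
    rewrite (@cindT _ _ _ A) ?AE// (@cindF _ _ _ B); last first.
      by rewrite BE; apply/negP; rewrite -leNgt; lra.
    by rewrite cindF ?mul1r ?mul0r ?addr0// => -[]; left; rewrite AE.
  rewrite (@cindF _ _ _ A) ?AE//; last exact/negP.
  case: ifPn => h2.
    rewrite (@cindT _ _ _ B) ?BE// cindF ?mul1r ?mul0r ?addr0 ?add0r// => -[].
    by right; rewrite BE.
  rewrite (@cindF _ _ _ B) ?BE//; last exact/negP.
  by rewrite cindT ?mul0r ?add0r ?mul1r// => -[]; rewrite ?AE ?BE; exact/negP.
rewrite (_ : g j.+1 = fun xi : T => conj_parity j.+1 (phi (xi + - c j.+1)) +
    (- 1) ^+ j.+1 * conj_parity j.+1 (phi (xi + c j.+1))).
  apply: cmeasurableD; first exact: cmeasurable_conj_parity.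
  by apply: cmeasurableZ; exact: cmeasurable_conj_parity.
by apply/funext => xi; rewrite gE.
Qed.

Lemma bcs_wilson_hat j : bcs (g j : T -> R[i]).
Proof.
split; first exact: cmeasurable_wilson_hat.
exists (c j + 1) => [x|x xc].
  by rewrite (le_trans (sqn_g_le1 _ _))// lerDr /c addr_ge0// divr_ge0.
by apply: g_large; rewrite (le_trans _ xc)//; lra.
Qed.

(* The positive half of [A = |phi|^2]; since [A x + A (x + 1/2) = 1] on
   [-1/2, 0], [A] is a box plus a difference of translates of [Ap], and such
   differences are invisible to [fcoef] when the translation is an integer. *)
Let A (x : T) : R[i] := (sqn (phi x))%:C.
Let Ap (x : T) : R[i] := A x * cind (`[0%R, 1[%classic : set T) x.

Let bcs_A : bcs A.
Proof.
split; first by split; [exact: (measurable_sqn mphi)|exact: measurable_cst].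
exists 1 => [x|x x1].
  by rewrite sqn_real expr_le1// ?sqn_ge0.
by rewrite /A phi0 ?sqn0//; lra.
Qed.

Let bcs_Ap : bcs Ap.
Proof.
rewrite (_ : Ap = fun x => cind (`[0%R, 1[%classic : set T) x * A x); last first.
  by apply/funext => x; rewrite mulrC.
apply: (@bcsM _ _ _ 1) => [|x|//]; first by apply: cmeasurable_cind; exact: measurable_itv.
by rewrite sqn_cind indicE; case: (_ \in _); rewrite ?ler01.
Qed.

Let Ap_ge0 x : 0 <= x -> Ap x = A x.
Proof.
move=> x0; rewrite /Ap; have [x1|x1] := leP 1 x.
  by rewrite /A phi0 ?sqn0 ?mul0r// ger0_norm; lra.
by rewrite cindT ?mulr1//= in_itv/= x0.
Qed.

Let Ap_lt0 x : x < 0 -> Ap x = 0.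
Proof.
by move=> x0; rewrite /Ap cindF ?mulr0//= in_itv/= leNgt x0.
Qed.

Let Ap_ge_half x : 1 / 2 <= x -> Ap x = 0.
Proof. by move=> x0; rewrite Ap_ge0; [rewrite /A phiR ?sqn0|lra]. Qed.

Let box (a b : R) : T -> R[i] := cind (`[a, b[%classic : set T).

Let boxT a b x : a <= x < b -> box a b x = 1.
Proof. by move=> h; rewrite /box cindT//= in_itv. Qed.

Let boxF a b x : ~~ (a <= x < b) -> box a b x = 0.
Proof. by move=> h; rewrite /box cindF//= in_itv/=; exact/negP. Qed.

Let AE x : A x = Ap x - Ap (x + 1 / 2) + box (- (1 / 2)) 0 x.
Proof.
have [x0|x0] := leP 0 x.
  rewrite Ap_ge0// Ap_ge_half; last by lra.
  by rewrite boxF ?subr0 ?addr0// negb_and -leNgt x0 orbT.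
rewrite Ap_lt0// sub0r; have [x1|x1] := leP (- (1 / 2)) x.
  rewrite boxT ?x1// Ap_ge0; last by lra.
  have h : - (1 / 2) <= x <= 0 by rewrite x1 ltW.
  rewrite /A; have -> : sqn (phi (x + 1 / 2)) = 1 - sqn (phi x) by have := phi1 h; lra.
  by apply: complexP; rewrite !ReImE/=; ring.
rewrite boxF; last by rewrite negb_and -ltNge x1.
rewrite Ap_lt0; last by lra.
by rewrite oppr0 addr0 /A phiL ?sqn0 ?ltW.
Qed.

Let fcoef_box2 m (a b : R) : a <= b <= a + 1 ->
  fcoef m (box a b) + fcoef m (box b (a + 1)) = (m == 0)%:R.
Proof.
move=> /andP[ab ba]; rewrite -fcoefD; [|exact: bcs_cind..].
rewrite -(fcoef_cind m a); congr fcoef; apply/funext => x.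
rewrite -/(box a (a + 1)).
have [x1|x1] := ltP x a.
  by rewrite !boxF ?addr0// negb_and -!ltNge ?x1// (lt_le_trans x1 ab).
have [x2|x2] := ltP x b.
  rewrite (@boxT a b) ?x1// (@boxT a (a + 1)) ?x1 ?(lt_le_trans x2)//.
  by rewrite boxF ?addr0// negb_and -ltNge x2.
rewrite (@boxF a b) ?add0r; last by rewrite negb_and -leNgt x2 orbT.
have [x3|x3] := ltP x (a + 1); first by rewrite !boxT ?x1 ?x2 ?x3.
by rewrite !boxF// negb_and -!leNgt x3 orbT.
Qed.

Let fcoef_telescope m (l : int) (F : T -> R[i]) : bcs F ->
  fcoef m (fun x => F x - F (x + l%:~R)) = 0.
Proof. by move=> bF; rewrite fcoefB ?fcoef_shift ?subrr//; exact: bcs_shift. Qed.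

Let bcs_telescope (l : int) (F : T -> R[i]) : bcs F -> bcs (fun x => F x - F (x + l%:~R)).
Proof. by move=> bF; apply: bcsD => //; apply: bcsN; exact: bcs_shift. Qed.

Let bcs_box a b : bcs (box a b). Proof. exact: bcs_cind. Qed.

(** For an index J > 0 with centre d, apply [AE] to both bumps. Each yields a difference of [Ap] at
    distance 1/2, which is not an integer, but 2 d = J + 1/2: exchanging terms between the bumps
    gives differences at distances J + 1 and J. The two boxes, one moved by J + 1, tile [d - 1/2, d
    + 1/2). For J = 0 the constant part supplies one of the boxes. *)
Lemma fcoef_wilson_diag m j :
  fcoef m (fun xi => g j xi * (g j xi)^*) = (m == 0)%:R.
Proof.
under eq_fun do rewrite sqn_mulJ.
have bP d : bcs (fun x => Ap (x + d)) by exact: bcs_shift.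
case: j => [|j].
  rewrite (_ : (fun x => _) = (fun x => (Ap (x + - (1 / 4)) - Ap (x + 1 + - (1 / 4)))
      + (box (- (1 / 4)) (1 / 4) x + box (1 / 4) (- (1 / 4) + 1) (x + 1)))).
    rewrite fcoefD; [|exact: (bcs_telescope 1 (bP _))|apply: bcsD => //; exact: bcs_shift].
    rewrite (fcoef_telescope _ 1 (bP _)) add0r fcoefD//; last exact: bcs_shift.
    rewrite (fcoef_shift _ 1)// fcoef_box2//.
    by apply/andP; split; lra.
  apply/funext => x; rewrite g0E.
  have [x1|x1] := ltP (1 / 4) x.
    rewrite Ap_ge0; last by lra.
    rewrite Ap_ge_half; last by lra.
    rewrite (@boxF (- (1 / 4))); last by rewrite negb_and -!leNgt; apply/orP; right; lra.
    rewrite boxF; last by rewrite negb_and -!leNgt; apply/orP; right; lra.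
    by rewrite subr0 !addr0.
  have [x2|x2] := ltP x (- (1 / 4)).
    rewrite Ap_lt0; last by lra.
    rewrite -/(A _) AE Ap_lt0; last by lra.
    rewrite (@boxF (- (1 / 4))); last by rewrite negb_and -ltNge; apply/orP; left; lra.
    rewrite add0r (_ : x + 1 / 4 + 1 / 2 = x + 1 + - (1 / 4)); last by field.
    have [x3|x3] := leP (- (3 / 4)) x.
      by rewrite !boxT ?add0r//; apply/andP; split; lra.
    rewrite (@boxF (- (1 / 2))); last by rewrite negb_and -ltNge; apply/orP; left; lra.
    rewrite boxF; last by rewrite negb_and -ltNge; apply/orP; left; lra.
    by rewrite !add0r.
  rewrite sqn_phi_0 (@Ap_ge_half (x + 1 + - (1 / 4))); last by lra.
  rewrite (@boxF (1 / 4)); last by rewrite negb_and -leNgt; apply/orP; right; lra.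
  rewrite subr0 addr0; have [x3|x3] := ltP x (1 / 4).
    rewrite Ap_lt0; last by lra.
    by rewrite boxT ?add0r// x2.
  rewrite boxF; last by rewrite negb_and -leNgt x3 orbT.
  (* The half-open box leaves out this point, where [Ap 0] = 1 takes its place. *)
  have -> : x = 1 / 4 by apply/le_anti/andP.
  by rewrite subrr addr0 Ap_ge0// /A sqn_phi_0.
set d := c j.+1.
have dE : d + d = j.+1%:R + 1 / 2 by rewrite /d /c; field.
have jS : j.+2%:R = j.+1%:R + 1 :> R by rewrite -[in LHS]addn1 natrD.
rewrite (_ : (fun x => _) = (fun x => (Ap (x + - d) - Ap (x + j.+2%:R + - d))
    + (- (Ap (x + (1 / 2 - d)) - Ap (x + j.+1%:R + (1 / 2 - d)))
    + (box (d - 1 / 2) d x + box d (d - 1 / 2 + 1) (x + j.+2%:R))))).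
  have bt := bcs_telescope (Posz j.+2) (bP (- d)).
  have bt' := bcs_telescope (Posz j.+1) (bP (1 / 2 - d)).
  have bb := bcs_shift j.+2%:R (bcs_box d (d - 1 / 2 + 1)).
  have bn := bcsN bt'; have bx := bcs_box (d - 1 / 2) d.
  rewrite (fcoefD _ bt (bcsD bn (bcsD bx bb))) (fcoefD _ bn (bcsD bx bb)).
  rewrite (fcoefD _ bx bb) fcoefN// (fcoef_telescope _ (Posz j.+2) (bP _)).
  rewrite (fcoef_telescope _ (Posz j.+1) (bP _)) oppr0 !add0r.
  rewrite (fcoef_shift _ (Posz j.+2))// fcoef_box2//.
  by apply/andP; split; lra.
apply/funext => x; rewrite sqn_g// -/d.
rewrite (_ : (sqn (phi (x - d)) + sqn (phi (x + d)))%:C = A (x - d) + A (x + d)); last first.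
  by apply: complexP; rewrite !ReImE/= ?addr0.
have box_sh a b y s : box a b y = box (a + s) (b + s) (y + s).
  have [h|h] := boolP (a <= y < b); first by rewrite !boxT// lerD2r ltrD2r.
  by rewrite !boxF// lerD2r ltrD2r.
rewrite !AE (box_sh _ _ (x - d) d) subrK add0r.
rewrite (box_sh _ _ (x + d) (d + 1 / 2)).
rewrite (_ : x + d + (d + 1 / 2) = x + j.+2%:R); last by rewrite jS; lra.
rewrite (_ : x + d = x + j.+1%:R + (1 / 2 - d)); last by lra.
rewrite (_ : x + j.+1%:R + (1 / 2 - d) + 1 / 2 = x + j.+2%:R - d); last by rewrite jS; lra.
rewrite (_ : x - d + 1 / 2 = x + (1 / 2 - d)); last by lra.
rewrite (_ : - (1 / 2) + d = d - 1 / 2); last by lra.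
rewrite (_ : - (1 / 2) + (d + 1 / 2) = d); last by lra.
rewrite (_ : 0 + (d + 1 / 2) = d - 1 / 2 + 1); last by lra.
ring.
Qed.

Let bcs_phi : bcs phi.
Proof.
split=> //; exists 1 => [x|x x1]; first exact: sqn_phi_le1.
by apply: phi0; lra.
Qed.

(** [F] is the overlap on the positive side. Moving it by j + 1 = c j + c (j + 1) exchanges its two
    factors and gives the overlap on the negative side; the signs of the two indices multiply to
    -1. *)
Let fcoef_wilson_succ m j : fcoef m (fun xi => g j xi * (g j.+1 xi)^*) = 0.
Proof.
pose F (x : T) : R[i] := conj_parity j (phi (x + - c j) * phi (x + (- c j - 1 / 2))).
have bF : bcs F.
  have [mF [M FM F0]] : bcs (fun x : T => phi (x + - c j) * phi (x + (- c j - 1 / 2))).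
    apply: (@bcsM _ _ _ 1) => //; exact: bcs_shift.
  split; first exact: cmeasurable_conj_parity.
  exists M => x; rewrite /F; first by rewrite sqn_conj_parity; exact: FM.
  by move=> /F0 ->; rewrite conj_parity0.
rewrite -(fcoef_telescope m (Posz j.+1) bF); congr fcoef; apply/funext => x.
have cS : c j.+1 = c j + 1 / 2 by rewrite /c -addn1 natrD; field.
have cE : j.+1%:R = c j + c j + 1 / 2 by rewrite /c -addn1 natrD; field.
have E1 : x + j.+1%:R + - c j = x + c j.+1 by rewrite cE cS; lra.
have E2 : x + j.+1%:R + (- c j - 1 / 2) = x + c j by rewrite cE; lra.
have E3 : x + (- c j - 1 / 2) = x - c j.+1 by rewrite cS; lra.
rewrite (gE _ (ltn0Sn j)) conjcD conjcM !conj_parityS.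
have -> : (((- 1) ^+ j.+1 : R[i])^* = - (- 1) ^+ j).
  rewrite exprS mulN1r -signr_odd; case: (odd j); apply: complexP;
    by rewrite !ReImE/= ?oppr0 ?opprK.
rewrite /F E1 E2 E3 !conj_parityM; clear F bF.
(* [g 0] is not a sum of two bumps; where it is constant, both bumps of [g 1] vanish. *)
case: j E1 E2 E3 cS cE => [|j] E1 E2 E3 cS cE.
  have c0 : c 0 = 1 / 4 by rewrite /c mul0r add0r.
  rewrite cS c0 expr0 mulN1r g0E /conj_parity/=.
  have [x1|x1] := ltP (1 / 4) x.
    rewrite (@phiR (x + (1 / 4 + 1 / 2))); last by lra.
    by rewrite mul0r !subr0.
  have [x2|x2] := ltP x (- (1 / 4)).
    rewrite (@phiL (x - (1 / 4 + 1 / 2))); last by lra.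
    by rewrite mulr0 !sub0r mulrN mulrC.
  rewrite (@phiR (x + (1 / 4 + 1 / 2))); last by lra.
  rewrite (@phiL (x - (1 / 4 + 1 / 2))); last by lra.
  by rewrite subrr !mulr0 mul0r subrr.
have cj := c_gt (ltn0Sn j).
have s2 : (- 1) ^+ j.+1 * (- 1) ^+ j.+1 = 1 :> R[i] by rewrite -expr2 sqrr_sign.
rewrite gE// mulrDl !mulrDr.
rewrite mulrACA mulrN s2 mulN1r.
have [x0|x0] := leP x 0.
  rewrite (@phiL (x - c j.+1)); last by lra.
  rewrite (@phiL (x - c j.+2)); last by lra.
  by rewrite conj_parity0 !(mul0r, mulr0) !add0r [X in _ = - X]mulrC.
rewrite (@phiR (x + c j.+1)); last by lra.
rewrite (@phiR (x + c j.+2)); last by lra.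
by rewrite conj_parity0 !(mul0r, mulr0) ?oppr0 !addr0.
Qed.

(** For j >= i + 2 the supports are disjoint: [g i] vanishes when the modulus is at least c i + 1/2,
    and [g j] when it is at most c j - 1/2. *)
Let fcoef_wilson_lt m i j : (i < j)%N -> fcoef m (fun xi => g i xi * (g j xi)^*) = 0.
Proof.
rewrite leq_eqVlt => /predU1P[<-|ij]; first exact: fcoef_wilson_succ.
rewrite /fcoef (_ : (fun x => _) = fun=> 0).
  by rewrite /cintegral /= /Rintegral !integral0.
have cij : c i + 1 / 2 <= c j - 1 / 2.
  by have : i.+2%:R <= j%:R :> R; [rewrite ler_nat|rewrite -addn2 natrD /c; lra].
apply/funext => x; have [xi|xi] := leP (c i + 1 / 2) `|x|.
  by rewrite g_large// mul0r mulr0.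
have j0 : (0 < j)%N by exact: leq_trans ij.
rewrite (@g_small j)//; first by rewrite conjc0 !mulr0.
exact: le_trans (ltW xi) cij.
Qed.

(* The Fourier transform of [f j (x - k)]. *)
Definition wilson_mode (kj : int * nat) : T -> R[i] :=
  fun xi => cis (2 * pi * (- kj.1)%:~R * xi) * g kj.2 xi.

Lemma bcs_wilson_mode kj : bcs (wilson_mode kj).
Proof. exact/bcs_cis_mul/bcs_wilson_hat. Qed.

Lemma wilson_mode_ip kj kj' : L2_inner mu (wilson_mode kj) (wilson_mode kj') =
  fcoef (kj'.1 - kj.1) (fun xi => g kj.2 xi * (g kj'.2 xi)^*).
Proof.
rewrite /L2_inner /fcoef; apply: eq_cintegral => x; rewrite /wilson_mode.
have cisJ t : (cis t : R[i])^* = cis (- t).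
  by apply: complexP; rewrite !ReImE/= ?cosN ?sinN.
rewrite conjcM cisJ mulrACA -cisD; congr (cis _ * _).
by rewrite intrD !rmorphN; ring.
Qed.

Lemma wilson_mode_orthonormal kj kj' :
  L2_inner mu (wilson_mode kj) (wilson_mode kj') = (kj == kj')%:R.
Proof.
have lt0 a b : (a.2 < b.2)%N -> L2_inner mu (wilson_mode a) (wilson_mode b) = 0.
  by move=> ab; rewrite wilson_mode_ip fcoef_wilson_lt.
case: kj kj' => k j [k' j'].
have [jj|jj|jj] := ltngtP j j'.
- by rewrite lt0// xpair_eqE (ltn_eqF jj) andbF.
- rewrite xpair_eqE (gtn_eqF jj) andbF ipC ?lt0 ?conjc0//;
  exact/bcs_L2/bcs_wilson_mode.
- rewrite jj wilson_mode_ip fcoef_wilson_diag/= subr_eq0 xpair_eqE eqxx andbT.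
  by rewrite eq_sym.
Qed.

Lemma sqn_wilson_hat_le1 j xi : sqn (g j xi) <= 1.
Proof. exact: sqn_g_le1. Qed.

(** Only the two consecutive centres around x are within 1/2 of it, and their terms add up to 1. The
    function [psi] is kept abstract to cover |phi|^2 for positive frequencies and its reflection for
    negative ones. *)
Let sum_half (psi : R -> R) (x : R) J :
  (forall y, 1 / 2 <= `|y| -> psi y = 0) ->
  (forall y, 0 <= y <= 1 / 2 -> psi y + psi (y - 1 / 2) = 1) ->
  1 / 4 < x -> 2 * x + 1 <= J%:R -> \sum_(j < J) psi (x - c j) = 1.
Proof.
move=> psi0 psi1 x4 xJ.
have x0 : 0 <= 2 * x - 1 / 2 by lra.
(* This j satisfies c j <= x < c (j + 1). *)
have [j /andP[j1 j2]] : exists j : nat, j%:R <= 2 * x - 1 / 2 < j.+1%:R.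
  by eexists; exact: truncn_itv.
have cE i : 2 * c i = i%:R + 1 / 2 by rewrite /c; field.
have jS : j.+1%:R = j%:R + 1 :> R by rewrite -[in LHS]addn1 natrD.
have jJ : (j.+1 < J)%N by rewrite -(ltr_nat R); lra.
rewrite (bigD1 (Ordinal jJ))//= (bigD1 (Ordinal (ltnW jJ)))//=; last first.
  by rewrite -val_eqE/= ltn_eqF.
rewrite big1 => [|i /andP[]]; last first.
  rewrite -!val_eqE/= => ij1 ij; apply: psi0; have := cE i.
  have [ij'|ij'|/eqP] := ltngtP i j; last by rewrite (negPf ij).
    have : i.+1%:R <= j%:R :> R by rewrite ler_nat.
    rewrite -addn1 natrD => h1 h2; rewrite ler_normr; apply/orP; left; lra.
  have : j.+2%:R <= i%:R :> R.
    by rewrite ler_nat ltn_neqAle eq_sym ij1.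
  rewrite -addn2 natrD => h1 h2; rewrite ler_normr; apply/orP; right; lra.
have := cE j; have := cE j.+1 => h1 h2.
have h : 0 <= x - c j <= 1 / 2 by lra.
rewrite addr0 -(psi1 _ h) addrC; congr (_ + psi _); lra.
Qed.

Lemma sum_sqn_wilson_hat xi J : 2 * `|xi| + 1 <= J%:R ->
  \sum_(j < J) sqn (g j xi) = 1.
Proof.
move=> xJ; have [x1|x1] := ltP (1 / 4) xi.
  rewrite -(@sum_half (fun y => sqn (phi y)) xi J); first last.
  - by have := ler_norm xi; lra.
  - by [].
  - move=> y y1 /=; have h : - (1 / 2) <= y - 1 / 2 <= 0 by lra.
    by have := phi1 h; rewrite subrK addrC.
  - by move=> y y1 /=; rewrite phi0// sqn0.
  apply: eq_bigr => -[[|j] _] _ /=; first by rewrite g0E ifT// /c mul0r add0r.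
  rewrite sqn_g// (@phiR (xi + c j.+1)) ?sqn0 ?addr0//.
  by have := c_gt (ltn0Sn j); lra.
have [x2|x2] := ltP xi (- (1 / 4)).
  rewrite -(@sum_half (fun x => sqn (phi (- x))) (- xi) J); first last.
  - by have := ler_norm (- xi); rewrite normrN; lra.
  - by lra.
  - move=> y y1 /=; have h : - (1 / 2) <= - y <= 0 by lra.
    by have := phi1 h; rewrite (_ : - (y - 1 / 2) = - y + 1 / 2)//; lra.
  - by move=> y y1 /=; rewrite phi0 ?sqn0// normrN.
  apply: eq_bigr => -[[|j] _] _ /=.
    by rewrite g0E ltNge (ltW (lt_trans x2 _))/= ?x2 1?/c ?mul0r ?add0r
      ?opprB ?opprK ?[1 / 4 + _]addrC//; lra.
  rewrite sqn_g// (@phiL (xi - c j.+1)) ?sqn0 ?add0r ?opprB ?opprK 1?addrC//.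
  by have := c_gt (ltn0Sn j); lra.
case: J xJ => [|J] xJ; first by have := normr_ge0 xi; move: xJ => /=; lra.
rewrite big_ord_recl big1 ?addr0.
  by rewrite g0E ltNge x1 ltNge x2/= sqn_phi_0.
move=> i _; rewrite /= g_small ?sqn0//.
have := c_gt (ltn0Sn i) => h; rewrite /bump/= add1n.
by rewrite ler_norml; apply/andP; split; lra.
Qed.

End wilson.

Section wilson_density.
Variables (R : realType) (phi : R -> R[i]).
Local Notation mu := (@lebesgue_measure R).
Local Notation T := (measurableTypeR R).
Local Notation g := (wilson_hat phi).
Hypothesis mphi : cmeasurable (phi : T -> R[i]).
Hypothesis phi0 : forall x : R, 1 / 2 <= `|x| -> phi x = 0.
Hypothesis phi1 : forall x : R, - (1 / 2) <= x <= 0 ->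
  sqn (phi x) + sqn (phi (x + 1 / 2)) = 1.

(* On an interval of length 1 the inner products of [h] with the modes of
   index [j] are the Fourier coefficients of [h] times the conjugate of [g j]. *)
Let approx_unit (l : R) (h : T -> R[i]) : L2 mu h ->
  (forall x, ~ `[l, l + 1[%classic x -> h x = 0) ->
  approx mu (wilson_mode phi) h.
Proof.
move=> Lh h0.
have Lm kj : L2 mu (wilson_mode phi kj) by exact/bcs_L2/bcs_wilson_mode.
apply: parseval_approx => //.
  by move=> *; exact: (wilson_mode_orthonormal mphi phi0 phi1).
move=> eps e0.
(* Over a bounded interval finitely many indices j suffice, with one J for all its points. *)
have [J JE] : exists J, forall x : R, `[l, l + 1[%classic x -> 2 * `|x| + 1 <= J%:R.
  have b0 : 0 <= 2 * (`|l| + 1) + 1 by rewrite addr_ge0// mulr_ge0// addr_ge0.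
  exists (Num.bound (2 * (`|l| + 1) + 1)) => x.
  rewrite /= in_itv/= => /andP[x1 x2]; apply/ltW/le_lt_trans/(archi_boundP b0).
  rewrite lerD2r ler_pM2l// -[x](subrK l) addrC (le_trans (ler_normD _ _))// lerD2l.
  by rewrite ger0_norm ?subr_ge0// lerBlDl ltW.
pose u j (x : T) : R[i] := (g j x)^* * h x.
have mg j : cmeasurable (fun x : T => (g j x)^*).
  exact/cmeasurableJ/(cmeasurable_wilson_hat mphi).
have Lu j : L2 mu (u j).
  apply: (L2M_bounded (mg j) (C := 1)) => // x.
  by rewrite sqn_conjc (sqn_wilson_hat_le1 phi0 phi1).
have u0 j x : ~ `[l, l + 1[%classic x -> u j x = 0.
  by move=> /h0; rewrite /u => ->; rewrite mulr0.
have hE : n2 mu h = \sum_(j < J) n2 mu (u j).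
  apply: EFin_inj; rewrite -sumEFin -nsqE//.
  rewrite (eq_bigr (fun j : 'I_J => nsq mu (u j))) => [|j _]; last by rewrite nsqE.
  rewrite /nsq -ge0_integral_sum//.
  - apply: eq_integral => x _; rewrite sumEFin; congr EFin.
    have [Ix|Ix] := pselect (`[l, l + 1[%classic x); last first.
      by rewrite h0// sqn0 big1// => j _; rewrite u0// sqn0.
    under eq_bigr do rewrite sqnM sqn_conjc.
    by rewrite -mulr_suml (sum_sqn_wilson_hat phi0 phi1 (JE _ Ix)) mul1r.
  - by move=> j; apply: measurable_sqnE; case: (Lu j).
  - by move=> j x _; rewrite lee_fin sqn_ge0.
have cv : \sum_(j < J) \sum_(k <- window N) sqn (L2_inner mu (u j) (trig l 1 k))
    @[N --> \oo] --> n2 mu h.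
  rewrite hE; apply: cvg_big => [|j _]; first exact: add_continuous.
  exact: (trig_parseval ltr01 (Lu j) (u0 j)).
have /cvgrPdist_lt/(_ _ e0)[N _ /(_ N (leqnn _))/=] := cv.
rewrite ltr_norml => /andP[_]; rewrite ltrBlDr -ltrBlDl => hN.
(* The sign is reversed because translation by k has frequency -k in [wilson_mode]. *)
exists [seq (- k, j) | k <- window N, j <- iota 0 J].
  apply: allpairs_uniq; [exact: window_uniq|exact: iota_uniq|].
  by move=> [k j] [k' j'] _ _ /= [/oppr_inj -> ->].
rewrite big_allpairs_dep/= exchange_big/=.
rewrite -{1}[J]subn0 -/(index_iota 0 J) big_mkord.
apply: lt_le_trans hN _; apply: ler_sum => j _; apply: ler_sum => k _.
rewrite le_eqVlt; apply/orP; left; apply/eqP; congr sqn.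
apply: eq_cintegral => x; rewrite /u /trig /wilson_mode opprK.
have [Ix|Ix] := pselect (`[l, l + 1[%classic x); last by rewrite h0// !(mulr0, mul0r).
rewrite cindT// mulr1 !conjcM -mulrA mulrCA; congr (_ * _).
have -> : rsqrtL 1 = 1 :> R by rewrite /rsqrtL sqrtr1 invr1.
rewrite conjcR mul1r mulrC /expi; congr ((cis _)^* * _).
by rewrite divr1.
Qed.

Lemma wilson_mode_basis : is_basis mu (wilson_mode phi).
Proof.
have Lm kj : L2 mu (wilson_mode phi kj) by exact/bcs_L2/bcs_wilson_mode.
split=> //.
  by move=> *; exact: (wilson_mode_orthonormal mphi phi0 phi1).
move=> h Lh; have cP := approx_csub Lm.
pose I : set T := `[0%R, 1%R[%classic.
have mI (k : R) : cmeasurable (fun x : T => cind I (x - k : T) : R[i]).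
  apply: (@cmeasurable_shift R (- k) (cind I)).
  by apply: cmeasurable_cind; exact: measurable_itv.
pose w N (x : T) : R[i] := \sum_(k <- window N) (cind I (x - k%:~R : T) * h x).
have E N x : w N x = (Num.floor x \in window N)%:R * h x.
  rewrite /w -mulr_suml; congr (_ * _).
  transitivity (((Num.floor x \in window N)%:R : R)%:C); last by case: (_ \in _).
  have := window_tile N x (@ltr01 R); rewrite divr1 => <-.
  rewrite /cind rmorph_sum/=; apply: eq_bigr => k _.
  by rewrite mulr1.
apply: (csub_dct (g := w) (G := fun x => sqn (h x)) cP Lh).
- move=> N; apply: (csub_sum cP) => k _.
  apply: (@approx_unit k%:~R) => [|x Ix].
    apply: (L2M_bounded (C := 1)) => // x.
    by rewrite sqn_cind indicE; case: (_ \in _); rewrite ?ler01.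
  rewrite cindF ?mul0r//; apply: contra_not Ix.
  by rewrite /I/= !in_itv/= subr_ge0 ltrBlDl.
- exact: L2_integrable_sqn.
- move=> N x; rewrite E; case: (_ \in _); rewrite ?mul1r ?mul0r ?subr0//.
  by rewrite subrr sqn0 sqn_ge0.
- move=> x; apply: cvg_near_cst; exists (absz (Num.floor x)).+1 => // N /= fN.
  rewrite E (_ : _ \in _ = true) ?mul1r ?subrr ?sqn0//.
  by move: fN; move: (Num.floor _) => k; rewrite mem_window; lia.
Qed.

End wilson_density.

(** * Consequences of the conditions on phi *)

Section wilson_window_function.
Variables (R : realType) (phi : R -> R[i]).
Local Notation T := (measurableTypeR R).
Hypothesis cphi : continuous (fun x => complex.Re (phi x)) /\
  continuous (fun x => complex.Im (phi x)).

Lemma continuous_cmeasurable : cmeasurable (phi : T -> R[i]).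
Proof. by case: cphi => c1 c2; split; exact: continuous_measurable_fun. Qed.

(** Beyond the interval the value is 0 by the support condition; the endpoints follow by
    continuity. *)
Lemma closure_support_eq0 (r : R) :
  closure [set x | phi x != 0] `<=` `[- r, r] ->
  forall x, r <= `|x| -> phi x = 0.
Proof.
move=> supp x rx.
have out y : r < `|y| -> phi y = 0.
  move=> ry; apply/eqP; apply: contraT => py.
  have /supp : closure [set x | phi x != 0] y by exact: subset_closure.
  by rewrite /= in_itv/= -ler_norml leNgt ry.
have zero (p : R[i] -> R) : p 0 = 0 -> {for x, continuous (fun x => p (phi x))} ->
    p (phi x) = 0.
  move=> p0 cp; apply/eqP; apply: contraT; rewrite -normr_gt0 => px.
  have /nbhs_ballP[e /= e0 H] : \forall y \near x, `|p (phi x) - p (phi y)| < `|p (phi x)|.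
    by move/cvgrPdist_lt : cp; exact.
  (* Move away from the origin by less than the radius e, to a point where phi is already known to
     vanish. *)
  pose y := x + (if 0 <= x then e / 2 else - (e / 2)).
  have yx : r < `|y|.
    apply: le_lt_trans rx _; rewrite /y; case: (lerP 0 x) => x0.
      by rewrite !ger0_norm ?addr_ge0//; lra.
    by rewrite !ler0_norm//; lra.
  have : `|p (phi x) - p (phi y)| < `|p (phi x)|.
    apply: H; rewrite /ball/= /y opprD addrA subrr sub0r normrN.
    by case: ifP => _; rewrite ?normrN gtr0_norm; lra.
  by rewrite (out y yx) p0 subr0 ltxx.
have [c1 c2] := cphi.
by apply: complexP; [exact: (zero _ _ (c1 x))|exact: (zero _ _ (c2 x))].
Qed.

(** For x in [-1/2, 0], the point x + k/2 is at least 1/2 when k >= 2 and at most -1/2 when k <= -1,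
    so only k = 0 and k = 1 contribute. *)
Lemma two_term_partition :
  (forall x : R, 1 / 2 <= `|x| -> phi x = 0) ->
  (forall x : R, \esum_(k in [set: int]) ((normc (phi (x + k%:~R / 2))) ^+ 2)%:E = 1%E) ->
  forall x : R, - (1 / 2) <= x <= 0 -> sqn (phi x) + sqn (phi (x + 1 / 2)) = 1.
Proof.
move=> phi0 phi_sum x /andP[x1 x2]; apply: EFin_inj; rewrite -(phi_sum x).
pose a (k : int) : \bar R := (sqn (phi (x + k%:~R / 2)))%:E.
have a0 k : (0 <= a k)%E by rewrite lee_fin sqn_ge0.
rewrite (eq_esum (b := fun k : int => ((if k \in [set 0%R] then a k else 0) +
  (if k \in [set 1%R] then a k else 0))%E)); last first.
  move=> k _; rewrite normc_sqr -/(a k).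
  have [->|k0] := eqVneq k 0.
    by rewrite mem_set// memNset ?adde0// => /= /eqP.
  have [->|k1] := eqVneq k 1.
    by rewrite memNset ?mem_set ?add0e// => /= /eqP.
  rewrite !memNset /=; [|exact/eqP|exact/eqP].
  rewrite adde0 /a phi0 ?sqn0//.
  have [k2|k2] := leP 2 k.
    have : 2%:~R <= k%:~R :> R by rewrite ler_int.
    move=> h; rewrite ger0_norm; first by move: h => /=; lra.
    by move: h => /=; lra.
  have : k%:~R <= (-1)%:~R :> R by rewrite ler_int; lia.
  rewrite rmorphN1 => h; rewrite ler0_norm; lra.
have m0 (l : int) k : (0 <= if k \in [set l] then a k else 0)%E by case: ifP.
rewrite esumD// -!esum_mkcond !esum_set1// /a mul0r addr0 -EFinD.
by rewrite (_ : 1%:~R / 2 = 1 / 2).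
Qed.

End wilson_window_function.

(** * Return from the Fourier side and conclusion *)

Section fourier_transfer.
Variable R : realType.
Local Notation mu := (@lebesgue_measure R).
Local Notation T := (measurableTypeR R).

Lemma trunc_cintegrable_L2 N (u : T -> R[i]) : L2 mu u ->
  cintegrable mu (trunc N u) /\ L2 mu (trunc N u).
Proof.
move=> Lu; split; last by apply: L2M_cind => //; exact: measurable_itv.
have := L2_cintegrable Lu (bcs_L2 (bcs_cind (- N%:R) (- N%:R + N.*2%:R))).
by congr cintegrable; apply/funext => x; rewrite conjcR.
Qed.

(** Orthonormality is transferred by polarization. For totality, a truncation w of h has a
    transform, which is approximated by a combination of the [E i]; the same combination of the
    [e i] approximates w equally well, since the two errors form a Fourier pair. *)
Lemma is_basis_fourier (I : eqType) (e E : I -> T -> R[i]) :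
  (forall i, fourier_pair (e i) (E i)) -> is_basis mu E -> is_basis mu e.
Proof.
move=> eE [LE oE aE].
have Le i : L2 mu (e i) by case: (eE i).
have cP := approx_csub Le.
split=> //; first by move=> i j; rewrite (fourier_pair_ip (eE i) (eE j)).
move=> h Lh; apply: (csub_lim cP) => // eps e0.
have [N hN] := trunc_cvg Lh e0; exists (trunc N h) => //.
have [iw Lw] := trunc_cintegrable_L2 N Lh; move: (trunc N h) iw Lw => w iw Lw.
have pw := fourier_pair_self iw Lw.
split=> // eps' e0'.
have [G sG wG] := (aE _ (L2_fourier iw Lw)).2 _ e0'.
have [G' sG' GG'] : exists2 G', span e G' & fourier_pair G' G.
  elim: sG => [|i c G1 _ [G2 sG2 pG2]].
    exists (fun=> 0); first exact: span_0.
    (* The zero pair, obtained as 0 times the pair of w. *)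
    by have := fourier_pairZ 0 pw; congr fourier_pair; apply/funext => x; rewrite mul0r.
  exists (fun x => c * e i x + G2 x); first exact: span_cons.
  exact: fourier_pairD (fourier_pairZ c (eE i)) pG2.
exists G' => //.
have := fourier_pairD pw (fourier_pairZ (-1) GG').
rewrite (_ : (fun x => w x + -1 * G' x) = (fun x => w x - G' x)); last first.
  by apply/funext => x; rewrite mulN1r.
rewrite (_ : (fun x => fourier w x + -1 * G x) = (fun x => fourier w x - G x)); last first.
  by apply/funext => x; rewrite mulN1r.
move=> p; have [L1 L2 _] := p.
by rewrite (nsqE L1) (fourier_pair_n2 p) -(nsqE L2).
Qed.

End fourier_transfer.

Section wilson_basis.
Variables (R : realType) (phi : R -> R[i]) (f : nat -> R -> R[i]).
Local Notation mu := (@lebesgue_measure R).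
Local Notation T := (measurableTypeR R).

Lemma wilson_basis : is_basis mu (wilson_mode phi) ->
  (forall j, is_fourier_L2 (f j) (wilson_hat phi j)) ->
  is_basis mu (fun (kj : int * nat) (x : T) => f kj.2 (x - kj.1%:~R)).
Proof.
move=> bE f_hat; apply: is_basis_fourier bE => -[k j].
have := fourier_pair_shift (- k)%:~R (is_fourier_L2_pair (f_hat j)).
by congr fourier_pair; apply/funext => x; rewrite rmorphN.
Qed.

End wilson_basis.

Lemma is_basis_reindex d (T : measurableType d) (R : realType)
    (mu : {measure set T -> \bar R}) (I J : eqType) (e : I -> T -> R[i])
    (s : J -> I) (s' : I -> J) : cancel s s' -> cancel s' s ->
  is_basis mu e -> is_basis mu (e \o s).
Proof.
move=> sK s'K [Le oe ae]; split=> [j|i j|h /ae]; first exact: Le.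
  by rewrite /= oe (can_eq sK).
apply: csub_approx; first by apply: approx_csub => j; exact: Le.
move=> i; rewrite -(s'K i).
by apply: (@approx_gen _ _ _ _ _ (e \o s) (s' i)); exact: Le.
Qed.

Theorem theorem2p6 (R : realType) (phi : R -> R[i]) (delta : R)
  (phi_smooth : smooth phi)
  (delta_gt0 : 0 < delta) (delta_le : delta <= 1 / 4)
  (phi_supp : closure [set xi | phi xi != 0] `<=`
     `[- (1 / 4) - delta, 1 / 4 + delta])
  (phi_sum : forall xi : R,
     \esum_(k in [set: int]) ((normc (phi (xi + k%:~R / 2))) ^+ 2)%:E = 1%E)
  (phi_flat : forall m : nat, (1 <= m)%N -> cderiv1n m phi 0 = 0)
  (f : nat -> R -> R[i])
  (f_hat : forall j : nat, is_fourier_L2 (f j) (wilson_hat phi j))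
  (n : nat) (n_ge1 : (1 <= n)%N) :
  orthonormal_basis_L2 (@lebesgue_measure_n R n)
    (fun kj : n.-tuple int * n.-tuple nat => translate kj.1 (tensor f kj.2)).
Proof.
have cphi : continuous (fun x => complex.Re (phi x)) /\
    continuous (fun x => complex.Im (phi x)).
  by split=> x; have [dr di] := phi_smooth 0 x;
    exact/differentiable_continuous/derivable1_diffP.
have phi0 : forall x, 1 / 2 <= `|x| -> phi x = 0.
  apply: closure_support_eq0 cphi _ _ => x /phi_supp.
  by rewrite /= !in_itv/= => /andP[x1 x2]; apply/andP; split; lra.
have phi1 := two_term_partition phi0 phi_sum.
have bE := wilson_mode_basis (continuous_cmeasurable cphi) phi0 phi1.
have bn := tensor_family_basis (wilson_basis bE f_hat) n.
(* The product basis is indexed by tuples of pairs, the Wilson system by pairs of tuples. *)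
pose zip_t (kj : n.-tuple int * n.-tuple nat) : n.-tuple (int * nat) :=
  [tuple (tnth kj.1 i, tnth kj.2 i) | i < n].
pose unzip_t (J : n.-tuple (int * nat)) : n.-tuple int * n.-tuple nat :=
  ([tuple (tnth J i).1 | i < n], [tuple (tnth J i).2 | i < n]).
have zipK : cancel zip_t unzip_t.
  by move=> [k j]; congr pair; apply: eq_from_tnth => i; rewrite !tnth_mktuple.
have unzipK : cancel unzip_t zip_t.
  move=> J; apply: eq_from_tnth => i; rewrite !tnth_mktuple.
  by case: (tnth J i).
apply: is_basis_orthonormal_basis; have := is_basis_reindex zipK unzipK bn.
congr is_basis; apply/funext => kj; apply/funext => x.
by apply: eq_bigr => i _; rewrite !tnth_mktuple.
Qed.
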